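(* Let $D\subset\mathbb R^d$ be a bounded open set with $0\in D$, let $D_*:=D\setminus\{0\}$ and let $p>1$. Suppose that $u\in\mathscr T_\nu(D_* )\cap L^p_{\mathrm{loc}}(D_* )$ is positive (i.e. $u\ge 0$) and satisfies $-Lu=u^p$ in $\mathscr D'(D_* )$. Then $u\in\mathscr T_\nu(D)\cap L^p_{\mathrm{loc}}(D)$ and there exists a constant $k\ge 0$ such that \[ -Lu=u^p+k\delta_0\quad\text{in }\mathscr D'(D), \] where $\delta_0$ is the Dirac mass at $0$. Furthermore, if $p\ge \frac{d}{d-2s}$, then $k=0$.
   Context: Setting. Fix $d\ge1$ and $s\in(0,1)$ with $2s<d$. $L$ is the generator of a strictly $2s$-stable Lévy process on $\mathbb R^d$: for $u\in C_c^2(\mathbb R^d)$, \[ Lu(x)=b\cdot\nabla u(x)+\int_{\mathbb R^d}\bigl(u(x+y)-u(x)-y\cdot\nabla u(x)\mathbf 1_{B(0,1)}(y)\bigr)\nu(dy), \] with $b\in\mathbb R^d$ and $\nu$ a Lévy measure (not necessarily symmetric), such that $L[u(a\,\cdot)](x)=a^{2s}(Lu)(ax)$ for all $a>0$, $u\in C_c^2(\mathbb R^d)$. The Lévy measure has the form $\nu(B)=\int_{\mathbb S^{d-1}}\lambda(d\theta)\int_0^\infty\mathbf 1_B(r\theta)\frac{dr}{r^{1+2s}}$ with $\lambda$ a finite positive Borel measure on $\mathbb S^{d-1}$, and for some $\Lambda>0$, $\inf_{\xi\in\mathbb S^{d-1}}\int_{\mathbb S^{d-1}}|\xi\cdot\theta|^{2s}\lambda(d\theta)\ge\Lambda$.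 If $s<1/2$ it is additionally assumed that the Green function $G$ of $L$ on $\mathbb R^d$ (the kernel with $\mathbb E_x\int_0^\infty f(X_t)dt=\int G(x,y)f(y)dy$ for Borel $f\ge0$, $X$ being the Lévy process generated by $L$, where $G(\cdot,y)$ is excessive for $X$ and $G(x,\cdot)$ is excessive for the dual process) is strictly positive on $\mathbb R^d\times\mathbb R^d$; this holds e.g. if the cone generated by the convex hull of $\operatorname{supp}\lambda$ is $\mathbb R^d$. $L^*$ is the operator of the same form with $(b,\nu)$ replaced by $(-b,\nu^* )$, $\nu^*(B)=\nu(-B)$. Tail space. For open $V\subset\mathbb R^d$ and compact $K\subset V$ let $r_{K,V}:=(2\operatorname{dist}(K,V^c))\wedge1$ and \[ \rho_{K,V}(x):=\nu\bigl(B_{r_{K,V}}^c\cap(K-x)\bigr)+\nu\bigl(B_{r_{K,V}}^c\cap(x-K)\bigr), \] where $B_r=\{|y|<r\}$. $\mathscr T_\nu(V)$ is the space of measurable functions $u$ on $\mathbb R^d$ with $\int_{\mathbb R^d}|u|\rho_{K,V}\,dx<\infty$ for every compact $K\subset V$. (One has $\mathscr T_\nu(V)\subset L^1_{\mathrm{loc}}(V)$, and $\int_{\mathbb R^d}|u||L^*\eta|<\infty$ for $u\in\mathscr T_\nu(V)$, $\eta\in C_c^2(V)$.) For $u\in\mathscr T_\nu(V)$ and a Radon measure $\mu$ on $V$ (a function $f\in L^1_{\mathrm{loc}}(V)$ being identified with $f\,dx$), ''$-Lu=\mu$ in $\mathscr D'(V)$'' means $-\int_{\mathbb R^d}u\,L^*\eta\,dx=\int_V\eta\,d\mu$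 for all $\eta\in C_c^\infty(V)$. *)

(* Defs.v *)
From HB Require Import structures.
From mathcomp Require Import all_boot all_order all_algebra.
From mathcomp Require Import all_classical all_reals all_analysis.
From mathcomp Require Import measurable_realfun.

Set Implicit Arguments.
Unset Strict Implicit.
Unset Printing Implicit Defensive.

Import Order.TTheory GRing.Theory Num.Def Num.Theory.
Import numFieldNormedType.Exports.

Local Open Scope classical_set_scope.
Local Open Scope ring_scope.

(* R^d is ['rV[R]_d], with its Borel sigma-algebra. The library norm on it is
   the sup norm; it is used below only for topological notions. *)
HB.instance Definition _ (R : realType) (d : nat) :=
  Measurable.copy 'rV[R]_d (g_sigma_algebraType (@open 'rV[R]_d)).

Section borel.
Context {R : realType} {d : nat}.

Lemma measurable_rVE : @measurable _ 'rV[R]_d = <<s open >>.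
Proof. by []. Qed.

Lemma open_measurable_rV (U : set 'rV[R]_d) : open U -> measurable U.
Proof. exact: sub_sigma_algebra. Qed.

End borel.

Section borel_maps.
Context {R : realType} {d : nat}.

Lemma continuous_measurable_rV d' (f : 'rV[R]_d -> 'rV[R]_d') :
  continuous f -> measurable_fun setT f.
Proof.
move=> cf; apply: (measurability _ (@measurable_rVE R _)) => _ [U oU <-].
rewrite setTI; apply: open_measurable_rV.
by move/continuousP : cf; apply.
Qed.

(* Coordinatewise measurability suffices, i.e. the Borel sigma-algebra is the
   product one. *)
Lemma measurable_fun_rV dT (T : measurableType dT) (f : T -> 'rV[R]_d) :
  (forall i, measurable_fun setT (fun t => f t ord0 i)) ->
  measurable_fun setT f.
Proof.
move=> mf; apply: (measurability _ (@measurable_rVE R _)) => _ [U oU <-]; rewrite setTI.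
pose q (v : 'rV[rat]_d) : 'rV[R]_d := map_mx ratr v.
pose I := ('rV[rat]_d * nat)%type.
pose good (j : I) := ball (q j.1) (j.2.+1%:R^-1) `<=` U.
have -> : U = \bigcup_(j in good) ball (q j.1) (j.2.+1%:R^-1).
  apply/seteqP; split => [x Ux|x [j gj]]; last exact: gj.
  have /nbhs_ballP[e /= e0 xeU] := open_nbhs_nbhs (conj oU Ux).
  have [n ne] : exists n, n.+1%:R^-1 *+ 2 < e.
    have /= e2 : 0 < e / 2 by rewrite divr_gt0.
    exists (Num.truncn (e / 2)^-1).
    have n2 : (Num.truncn (e / 2)^-1).+1%:R^-1 < e / 2.
      by rewrite -[ltRHS]invrK ltf_pV2 ?posrE ?invr_gt0// truncnS_gt.
    by rewrite mulr2n [ltRHS]splitr ltrD.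
  have n0 : 0 < n.+1%:R^-1 :> R by rewrite invr_gt0.
  have /choice[v Hv] : forall i : 'I_d, exists r : rat,
      `|x ord0 i - ratr r| < n.+1%:R^-1.
    move=> i; have [r rP] : exists r : rat,
        ratr r \in `](x ord0 i - n.+1%:R^-1), (x ord0 i + n.+1%:R^-1)[.
      by apply: rat_in_itvoo; rewrite ltrD2l gtrN.
    by exists r; rewrite ltr_distlC; move: rP; rewrite in_itv.
  have Hq : ball (q (\row_i v i)) n.+1%:R^-1 x.
    by split => // i j; rewrite !mxE (ord1 i) /ball/= distrC; exact: Hv.
  exists (\row_i v i, n) => // y /= Hy; apply: xeU.
  have := ball_triangle (ball_sym Hq) Hy.
  by apply: le_ball; rewrite -mulr2n ltW.
rewrite preimage_bigcup.
have -> : \bigcup_(j in good) f @^-1` ball (q j.1) (j.2.+1%:R^-1) =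
          \bigcup_j (if `[< good j >]
            then f @^-1` ball (q j.1) (j.2.+1%:R^-1) else set0).
  apply/seteqP; split => t [j gj fj]; exists j => //.
    by rewrite (asboolT gj).
  - by move: fj; case: asboolP.
  - by move: fj; case: asboolP.
apply: countable_bigcupT_measurable; first exact: countableP.
move=> [v n]; case: ifPn => _ //=.
have -> : f @^-1` ball (q v) n.+1%:R^-1 =
  \bigcap_(i in [set: 'I_d])
    (fun t => f t ord0 i) @^-1` ball (ratr (v ord0 i) : R) n.+1%:R^-1.
  apply/seteqP; split => [t [_ ft] i _|t ft].
    by have := ft ord0 i; rewrite !mxE.
  split; first by rewrite invr_gt0.
  by move=> i j; rewrite (ord1 i) mxE; exact: ft.
apply: fin_bigcap_measurable => // i _.
rewrite -[X in measurable X]setTI; apply: mf => //.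
by rewrite ball_itv; exact: measurable_itv.
Qed.


End borel_maps.

Section lebesgue.
Context {R : realType}.

Definition vcons d (p : 'rV[R]_d * R) : 'rV[R]_d.+1 :=
  \row_i oapp (p.1 ord0) p.2 (unlift ord0 i).

Lemma measurable_coord d (i : 'I_d) :
  measurable_fun setT (fun x : 'rV[R]_d => x ord0 i).
Proof.
apply: (measurability _ (RGenOpens.measurableE R)) => _ [_ [a [b ->] <-]].
rewrite setTI; apply: open_measurable_rV.
by apply: open_comp; [move=> x _; exact: coord_continuous|exact: interval_open].
Qed.

Lemma measurable_vcons d : measurable_fun setT (@vcons d).
Proof.
apply: measurable_fun_rV => i; rewrite /vcons.
under eq_fun do rewrite mxE.
case: (unlift ord0 i) => [j|] /=; last exact: measurable_snd.
exact: (measurableT_comp (f := fun x : 'rV[R]_d => x ord0 j)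
  (measurable_coord j) measurable_fst).
Qed.

Lemma oppr_measurable_rV d : measurable_fun setT (-%R : 'rV[R]_d -> 'rV[R]_d).
Proof. by apply: continuous_measurable_rV => x; exact: opp_continuous. Qed.

Definition image_measure d1 d2 (T1 : measurableType d1) (T2 : measurableType d2)
    (m : {measure set T1 -> \bar R}) (f : T1 -> T2)
    (mf : measurable_fun [set: T1] f) : {measure set T2 -> \bar R} :=
  @measure_function_pushforward__canonical__measure_function_Measure
    _ _ _ _ _ m f mf.

(* d-dimensional Lebesgue measure, as an iterated product *)
Fixpoint leb (d : nat) : {measure set 'rV[R]_d -> \bar R} :=
  match d return {measure set 'rV[R]_d -> \bar R} with
  | 0%N => dirac (0 : 'rV[R]_0)
  | d'.+1 => image_measure (leb d' \x lebesgue_measure)%E (@measurable_vcons d')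
  end.

Lemma leb_cylinder d (A : 'I_d -> set R) : (forall i, measurable (A i)) ->
  leb d [set x | forall i, A i (x ord0 i)] =
  (\prod_i lebesgue_measure (A i))%E.
Proof.
elim: d A => [|d IH] A mA.
  by rewrite big_ord0 /= diracE mem_set// => -[].
rewrite big_ord_recl muleC /= /pushforward.
have -> : @vcons d @^-1` [set x | forall i, A i (x ord0 i)] =
    [set v : 'rV[R]_d | forall i, A (lift ord0 i) (v ord0 i)] `*` A ord0.
  apply/seteqP; split => [[v r] /= H|[v r] /= [Hv Hr] i].
    split => [i|].
      by have := H (lift ord0 i); rewrite mxE liftK.
    by have := H ord0; rewrite mxE unlift_none.
  by rewrite mxE; case: unliftP => [k|] -> //=.
have mB : measurable [set v : 'rV[R]_d | forall i, A (lift ord0 i) (v ord0 i)].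
  rewrite (_ : mkset _ = \bigcap_(i in [set: 'I_d])
      (fun v : 'rV[R]_d => v ord0 i) @^-1` A (lift ord0 i)).
    apply: fin_bigcap_measurable => // i _.
    by rewrite -[X in measurable X]setTI; apply: measurable_coord.
  by apply/seteqP; split => v Hv i *; exact: Hv.
rewrite product_measure1E//.
by congr (_ * _)%E; exact: IH.
exact: mA.
Qed.

End lebesgue.

Section euclid.
Context {R : realType} {d : nat}.
Implicit Types x y : 'rV[R]_d.

Definition dot x y : R := \sum_i x ord0 i * y ord0 i.

Definition enorm x : R := Num.sqrt (dot x x).

Definition sphere : set 'rV[R]_d := [set x | enorm x = 1].

(* equal to +oo if K or F is empty *)
Definition edistance (K F : set 'rV[R]_d) : \bar R :=
  ereal_inf [set (enorm (x - y))%:E | x in K & y in F].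

End euclid.

Section test_functions.
Context {R : realType} {d : nat}.
Implicit Types u : 'rV[R]_d -> R.

Definition partial (i : 'I_d) u : 'rV[R]_d -> R := 'D_(delta_mx ord0 i) u.

Definition grad u (x : 'rV[R]_d) : 'rV[R]_d := \row_i partial i u x.

Fixpoint Ck (k : nat) u : Prop :=
  continuous u /\
  if k is k'.+1 then
    forall i, (forall x, derivable u x (delta_mx ord0 i)) /\ Ck k' (partial i u)
  else True.

Definition supp u : set 'rV[R]_d := closure [set x | u x != 0].

Definition Cck (k : nat) (V : set 'rV[R]_d) u : Prop :=
  [/\ Ck k u, compact (supp u) & supp u `<=` V].

Definition Ccinfty (V : set 'rV[R]_d) u : Prop := forall k, Cck k V u.

End test_functions.

Section operator.
Context {R : realType} {d : nat}.
Implicit Types (b : 'rV[R]_d) (nu : {measure set 'rV[R]_d -> \bar R}).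

Definition levy_measure nu : Prop :=
  nu [set 0] = 0%E /\
  (\int[nu]_y (Num.min 1 (enorm y ^+ 2))%:E < +oo)%E.

Definition levy_op b nu (u : 'rV[R]_d -> R) (x : 'rV[R]_d) : R :=
  dot b (grad u x) +
  \int[nu]_y (u (x + y) - u x -
              dot y (grad u x) * \1_[set z | enorm z < 1] y).

Definition refl_measure nu : {measure set 'rV[R]_d -> \bar R} :=
  image_measure nu (@oppr_measurable_rV R d).

Definition levy_op_dual b nu : ('rV[R]_d -> R) -> 'rV[R]_d -> R :=
  levy_op (- b) (refl_measure nu).

Definition strictly_stable (s : R) b nu : Prop :=
  forall a : R, 0 < a -> forall u, Cck 2 setT u -> forall x,
    levy_op b nu (fun z => u (a *: z)) x = a `^ (2 * s) * levy_op b nu u (a *: x).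

Definition polar_form (s : R) (lam : set 'rV[R]_d -> \bar R) nu : Prop :=
  forall B, measurable B ->
    nu B = (\int[lam]_(theta in sphere) \int[lebesgue_measure]_(r in `]0%R, +oo[)
              (\1_B (r *: theta) / r `^ (1 + 2 * s))%:E)%E.

End operator.

Section levy_process.
Context {R : realType} {d : nat} {dO : measure_display} {Omega : measurableType dO}.
Variables (P : probability Omega R) (X : R -> Omega -> 'rV[R]_d).

(* Time is [0, +oo[; the values of X at negative times are irrelevant. *)
Record levy_process : Prop := {
  levy_measurable : forall t, 0 <= t -> measurable_fun setT (X t) ;
  levy_start : forall w, X 0 w = 0 ;
  levy_independent : forall (t : R^nat) (A : (set 'rV[R]_d)^nat) (n : nat),
    0 <= t 0%N -> {homo t : i j / (i <= j)%N >-> i <= j} ->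
    (forall i, measurable (A i)) ->
    P [set w | forall i, (i < n)%N -> A i (X (t i.+1) w - X (t i) w)] =
    (\prod_(i < n) P [set w | A i (X (t i.+1) w - X (t i) w)%R])%E ;
  levy_stationary : forall t h, 0 <= t -> 0 <= h ->
    forall A, measurable A ->
      P [set w | A (X (t + h) w - X t w)] = P [set w | A (X h w)] ;
  levy_right_continuous : forall w t, 0 <= t ->
    X r w @[r --> t^'+] --> X t w ;
  levy_left_limit : forall w t, 0 < t -> cvg (X r w @[r --> t^'-])
}.

(* L is the restriction to C_c^2 of the generator of the Feller semigroup of X,
   hence the uniform convergence. *)
Definition generated_by (L : ('rV[R]_d -> R) -> 'rV[R]_d -> R) : Prop :=
  forall u, Cck 2 setT u -> forall e : R, 0 < e -> exists2 h : R, 0 < h &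
    forall t x, 0 < t < h ->
      `|((\int[P]_w u (x + X t w)) - u x) / t - L u x| <= e.

(* Under P_x the process is x + X. *)
Definition transition (t : R) (f : 'rV[R]_d -> \bar R) (x : 'rV[R]_d) : \bar R :=
  (\int[P]_w f (x + X t w)%R)%E.

Record excessive (f : 'rV[R]_d -> \bar R) : Prop := {
  excessive_measurable : measurable_fun [set: 'rV[R]_d] f ;
  excessive_ge0 : forall x, (0 <= f x)%E ;
  excessive_le : forall t x, 0 <= t -> (transition t f x <= f x)%E ;
  excessive_cvg : forall x, transition t f x @[t --> 0^'+] --> f x
}.

End levy_process.

Section green.
Context {R : realType} {d : nat} {dO : measure_display} {Omega : measurableType dO}.
Variables (P : probability Omega R) (X : R -> Omega -> 'rV[R]_d).

(* The dual process is - X. *)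
Record green_function (G : 'rV[R]_d -> 'rV[R]_d -> \bar R) : Prop := {
  green_occupation : forall f : 'rV[R]_d -> \bar R,
    measurable_fun [set: 'rV[R]_d] f -> (forall y, (0 <= f y)%E) -> forall x,
    (\int[P]_w \int[lebesgue_measure]_(t in `[0%R, +oo[) f (x + X t w)%R =
     \int[leb d]_y (G x y * f y))%E ;
  green_excessive : forall y, excessive P X (G ^~ y) ;
  green_coexcessive : forall x, excessive P (fun t w => - X t w) (G x)
}.

End green.

Section equation.
Context {R : realType} {d : nat}.
Implicit Types (b : 'rV[R]_d) (nu : {measure set 'rV[R]_d -> \bar R}).
Implicit Types (K V : set 'rV[R]_d) (u f : 'rV[R]_d -> R).

Definition tail_radius K V : R :=
  fine (Order.min (2%:E * edistance K (~` V))%E 1%E).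

Definition tail_weight nu K V (x : 'rV[R]_d) : \bar R :=
  (nu [set y | (tail_radius K V <= enorm y)%R /\ K (y + x)%R] +
   nu [set y | (tail_radius K V <= enorm y)%R /\ K (x - y)%R])%E.

Definition tail_space nu V u : Prop :=
  measurable_fun setT u /\
  forall K, compact K -> K `<=` V ->
    (\int[leb d]_x (`|u x|%:E * tail_weight nu K V x) < +oo)%E.

Definition Lploc (p : R) V u : Prop :=
  measurable_fun V u /\
  forall K, compact K -> K `<=` V ->
    (\int[leb d]_(x in K) (`|u x| `^ p)%:E < +oo)%E.

(* For f >= 0 measurable this is the measure f dx. *)
Definition density f : set 'rV[R]_d -> \bar R :=
  fun A => (\int[leb d]_(x in A) (f x)%:E)%E.

(* - L u = mu in D'(V), for mu a Radon measure on V. The type of mu is that of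
   set functions so that [density] needs no proof arguments. *)
Definition solves b nu V u (mu : set 'rV[R]_d -> \bar R) : Prop :=
  forall eta, Ccinfty V eta ->
    - (\int[leb d]_x (u x * levy_op_dual b nu eta x)) =
    fine (\int[mu]_(x in V) (eta x)%:E)%E.

End equation.

(* Main.v *)
Require Import Defs.
From HB Require Import structures.
From mathcomp Require Import all_boot all_order all_algebra.
From mathcomp Require Import all_classical all_reals all_analysis.
From mathcomp Require Import measurable_realfun.
From mathcomp Require Import ring lra.

Set Implicit Arguments.
Unset Strict Implicit.
Unset Printing Implicit Defensive.

Import Order.TTheory GRing.Theory Num.Def Num.Theory.
Import numFieldNormedType.Exports.

Local Open Scope classical_set_scope.
Local Open Scope ring_scope.

(* The origin is polar: since 2s < d, for every M and e there is a nonnegative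
   test function Gam with Gam(0) >= M, L Gam <= Gam + e and integral at most e,
   namely an approximate resolvent of the dual process applied to a rescaled
   bump.  For a smooth convex approximation h of the positive part and a test
   function zeta >= 0 on D, the function h(zeta - Gam) vanishes near 0, hence is
   admissible in the equation on D \ 0, and by convexity
   L h(zeta - Gam) >= h'(zeta - Gam) (L zeta - Gam - e).  With h fixed, the
   superlinear term absorbs u L zeta and bounds the integral of u^p near 0.
   Letting then Gam -> 0 a.e. and h' -> 1_{t > 0} shows that
   T(zeta) = - int u L zeta - int u^p zeta is bounded below by minus the integral
   of u L zeta over the set where zeta vanishes; localizing zeta at 0, where the
   stability of nu makes that integral tend to 0, gives T(eta) >= 0 as soon as
   eta(0) > 0.  As T vanishes on test functions supported away from 0,
   T(eta) = k eta(0) with k >= 0.  Testing with bumps of radius e and splitting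
   u <= A + A^(1 - p) u^p, with A a small multiple of e^(- 2s / (p - 1)), forces
   k = 0 when p >= d / (d - 2s). *)

(** * Smooth functions *)

(** The equation pairs u with the dual operator, so the argument is run for the pair
    [(- b, refl_measure nu)] and the process [- X]; there L acts on test functions. The obstacle is
    that a priori neither u nor its tail seen from 0 is controlled near 0, so [L zeta] cannot be
    paired with u when zeta does not vanish near 0. In h(zeta - Gam) the factor h' confines the
    pairing to a compact set off 0. Gam has to be a genuine smooth function with compact support,
    whereas a resolvent of the process is an infinite average. Hence the law at a small time is
    replaced by finitely many point masses: the resulting averages of translates commute with L and
    contract the sup norm, so one generator estimate for a single bump serves all iterates. The form
    L Gam <= Gam + e comes from the resolvent equation L G = G - g with g >= 0. Its size comes from
    scaling: for a bump of width 1/r, L g is of order r^(2s), so G(0) is at least of order r^(- 2s)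
    while its mass is of order r^(- d); normalizing G(0) leaves a mass of order r^(2s - d). *)

Section smooth_line.
Context {R : realType}.
Implicit Types h : R -> R.

Fixpoint C1k (k : nat) h : Prop :=
  continuous h /\
  if k is k'.+1 then
    exists2 h', (forall t : R, is_derive t 1 h (h' t)) & C1k k' h'
  else True.

Lemma C1k_continuous k h : C1k k h -> continuous h.
Proof. by case: k => [|k] []. Qed.

(** A directional derivative only sees the restriction to a line, which gives access to the
    one-variable chain rule and mean value theorem. *)
Lemma is_derive_line (V : normedModType R) (f : V -> R) (x v : V) (df : R) :
  is_derive x v f df <-> is_derive (0 : R) 1 (fun t : R => f (t *: v + x)) df.
Proof.
have e : (fun t : R => t^-1 *: ((f \o shift x) (t *: v) - f x)) =
  (fun t => t^-1 *: (((fun t : R => f (t *: v + x)) \o shift 0) (t *: 1) -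
                    f (0 *: v + x))).
  by apply/funext => t /=; rewrite addr0 scale0r add0r [_%:A]mulr1.
by split=> -[h1 h2]; split; rewrite /derivable /derive ?e// -e.
Qed.

Lemma is_derive_comp (V : normedModType R) (f : V -> R) h (x v : V) (df dh : R) :
  is_derive x v f df -> is_derive (f x) 1 h dh ->
  is_derive x v (h \o f) (dh * df).
Proof.
move=> /is_derive_line df' dh'; apply/is_derive_line.
apply: (@is_derive1_comp _ h (fun t : R => f (t *: v + x))) => //.
by rewrite scale0r add0r.
Qed.

End smooth_line.

Section Ck_calculus.
Context {R : realType} {d : nat}.
Implicit Types (f g u : 'rV[R]_d -> R) (x z : 'rV[R]_d).

Lemma Ck_continuous k f : Ck k f -> continuous f.
Proof. by case: k => [|k] []. Qed.

Lemma Ck_S k f (f' : 'I_d -> 'rV[R]_d -> R) : continuous f ->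
  (forall i x, is_derive x (delta_mx ord0 i) f (f' i x)) ->
  (forall i, Ck k (f' i)) -> Ck k.+1 f.
Proof.
move=> cf df Cf; split => // i; split => [x|]; first by case: (df i x).
rewrite (_ : partial i f = f' i)//; apply/funext => x.
by rewrite /partial; case: (df i x).
Qed.

Lemma Ck_is_derive k f : Ck k.+1 f -> forall i x,
  is_derive x (delta_mx ord0 i) f (partial i f x).
Proof. by move=> [_ H] i x; apply: DeriveDef => //; case: (H i). Qed.

Lemma Ck_partial k f : Ck k.+1 f -> forall i, Ck k (partial i f).
Proof. by move=> [_ H] i; case: (H i). Qed.

Lemma Ck_pred k f : Ck k.+1 f -> Ck k f.
Proof.
elim: k f => [|k IH] f [cf H]; split => // i; have [Hi1 Hi2] := H i.
by split => //; exact: IH.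
Qed.

Lemma Ck_cst k (c : R) : Ck k (cst c : 'rV[R]_d -> R).
Proof.
elim: k c => [|k IH] c; first by split=> // x; exact: cst_continuous.
by apply: (@Ck_S _ _ (fun=> cst 0)) => // x; exact: cst_continuous.
Qed.

Lemma CkD k f g : Ck k f -> Ck k g -> Ck k (f + g).
Proof.
elim: k f g => [|k IH] f g Cf Cg.
  split => // x; apply: continuousD; exact: (Ck_continuous (k := 0)).
apply: (@Ck_S _ _ (fun i => partial i f + partial i g)).
- by move=> x; apply: continuousD; [exact: (Ck_continuous Cf)|exact: (Ck_continuous Cg)].
- by move=> i x; apply: is_deriveD; [exact: (Ck_is_derive Cf)|exact: (Ck_is_derive Cg)].
- by move=> i; apply: IH; exact: Ck_partial.
Qed.

Lemma CkM k f g : Ck k f -> Ck k g -> Ck k (f * g).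
Proof.
elim: k f g => [|k IH] f g Cf Cg.
  split => // x; apply: continuousM; exact: (Ck_continuous (k := 0)).
apply: (@Ck_S _ _ (fun i => f * partial i g + g * partial i f)).
- by move=> x; apply: continuousM; [exact: (Ck_continuous Cf)|exact: (Ck_continuous Cg)].
- by move=> i x; apply: is_deriveM; [exact: (Ck_is_derive Cf)|exact: (Ck_is_derive Cg)].
- by move=> i; apply: CkD; apply: IH => //; try exact: Ck_partial; exact: Ck_pred.
Qed.

Lemma CkZ k (c : R) f : Ck k f -> Ck k (fun x => c * f x).
Proof. by move=> Cf; apply: (@CkM k (cst c) f) => //; exact: Ck_cst. Qed.

Lemma CkB k f g : Ck k f -> Ck k g -> Ck k (f - g).
Proof.
move=> Cf Cg; rewrite (_ : f - g = f + (fun x => -1 * g x)).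
  by apply: CkD => //; exact: CkZ.
by apply/funext => x; rewrite !fctE mulN1r.
Qed.

Lemma Ck_sum k (I : Type) (r : seq I) (F : I -> 'rV[R]_d -> R) :
  (forall i, Ck k (F i)) -> Ck k (\sum_(i <- r) F i).
Proof.
move=> CF; elim: r => [|i r IH]; first by rewrite big_nil; exact: (Ck_cst k 0).
by rewrite big_cons; exact: CkD.
Qed.

Lemma Ck_prod k (I : Type) (r : seq I) (F : I -> 'rV[R]_d -> R) :
  (forall i, Ck k (F i)) -> Ck k (\prod_(i <- r) F i).
Proof.
move=> CF; elim: r => [|i r IH]; first by rewrite big_nil; exact: (Ck_cst k 1).
by rewrite big_cons; exact: CkM.
Qed.

Lemma Ck_inv k f : (forall x, f x != 0) -> Ck k f -> Ck k (fun x => (f x)^-1).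
Proof.
move=> f0; elim: k => [|k IH] Cf.
  by split => // x; apply: continuousV => //; exact: (Ck_continuous Cf).
(* The derivative is written as a product of inverses so that the induction hypothesis applies to
   its factors. *)
apply: (@Ck_S _ _ (fun i => (fun x => (f x)^-1) * (fun x => (f x)^-1) * (fun x => -1 * partial i f x))).
- by move=> x; apply: continuousV => //; exact: (Ck_continuous Cf).
- move=> i x; have [d1 d2] := Ck_is_derive Cf i x.
  apply: DeriveDef; first exact: derivableV.
  by rewrite deriveV// d2 !fctE mulN1r mulrN -expr2 exprVn scaleNr.
- move=> i; apply: CkM; last by apply: CkZ; exact: Ck_partial.
  by apply: CkM; apply: IH; exact: Ck_pred.
Qed.

Lemma Ck_comp k (h : R -> R) f : C1k k h -> Ck k f -> Ck k (h \o f).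
Proof.
elim: k h f => [|k IH] h f [ch Ch] Cf.
  by split => // x; apply: continuous_comp; [exact: (Ck_continuous Cf)|exact: ch].
case: Ch => h' dh Ch.
apply: (@Ck_S _ _ (fun i => (h' \o f) * partial i f)).
- by move=> x; apply: continuous_comp; [exact: (Ck_continuous Cf)|exact: ch].
- by move=> i x; apply: is_derive_comp => //; exact: (Ck_is_derive Cf).
- move=> i; apply: CkM; last exact: Ck_partial.
  by apply: IH => //; exact: Ck_pred.
Qed.

Lemma is_derive_affine f (a : R) z x v (df : R) : 
  is_derive (a *: x + z) v f df -> is_derive x v (fun y => f (a *: y + z)) (a * df).
Proof.
move=> /is_derive_line df'.
pose F := fun t : R => f (t *: v + (a *: x + z)).
have e : (fun t : R => f (a *: (t *: v + x) + z)) = F \o (fun t => a * t).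
  by apply/funext => t; rewrite /F /= scalerDr scalerA addrA.
have da : is_derive (0:R) 1 (fun t : R => a * t) a.
  have := is_deriveZ (f := id : R -> R) a (is_derive_id (0 : R) 1).
  by rewrite [_ *: 1]mulr1.
apply/is_derive_line; rewrite e mulrC.
by apply: (@is_derive1_comp _ F (fun t => a * t)) => //; rewrite mulr0.
Qed.

Lemma Ck_affine k f (a : R) z : Ck k f -> Ck k (fun x => f (a *: x + z)).
Proof.
have cA g : continuous g -> continuous (fun x => g (a *: x + z)).
  move=> cg x; apply: (continuous_comp (f := fun x => a *: x + z)) => //; last exact: cg.
  by apply: continuousD; [exact: scaler_continuous|exact: cst_continuous].
elim: k f => [|k IH] f Cf; first by split => //; apply: cA; exact: (Ck_continuous Cf).
apply: (@Ck_S _ _ (fun i => fun x => a * partial i f (a *: x + z))).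
- by apply: cA; exact: (Ck_continuous Cf).
- by move=> i x; apply: is_derive_affine; exact: (Ck_is_derive Cf).
- by move=> i; apply: (@CkZ k a (fun x => partial i f (a *: x + z))); apply: IH; exact: Ck_partial.
Qed.

Lemma Ck_coord k (i : 'I_d) : Ck k (fun x => x ord0 i).
Proof.
case: k => [|k]; first by split => // x; exact: coord_continuous.
apply: (@Ck_S _ _ (fun j => cst ((j == i)%:R))).
- by move=> x; exact: coord_continuous.
- move=> j x; apply/is_derive_line.
  rewrite (_ : (fun t : R => _) = (j == i)%:R \*: (id : R -> R) + cst (x ord0 i)).
    have := is_deriveD (is_deriveZ (f := id : R -> R) (j == i)%:R (is_derive_id (0 : R) 1))
      (is_derive_cst (x ord0 i) (0 : R) 1).
    by rewrite [_ *: 1]mulr1 addr0.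
  by apply/funext => t; rewrite !fctE !mxE eqxx [i == j]eq_sym mulrC.
- by move=> j; exact: Ck_cst.
Qed.

End Ck_calculus.

(** * Flat functions on the line *)

Section exp_inv.
Context {R : realType}.
Implicit Types (t : R) (n k : nat).

Lemma C1kD k (f g : R -> R) : C1k k f -> C1k k g -> C1k k (f + g).
Proof.
elim: k f g => [|k IH] f g [cf Hf] [cg Hg].
  by split => // x; apply: continuousD; [exact: cf|exact: cg].
split; first by move=> x; apply: continuousD; [exact: cf|exact: cg].
case: Hf Hg => f' df Cf [g' dg Cg].
by exists (f' + g'); [move=> t; exact: is_deriveD|exact: IH].
Qed.

Lemma C1kZ k (a : R) (f : R -> R) : C1k k f -> C1k k (a \*: f).
Proof.
have ca (g : R -> R) : continuous g -> continuous (a \*: g).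
  by move=> cg x; apply: continuousZr; exact: cg.
elim: k f => [|k IH] f [cf Hf]; first by split => //; exact: ca.
split; first exact: ca.
case: Hf => f' df Cf.
by exists (a \*: f'); [move=> t; exact: is_deriveZ|exact: IH].
Qed.

(** The powers of 1/t in front of exp(-1/t) make the family stable under differentiation, so that
    smoothness is proved for all n at once by induction on the order. *)
Definition exp_inv n t : R := if 0 < t then t^-1 ^+ n * expR (- t^-1) else 0.

Lemma exp_inv_ge0 n t : 0 <= exp_inv n t.
Proof.
rewrite /exp_inv; case: ifP => // t0.
by rewrite mulr_ge0 ?expR_ge0// exprn_ge0// invr_ge0 ltW.
Qed.

Lemma exp_inv_gt0 n t : 0 < t -> 0 < exp_inv n t.
Proof. by move=> t0; rewrite /exp_inv t0 mulr_gt0 ?expR_gt0// exprn_gt0// invr_gt0. Qed.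

Lemma exp_inv_le0 n t : t <= 0 -> exp_inv n t = 0.
Proof. by rewrite /exp_inv leNgt => /negbTE ->. Qed.

Lemma exprn_expR_le n (x : R) : 0 <= x -> x ^+ n * expR (- x) <= n`!%:R.
Proof.
move=> x0; case: n => [|n]; first by rewrite expr0 mul1r -expR0 ler_expR oppr_le0.
have f0 : (0 : R) < n.+1`!%:R by rewrite ltr0n fact_gt0.
rewrite expRN ler_pdivrMr ?expR_gt0// mulrC -ler_pdivrMr//.
by apply: le_trans (expR_ge1Dxn n x0); rewrite lerDr.
Qed.

(** With x = 1/t, dividing by t^2 turns x^n into x^(n+2), and x^m exp(-x) <= m!. The quadratic decay
    is what gives derivative 0 at the origin. *)
Lemma exp_inv_bound n t : exp_inv n t <= n.+2`!%:R * t ^+ 2.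
Proof.
have [t0|t0] := leP t 0.
  by rewrite exp_inv_le0// mulr_ge0 ?sqr_ge0.
have := @exprn_expR_le n.+2 t^-1; rewrite invr_ge0 => /(_ (ltW t0)) H.
rewrite -ler_pdivrMr ?exprn_gt0//; apply: le_trans H.
by rewrite /exp_inv t0 -[n.+2]addn2 [t^-1 ^+ (n + 2)]exprD -[leRHS]mulrA -[leLHS]mulrA
  [_ / t ^+ 2]mulrC -exprVn.
Qed.

Lemma is_derive_exp_inv n t :
  is_derive t 1 (exp_inv n) (exp_inv n.+2 t - n%:R * exp_inv n.+1 t).
Proof.
have [t0|t0|->] := ltgtP t 0.
- rewrite !exp_inv_le0 ?ltW// mulr0 subr0.
  apply: (near_eq_is_derive (f := cst 0)).
  by near=> x; rewrite exp_inv_le0//; apply: ltW; near: x; exact: lt_nbhsl.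
- have dV : is_derive t 1 (fun x : R => x^-1) (- t ^- 2).
    have tn0 : t != 0 by rewrite gt_eqF.
    apply: DeriveDef; first exact: derivableV.
    by rewrite deriveV// derive_id [_ *: _]mulr1.
  have d1 : is_derive t 1 (fun x : R => x^-1 ^+ n * expR (- x^-1))
     (exp_inv n.+2 t - n%:R * exp_inv n.+1 t).
    have dE : is_derive t 1 (fun x : R => expR (- x^-1)) (expR (- t^-1) * (t ^- 2)).
      apply: (@is_derive1_comp _ expR (fun x => - x^-1)).
      by rewrite -[t ^- 2]opprK; exact: is_deriveN.
    have E : (fun x : R => x^-1 ^+ n * expR (- x^-1)) =
        ((fun x : R => x^-1) ^+ n) * (fun x : R => expR (- x^-1)).
      by apply/funext => x; rewrite !fctE.
    rewrite E; apply: (is_derive_eq (is_deriveM (is_deriveX n dV) dE)).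
    rewrite /exp_inv t0 /GRing.scale /= !fctE -!exprVn.
    case: n {E} => [|n] /=; first by rewrite !expr0; ring.
    rewrite !exprS expr0; ring.
  apply: near_eq_is_derive d1.
  by near=> x; rewrite /exp_inv ifT//; near: x; exact: lt_nbhsr.
- rewrite !exp_inv_le0// mulr0 subr0.
  (* By the quadratic bound the difference quotient at 0 is at most (n+2)! |h|. *)
  have H : (fun h : R => h^-1 *: ((exp_inv n \o shift 0) (h *: 1) - exp_inv n 0)) @ 0^' --> (0 : R).
    apply/cvgr0Pnorm_lt => e e0.
    near=> h.
    have hn0 : h != 0 by near: h; exact: nbhs_dnbhs_neq.
    rewrite /= addr0 [h *: 1]mulr1 [exp_inv n 0]exp_inv_le0// subr0 normrZ normfV.
    rewrite mulrC ltr_pdivrMr ?normr_gt0// ger0_norm ?exp_inv_ge0//.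
    apply: (le_lt_trans (exp_inv_bound _ _)).
    rewrite -real_normK ?num_real// expr2 mulrA ltr_pM2r ?normr_gt0//.
    rewrite mulrC -ltr_pdivlMr ?ltr0n ?fact_gt0//.
    near: h; apply: nbhs_dnbhs.
    exists (e / n.+2`!%:R); first by rewrite /= divr_gt0// ltr0n fact_gt0.
    by move=> y; rewrite /= sub0r normrN.
  apply: DeriveDef; first by apply/cvg_ex; exists 0.
  exact: (cvg_lim (@Rhausdorff R) H).
Unshelve. all: by end_near. Qed.

Lemma C1k_exp_inv k n : C1k k (exp_inv n).
Proof.
have c m : continuous (exp_inv m).
  move=> t; apply: differentiable_continuous; apply/derivable1_diffP.
  by case: (is_derive_exp_inv m t).
elim: k n => [|k IH] n; split => //.
exists (exp_inv n.+2 + (- n%:R) \*: exp_inv n.+1).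
  by move=> t; have := is_derive_exp_inv n t; rewrite -mulNr.
by apply: C1kD => //; exact: C1kZ.
Qed.

End exp_inv.

(** * Convex regularizations of the positive part *)

Section ramp.
Context {R : realType}.
Implicit Types (m t a b : R).

(* A smooth convex approximation of the positive part, exact on t <= 0, whose
   derivative tends to the indicator of t > 0 as m -> +oo. *)
Definition ramp m t : R := t * exp_inv 0 (m * t).
Definition dramp m t : R := exp_inv 0 (m * t) + exp_inv 1 (m * t).

Lemma is_derive_mul m t : is_derive t 1 (fun x : R => m * x) m.
Proof.
have := is_deriveZ (f := id : R -> R) m (is_derive_id t 1).
by rewrite [_ *: 1]mulr1.
Qed.

Lemma is_derive_exp_inv_mul n m t : is_derive t 1 (fun x => exp_inv n (m * x))
  ((exp_inv n.+2 (m * t) - n%:R * exp_inv n.+1 (m * t)) * m).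
Proof.
apply: (@is_derive1_comp _ (exp_inv n) (fun x => m * x)).
  exact: is_derive_exp_inv.
exact: is_derive_mul.
Qed.

Lemma exp_invS n t : t * exp_inv n.+1 t = exp_inv n t.
Proof.
have [t0|t0] := leP t 0; first by rewrite !exp_inv_le0// mulr0.
by rewrite /exp_inv t0 exprS !mulrA divff ?gt_eqF// mul1r.
Qed.

Lemma is_derive_ramp m t : is_derive t 1 (ramp m) (dramp m t).
Proof.
have E : ramp m = (id : R -> R) * (fun x => exp_inv 0 (m * x)) by [].
rewrite E; apply: (is_derive_eq (is_deriveM (is_derive_id t 1) (is_derive_exp_inv_mul 0 m t))).
rewrite /GRing.scale /= mulr1 mul0r subr0 /dramp mulrC -mulrA [m * t]mulrC.
by rewrite mulrC -[t * m * _]/(t * m * exp_inv 2 _) exp_invS addrC.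
Qed.

Lemma dramp_ge0 m t : 0 <= dramp m t.
Proof. by rewrite addr_ge0// exp_inv_ge0. Qed.

(** With q = 1 / (m t) this is (1 + q) exp(-q) <= 1. *)
Lemma dramp_le1 m t : dramp m t <= 1.
Proof.
rewrite /dramp; have [t0|t0] := leP (m * t) 0; first by rewrite !exp_inv_le0// addr0.
rewrite /exp_inv t0 expr0 expr1 -mulrDl expRN ler_pdivrMr ?expR_gt0// mul1r.
exact: expR_ge1Dx.
Qed.

Lemma dramp_ndecr m : 0 < m -> {homo dramp m : a b / a <= b}.
Proof.
move=> m0 a b ab.
(* The two [exp_inv 2] terms cancel, and the second derivative of the ramp is a nonnegative multiple
   of [exp_inv 3]. *)
have dD t : is_derive t 1 (dramp m) (exp_inv 3 (m * t) * m).
  apply: (is_derive_eq (is_deriveD (is_derive_exp_inv_mul 0 m t) (is_derive_exp_inv_mul 1 m t))).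
  by rewrite -mulrDl mul0r subr0 mul1r addrC subrK.
move: ab; rewrite le_eqVlt => /predU1P[->//|ab].
have [c _ E] := MVT ab (fun t _ => dD t)
  (derivable_within_continuous (fun x _ => @ex_derive _ _ _ _ _ _ _ (dD x))).
rewrite -subr_ge0 E mulr_ge0 ?subr_ge0 ?(ltW ab)//.
by rewrite mulr_ge0 ?exp_inv_ge0// ltW.
Qed.

Lemma ramp_le0 m t : 0 < m -> t <= 0 -> ramp m t = 0.
Proof. by move=> m0 t0; rewrite /ramp exp_inv_le0 ?mulr0// pmulr_rle0. Qed.

Lemma dramp_le0 m t : 0 < m -> t <= 0 -> dramp m t = 0.
Proof. by move=> m0 t0; rewrite /dramp !exp_inv_le0 ?addr0// pmulr_rle0. Qed.

Lemma ramp_gt0 m t : 0 < m -> 0 < t -> 0 < ramp m t.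
Proof. by move=> m0 t0; rewrite mulr_gt0// exp_inv_gt0// mulr_gt0. Qed.

Lemma ramp_ge0 m t : 0 < m -> 0 <= ramp m t.
Proof.
move=> m0; have [t0|t0] := leP t 0; first by rewrite ramp_le0.
by rewrite ltW// ramp_gt0.
Qed.

Lemma exp_inv0_le1 t : exp_inv 0 t <= 1.
Proof.
rewrite /exp_inv; case: ifPn => // t0.
by rewrite expr0 mul1r -expR0 ler_expR oppr_le0 invr_ge0 ltW.
Qed.

Lemma ramp_le m t : 0 < m -> ramp m t <= Num.max t 0.
Proof.
move=> m0; have [t0|t0] := leP t 0; first by rewrite ramp_le0.
by rewrite ger_pMr// exp_inv0_le1.
Qed.

Lemma ramp_convex m a b : 0 < m -> dramp m a * (b - a) <= ramp m b - ramp m a.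
Proof.
move=> m0.
have cc x y : {within `[x, y], continuous (ramp m)}.
  exact: (derivable_within_continuous (fun t _ => @ex_derive _ _ _ _ _ _ _ (is_derive_ramp m t))).
have [ab|ab|->] := ltgtP a b; last by rewrite !subrr mulr0.
  have [c] := MVT ab (fun t _ => is_derive_ramp m t) (cc _ _).
  rewrite in_itv /= => /andP[ac cb] ->.
  by rewrite ler_wpM2r ?subr_ge0 ?(ltW ab)// dramp_ndecr// ltW.
have [c] := MVT ab (fun t _ => is_derive_ramp m t) (cc _ _).
rewrite in_itv /= => /andP[bc ca] E.
rewrite -[leRHS]opprB E -[b - a]opprB mulrN lerN2.
by rewrite ler_wpM2r ?subr_ge0 ?(ltW ab)// dramp_ndecr// ltW.
Qed.

Lemma exp_inv0_ge t : 0 < t -> 1 - t^-1 <= exp_inv 0 t.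
Proof.
move=> t0; rewrite /exp_inv t0 expr0 mul1r.
by apply: le_trans (expR_ge1Dx _).
Qed.

(** The point may move with n because the ramp sharpens and the potentials vanish in the same
    limit. *)
Lemma exp_inv0_cvg (t_ : R^nat) t : 0 < t -> t_ n @[n --> \oo] --> t ->
  exp_inv 0 (n.+1%:R * t_ n) @[n --> \oo] --> (1 : R).
Proof.
move=> t0 ct.
apply: (@squeeze_cvgr _ _ _ _ (fun n => 1 - (n.+1%:R)^-1 * (t_ n)^-1) (cst 1)).
- have t_gt0 : \forall n \near \oo, 0 < t_ n by apply: (cvgr_gt t).
  near=> n; rewrite exp_inv0_le1 andbT -invfM.
  by apply: exp_inv0_ge; rewrite mulr_gt0//; near: n.
- rewrite -[X in _ --> X]subr0; apply: cvgB; first exact: cvg_cst.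
  rewrite -(mul0r t^-1); apply: cvgM; first exact: cvg_harmonic.
  by apply: cvgV => //; rewrite gt_eqF.
- exact: cvg_cst.
Unshelve. all: by end_near. Qed.

Lemma ramp_cvg (t_ : R^nat) t : 0 < t -> t_ n @[n --> \oo] --> t ->
  ramp n.+1%:R (t_ n) @[n --> \oo] --> t.
Proof.
by move=> t0 ct; rewrite -[X in _ --> X]mulr1; apply: cvgM => //; exact: exp_inv0_cvg ct.
Qed.

Lemma dramp_cvg (t_ : R^nat) t : 0 < t -> t_ n @[n --> \oo] --> t ->
  dramp n.+1%:R (t_ n) @[n --> \oo] --> (1 : R).
Proof.
move=> t0 ct.
apply: (@squeeze_cvgr _ _ _ _ (fun n => exp_inv 0 (n.+1%:R * t_ n)) (cst 1)).
- by near=> n; rewrite dramp_le1 andbT lerDl exp_inv_ge0.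
- exact: exp_inv0_cvg ct.
- exact: cvg_cst.
Unshelve. all: by end_near. Qed.

(** Where u > a, write u = u^(1 - p) u^p and use 1 - p <= 0. The threshold stays free: it is chosen
    pointwise in [dramp_absorb] and as a power of the radius in the critical case. *)
Lemma le_add_powR (p u a : R) : 1 <= p -> 0 < a -> 0 <= u ->
  u <= a + a `^ (1 - p) * u `^ p.
Proof.
move=> p1 a0 u0; have [ua|au] := leP u a.
  by apply: (le_trans ua); rewrite lerDl mulr_ge0 ?powR_ge0.
have u0' : 0 < u by apply: lt_trans au.
rewrite -[leLHS]add0r lerD ?(ltW a0)//.
rewrite -{1}[u]powRr1// -[1 in leLHS](subrK p) powRD; last by rewrite (gt_eqF u0') implybT.
rewrite ler_wpM2r ?powR_ge0// -[1 - p]opprB !powRN lef_pV2 ?posrE ?powR_gt0//.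
by rewrite ge0_ler_powR ?nnegrE ?subr_ge0// ltW.
Qed.

(* This absorption is what makes the superlinear right-hand side control the
   solution near the singularity. *)
Lemma dramp_absorb (p C : R) : 1 < p -> 0 < C -> exists2 C' : R, 0 <= C' &
  forall u t, 0 <= u -> t <= 1 ->
    C * u * dramp 1 t <= 2^-1 * (u `^ p * ramp 1 t) + C'.
Proof.
move=> p1 C0; pose k := (p - 1)^-1.
have k0 : 0 < k by rewrite invr_gt0 subr_gt0.
(* Since q >= 1 below, q^(2k) <= q^(N+1): the real power is traded for an integer one, and a * q *
   exp(-q) is bounded through (N+2)!. *)
pose N := Num.truncn (2 * k).
have kN : 2 * k <= N.+1%:R by rewrite ltW// truncnS_gt.
pose C' := 2 * C * (4 * C) `^ k * N.+2`!%:R.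
have C'0 : 0 <= C' by rewrite !mulr_ge0 ?powR_ge0// ltW.
exists C' => // u t u0 t1.
have [t0|t0] := leP t 0.
  by rewrite dramp_le0// ramp_le0// !mulr0 add0r.
pose q := t^-1.
have q1 : 1 <= q by rewrite invf_ge1.
have q0 : 0 < q by rewrite invr_gt0.
(* The threshold depends on t so that a^(1 - p) = 1 / (4 C q^2). As dramp <= 2 q exp(-q) and ramp =
   exp(-q) / q, the u^p term is then at most half of u^p times the ramp. *)
pose a := (4 * C * q ^+ 2) `^ k.
have b0 : 0 < 4 * C * q ^+ 2 by rewrite !mulr_gt0// exprn_gt0.
have a0 : 0 < a by rewrite powR_gt0.
have aE : a `^ (1 - p) = (4 * C * q ^+ 2)^-1.
  rewrite /a -powRrM -[1 - p]opprB mulrN /k mulVf ?gt_eqF ?subr_gt0//.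
  by rewrite powR_inv1// ltW.
have E0 : exp_inv 0 (1 * t) = expR (- q) by rewrite mul1r /exp_inv t0 expr0 mul1r.
have E1 : exp_inv 1 (1 * t) = q * expR (- q) by rewrite mul1r /exp_inv t0 expr1.
have dE : dramp 1 t <= 2 * q * expR (- q).
  rewrite /dramp E0 E1; have := expR_ge0 (- q); nra.
have rE : ramp 1 t = q^-1 * expR (- q) by rewrite /ramp E0 /q invrK.
have qN : a * q * expR (- q) <= (4 * C) `^ k * N.+2`!%:R.
  have -> : a = (4 * C) `^ k * (q ^+ 2) `^ k by rewrite /a powRM ?mulr_ge0 ?exprn_ge0 ?ltW.
  rewrite -!mulrA ler_wpM2l ?powR_ge0// mulrA.
  apply: le_trans (exprn_expR_le N.+2 (ltW q0)).
  rewrite [q ^+ N.+2]exprSr ler_wpM2r ?expR_ge0// ler_wpM2r ?(ltW q0)//.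
  rewrite -powR_mulrn ?(ltW q0)// -powRrM -powR_mulrn ?(ltW q0)//.
  exact: ler_powR.
apply: (le_trans (y := C * (a + a `^ (1 - p) * u `^ p) * dramp 1 t)).
  by rewrite ler_wpM2r ?dramp_ge0// ler_wpM2l ?(ltW C0)// le_add_powR// ltW.
rewrite [C * (a + _)]mulrDr [(C * a + _) * _]mulrDl addrC lerD//.
  rewrite aE rE.
  have up := powR_ge0 u p.
  apply: (le_trans (y := C * ((4 * C * q ^+ 2)^-1 * u `^ p) * (2 * q * expR (- q)))).
    apply: ler_wpM2l => //; apply: mulr_ge0; first exact: ltW.
    by rewrite mulr_ge0// invr_ge0 ltW.
  rewrite le_eqVlt; apply/orP; left; apply/eqP; field.
  by rewrite !gt_eqF.
apply: (le_trans (y := C * a * (2 * q * expR (- q)))).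
  by apply: ler_wpM2l => //; rewrite mulr_ge0// ltW.
have -> : C * a * (2 * q * expR (- q)) = 2 * C * (a * q * expR (- q)) by ring.
rewrite /C' -[leRHS]mulrA; apply: ler_wpM2l => //.
by rewrite mulr_ge0// ltW.
Qed.

End ramp.

(** * Smooth cutoffs of cubes *)

Section cutoff.
Context {R : realType} {d : nat}.
Implicit Types (x y : 'rV[R]_d) (f g : 'rV[R]_d -> R) (r : R).

Lemma rV_normP x r : 0 <= r -> `|x| <= r <-> forall i, `|x ord0 i| <= r.
Proof.
move=> r0; rewrite [`|x|]/normr /= mx_normrE; split => [/bigmax_leP[_ H] i|H].
  exact: (H (ord0, i) isT).
by apply/bigmax_leP; split => // -[a i] _ /=; rewrite (ord1 a).
Qed.

Lemma rV_norm_coord x i : `|x ord0 i| <= `|x|.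
Proof. by move: i; apply/rV_normP. Qed.

Lemma closed_norm_le r : closed [set x : 'rV[R]_d | `|x| <= r].
Proof.
rewrite (_ : mkset _ = (fun x : 'rV[R]_d => `|x|) @^-1` [set t | t <= r])//.
apply: closed_comp => [x _|]; last exact: closed_le.
exact: norm_continuous.
Qed.

Lemma compact_norm_le r : compact [set x : 'rV[R]_d | `|x| <= r].
Proof.
apply: bounded_closed_compact; last exact: closed_norm_le.
exists r; split; first exact: num_real.
by move=> M rM x /= xr; rewrite (le_trans xr)// ltW.
Qed.

Lemma open_norm_lt r : open [set x : 'rV[R]_d | `|x| < r].
Proof.
rewrite (_ : mkset _ = (fun x : 'rV[R]_d => `|x|) @^-1` [set t | t < r])//.
apply: open_comp => [x _|]; last exact: open_lt.
exact: norm_continuous.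
Qed.

Lemma supp_subset f (K : set 'rV[R]_d) : closed K -> (forall x, ~ K x -> f x = 0) ->
  supp f `<=` K.
Proof.
move=> cK fK; rewrite /supp [X in _ `<=` X]((closure_id K).1 cK).
by apply: closure_subset => x /= fx; apply: contrapT => /fK/eqP; exact/negP.
Qed.

Lemma supp_eq0 f x : ~ supp f x -> f x = 0.
Proof.
by move=> H; apply/eqP; apply: contrapT => /negP fx; apply: H; exact: subset_closure.
Qed.

Lemma CckI k f (K V : set 'rV[R]_d) : Ck k f -> compact K ->
  (forall x, ~ K x -> f x = 0) -> K `<=` V -> Cck k V f.
Proof.
move=> Cf cK fK KV.
have cl : closed K by apply: compact_closed => //; exact: norm_hausdorff.
have sK := supp_subset cl fK.
split => //; last exact: subset_trans KV.
by apply: (subclosed_compact _ cK) => //; exact: closed_closure.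
Qed.

Lemma compact_norm_bounded (K : set 'rV[R]_d) : compact K ->
  exists2 M : R, 0 < M & forall x, K x -> `|x| <= M.
Proof.
move=> /compact_bounded[M [_ HM]].
exists (Num.max M 0 + 1); first by rewrite ltr_wpDl// le_max lexx orbT.
move=> x Kx; apply: HM => //.
by rewrite (@le_lt_trans _ _ (Num.max M 0))// ?le_max ?lexx// ltrDl.
Qed.

Lemma Cck_bounded_supp k V f : Cck k V f ->
  exists2 M : R, 0 < M & forall x, M < `|x| -> f x = 0.
Proof.
case=> _ /compact_norm_bounded[M M0 HM] _; exists M => // x Mx.
by apply: supp_eq0 => /HM; rewrite leNgt Mx.
Qed.

Lemma CckT_bounded k f M : Ck k f -> (forall x, M < `|x| -> f x = 0) -> Cck k setT f.
Proof.
move=> Cf fM; apply: (CckI Cf (@compact_norm_le M)) => //.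
by move=> x /= /negP; rewrite -ltNge => /fM.
Qed.

Lemma Cck_setT k V f : Cck k V f -> Cck k setT f.
Proof. by case=> *; split. Qed.

Lemma Ck_ramp k m f : Ck k f -> Ck k (fun x => ramp m (f x)).
Proof.
move=> Cf; apply: (@CkM _ _ _ f (fun x => exp_inv 0 (m * f x))) => //.
apply: (@Ck_comp _ _ _ (exp_inv 0) (fun x => m * f x)); first exact: C1k_exp_inv.
exact: CkZ.
Qed.

Let num x (i : 'I_d) : R := exp_inv 0 (4 - x ord0 i ^+ 2).
Let den x (i : 'I_d) : R := exp_inv 0 (x ord0 i ^+ 2 - 1).

Let numden_gt0 x i : 0 < num x i + den x i.
Proof.
have [h|h] := ltP (x ord0 i ^+ 2) 4.
  by rewrite ltr_pwDl ?exp_inv_ge0// exp_inv_gt0// subr_gt0.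
rewrite ltr_wpDl ?exp_inv_ge0// exp_inv_gt0// subr_gt0 (lt_le_trans _ h)//.
by rewrite (_ : 1 = 1%:R)// ltr_nat.
Qed.

(** Balls of the sup norm are cubes, hence a product of one-variable cutoffs. A factor is 1 where
    [den] vanishes, |x_i| <= 1, and 0 where [num] vanishes, |x_i| >= 2; the two never vanish
    together. *)
Definition cutoff x : R := \prod_(i < d) (num x i / (num x i + den x i)).

Lemma cutoff_ge0 x : 0 <= cutoff x.
Proof. by apply: prodr_ge0 => i _; rewrite divr_ge0 ?exp_inv_ge0// ltW. Qed.

Lemma cutoff_le1 x : cutoff x <= 1.
Proof.
apply: prodr_ile1 => i _; rewrite divr_ge0 ?exp_inv_ge0 ?(ltW (numden_gt0 _ _))//=.
by rewrite ler_pdivrMr// mul1r lerDl exp_inv_ge0.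
Qed.

Lemma cutoff_eq1 x : `|x| <= 1 -> cutoff x = 1.
Proof.
move=> /(rV_normP _ ler01) H; apply: big1 => i _.
have -> : den x i = 0.
  by rewrite /den exp_inv_le0// subr_le0 -real_normK ?num_real// expr_le1.
have := numden_gt0 x i; rewrite /den exp_inv_le0 ?addr0.
  by move=> n0; rewrite divff// gt_eqF.
by rewrite subr_le0 -real_normK ?num_real// expr_le1.
Qed.

Lemma cutoff_eq0 x : 2 <= `|x| -> cutoff x = 0.
Proof.
move=> x2; have [i xi] : exists i, 2 <= `|x ord0 i|.
  apply: contrapT => /forallNP H.
  have E : `|x| = \big[Num.max/0]_ij `|x ij.1 ij.2| by rewrite [LHS]/normr /= mx_normrE.
  have : `|x| < 2.
    rewrite E; apply/bigmax_ltP; split => // -[a j] _ /=; rewrite (ord1 a) ltNge.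
    by apply/negP; exact: H.
  by rewrite ltNge x2.
rewrite /cutoff (bigD1 i)//= /num exp_inv_le0 ?mul0r// subr_le0.
rewrite -real_normK ?num_real// (_ : 4 = 2 ^+ 2); last by rewrite -natrX.
by rewrite ler_pXn2r ?nnegrE.
Qed.

Lemma cutoff_gt0 x : `|x| < 2 -> 0 < cutoff x.
Proof.
move=> x2; apply: prodr_gt0 => i _; rewrite divr_gt0// exp_inv_gt0// subr_gt0.
rewrite -real_normK ?num_real// (_ : 4 = 2 ^+ 2); last by rewrite -natrX.
by rewrite ltr_pXn2r ?nnegrE// (le_lt_trans (rV_norm_coord _ _)).
Qed.

Lemma Ck_cutoff k : Ck k cutoff.
Proof.
have E : cutoff = \prod_(i <- index_enum 'I_d) ((fun x => num x i) * (fun x => (num x i + den x i)^-1)).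
  apply/funext => x; rewrite fct_prodE.
  by apply: eq_bigr => i _; rewrite !fctE.
rewrite E; apply: Ck_prod => i.
have Cx : Ck k (fun x => x ord0 i ^+ 2).
  by apply: (@CkM _ _ _ (fun x => x ord0 i) (fun x => x ord0 i)); exact: Ck_coord.
have Cn : Ck k (fun x => num x i).
  apply: (@Ck_comp _ _ _ (exp_inv 0) (fun x => 4 - x ord0 i ^+ 2)); first exact: C1k_exp_inv.
  by apply: (@CkB _ _ _ (cst 4)) => //; exact: Ck_cst.
apply: CkM => //; apply: Ck_inv => [x|]; first by rewrite gt_eqF.
apply: (@CkD _ _ _ (fun x => num x i) (fun x => den x i)) => //.
apply: (@Ck_comp _ _ _ (exp_inv 0) (fun x => x ord0 i ^+ 2 - 1)); first exact: C1k_exp_inv.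
by apply: (@CkB _ _ _ _ (cst 1)) => //; exact: Ck_cst.
Qed.

Definition bump r x : R := cutoff (r^-1 *: x).

Section bump.
Variable r : R.
Hypothesis r0 : 0 < r.

Let normr_scale x : `|r^-1 *: x| = `|x| / r.
Proof. by rewrite normrZ gtr0_norm ?invr_gt0// mulrC. Qed.

Lemma bump_ge0 x : 0 <= bump r x. Proof. exact: cutoff_ge0. Qed.

Lemma bump_le1 x : bump r x <= 1. Proof. exact: cutoff_le1. Qed.

Lemma bump_eq1 x : `|x| <= r -> bump r x = 1.
Proof. by move=> h; apply: cutoff_eq1; rewrite normr_scale ler_pdivrMr// mul1r. Qed.

Lemma bump_eq0 x : 2 * r <= `|x| -> bump r x = 0.
Proof. by move=> h; apply: cutoff_eq0; rewrite normr_scale ler_pdivlMr. Qed.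

Lemma bump_gt0 x : `|x| < 2 * r -> 0 < bump r x.
Proof. by move=> h; apply: cutoff_gt0; rewrite normr_scale ltr_pdivrMr. Qed.

Lemma Ck_bump k : Ck k (bump r).
Proof.
rewrite (_ : bump r = fun x => cutoff (r^-1 *: x + 0)).
  by apply: Ck_affine; exact: Ck_cutoff.
by apply/funext => x; rewrite addr0.
Qed.

Lemma Cck_bump k : Cck k setT (bump r).
Proof.
apply: (@CckT_bounded _ _ (2 * r)); first exact: Ck_bump.
by move=> x /ltW; exact: bump_eq0.
Qed.

End bump.

End cutoff.

(** * Taylor bounds from partial derivatives *)

Section taylor.
Context {R : realType} {d : nat}.
Implicit Types (x y z : 'rV[R]_d) (f g : 'rV[R]_d -> R).

Lemma MVT_coord f z (i : 'I_d) (a : R) : Ck 1 f -> exists2 c : R, `|c| <= `|a| &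
  f (a *: delta_mx ord0 i + z) - f z = a * partial i f (c *: delta_mx ord0 i + z).
Proof.
move=> Cf; pose e : 'rV[R]_d := delta_mx ord0 i; pose F (t : R) := f (t *: e + z).
have dF (t : R) : is_derive t 1 F (partial i f (t *: e + z)).
  have h := (is_derive_line f (t *: e + z) e _).1 (Ck_is_derive Cf i (t *: e + z)).
  have -> : F = (fun s : R => f (s *: e + (t *: e + z))) \o (fun s => s + (- t)).
    by apply/funext => s; rewrite /F /= addrA -scalerDl subrK.
  rewrite -[partial _ _ _]mulr1.
  by apply: is_derive1_comp; [rewrite subrr|exact: is_derive_shift].
have cF u v : {within `[u, v], continuous F}.
  exact: (derivable_within_continuous (fun t _ => @ex_derive _ _ _ _ _ _ _ (dF t))).
have F0 : F 0 = f z by rewrite /F scale0r add0r.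
have [a0|a0|->] := ltgtP a 0; last by exists 0; rewrite ?mul0r // scale0r add0r subrr.
- have [c] := MVT a0 (fun t _ => dF t) (cF _ _).
  rewrite in_itv /= => /andP[ac c0] E; exists c.
    by rewrite !ltr0_norm// lerN2 ltW.
  by rewrite -F0 -opprB E sub0r mulrN opprK mulrC.
- have [c] := MVT a0 (fun t _ => dF t) (cF _ _).
  rewrite in_itv /= => /andP[c0 ca] E; exists c.
    by rewrite !gtr0_norm// ltW.
  by rewrite -F0 E subr0 mulrC.
Qed.

(** One coordinate is moved at a time, so that partial derivatives suffice; in the sup norm the
    intermediate points stay within |y| of x. *)
Lemma C1_telescope f x y : Ck 1 f -> exists2 xi : 'I_d -> 'rV[R]_d,
  (forall i, `|xi i - x| <= `|y|) &
  f (x + y) - f x = \sum_i y ord0 i * partial i f (xi i).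
Proof.
(* [p k] takes its first k coordinates from x + y and the others from x, so that p 0 = x and p d = x
   + y. *)
move=> Cf; pose p k : 'rV[R]_d := \row_j (x ord0 j + (j < k)%:R * y ord0 j).
have pS (i : 'I_d) : p i.+1 = y ord0 i *: delta_mx ord0 i + p i.
  apply/rowP => j; rewrite !mxE eqxx /= ltnS leq_eqVlt.
  have [->|ji] := eqVneq j i; first by rewrite !eqxx ltnn /= mulr1 mul1r mul0r addr0 addrC.
  have -> : (val j == val i) = false by apply/negbTE.
  by rewrite /= mulr0 add0r.
have /choice[c Hc] : forall i : 'I_d, exists c, `|c| <= `|y ord0 i| /\
    f (p i.+1) - f (p i) = y ord0 i * partial i f (c *: delta_mx ord0 i + p i).
  move=> i; have [c c1 c2] := MVT_coord (p i) i (y ord0 i) Cf.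
  by exists c; rewrite pS.
exists (fun i => c i *: delta_mx ord0 i + p i) => [i|].
  apply/rV_normP => // j; rewrite !mxE eqxx /=.
  have [ci _] := Hc i.
  have [->|ji] := eqVneq j i.
    by rewrite ltnn mulr1 mul0r addr0 addrK (le_trans ci)// rV_norm_coord.
  rewrite mulr0 add0r addrAC subrr add0r.
  by case: (_ < _)%N; rewrite ?mul1r ?mul0r ?normr0 ?rV_norm_coord.
transitivity (\sum_(i < d) (f (p i.+1) - f (p i))); last by apply: eq_bigr => i _; case: (Hc i).
rewrite -(big_mkord xpredT (fun i => f (p i.+1) - f (p i))) telescope_sumr//.
congr (f _ - f _); apply/rowP => j; rewrite !mxE ?ltn_ord ?mul1r//.
by rewrite mul0r addr0.
Qed.

Lemma continuous_bounded_supp f M : continuous f -> (forall x, M < `|x| -> f x = 0) ->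
  exists2 B : R, 0 < B & forall x, `|f x| <= B.
Proof.
move=> cf fM.
have : compact (f @` [set x | `|x| <= M]).
  apply: continuous_compact; last exact: compact_norm_le.
  exact: continuous_subspaceT.
move=> /compact_bounded[A [_ HA]]; exists (Num.max A 0 + 1).
  by rewrite ltr_wpDl// le_max lexx orbT.
move=> x; have [xM|xM] := leP `|x| M; last by rewrite fM// normr0 addr_ge0// le_max lexx orbT.
apply: HA; last by exists x.
by rewrite (@le_lt_trans _ _ (Num.max A 0))// ?le_max ?lexx// ltrDl.
Qed.

Lemma partial_eq f g x i : (\near x, f x = g x) -> partial i f x = partial i g x.
Proof. by move=> H; exact: near_eq_derive. Qed.

Lemma partial_cst (c : R) x i : partial i (cst c) x = 0.
Proof. exact: derive_cst. Qed.

Lemma near_norm_gt M x : M < `|x| -> \near x, M < `|x|.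
Proof.
move=> Mx; have : open [set y : 'rV[R]_d | M < `|y|].
  rewrite (_ : mkset _ = (fun y : 'rV[R]_d => `|y|) @^-1` [set t | M < t])//.
  by apply: open_comp => [z _|]; [exact: norm_continuous|exact: open_gt].
by move=> o; apply: (open_nbhs_nbhs (A := [set y : 'rV[R]_d | M < `|y|])).
Qed.

Lemma partial_bounded_supp f M i : (forall x, M < `|x| -> f x = 0) ->
  forall x, M < `|x| -> partial i f x = 0.
Proof.
move=> fM x Mx; rewrite (@partial_eq f (cst 0)); first exact: partial_cst.
by apply: filterS (near_norm_gt Mx) => y /fM.
Qed.

Lemma lipschitz_C1 f M : Ck 1 f -> (forall x, M < `|x| -> f x = 0) ->
  exists2 B : R, 0 < B & forall x y, `|f (x + y) - f x| <= B * `|y|.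
Proof.
move=> Cf fM.
have /choice[B HB] : forall i : 'I_d, exists B, 0 < B /\ forall x, `|partial i f x| <= B.
  move=> i; have [B B0 HB] := continuous_bounded_supp (Ck_continuous (Ck_partial Cf i))
    (partial_bounded_supp i fM).
  by exists B.
exists (\sum_i B i + 1).
  by rewrite ltr_wpDl// sumr_ge0// => i _; rewrite ltW//; case: (HB i).
move=> x y; have [xi _ ->] := C1_telescope x y Cf.
apply: (le_trans (ler_norm_sum _ _ _)).
apply: (@le_trans _ _ (\sum_i B i * `|y|)); last first.
  by rewrite -mulr_suml ler_wpM2r// lerDl.
apply: ler_sum => i _; rewrite normrM mulrC ler_pM ?rV_norm_coord//.
by case: (HB i).
Qed.

(** At the telescoping points the partial derivatives differ from those at x by O(|y|), because each
    of them is Lipschitz. *)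
Lemma taylor2 f M : Ck 2 f -> (forall x, M < `|x| -> f x = 0) ->
  exists2 B : R, 0 < B &
    forall x y, `|f (x + y) - f x - dot y (grad f x)| <= B * `|y| ^+ 2.
Proof.
move=> Cf fM.
have /choice[B HB] : forall i : 'I_d, exists B, 0 < B /\
    forall x y, `|partial i f (x + y) - partial i f x| <= B * `|y|.
  move=> i; have [B B0 HB] := lipschitz_C1 (Ck_partial Cf i) (partial_bounded_supp i fM).
  by exists B.
exists (\sum_i B i + 1).
  by rewrite ltr_wpDl// sumr_ge0// => i _; rewrite ltW//; case: (HB i).
move=> x y; have [xi xix ->] := C1_telescope x y (Ck_pred Cf).
rewrite /dot -sumrB.
apply: (le_trans (ler_norm_sum _ _ _)).
apply: (@le_trans _ _ (\sum_i B i * `|y| ^+ 2)); last first.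
  by rewrite -mulr_suml ler_wpM2r ?exprn_ge0// lerDl.
apply: ler_sum => i _; rewrite /grad mxE -mulrBr normrM.
have [Bi H] := HB i.
rewrite expr2 mulrA mulrC ler_pM ?rV_norm_coord//.
rewrite -[xi i](subrK x) [_ - x + x]addrC; apply: (le_trans (H _ _)).
by rewrite ler_wpM2l// ltW.
Qed.

Lemma norm_le_enorm y : `|y| <= enorm y.
Proof.
apply/rV_normP => [|i]; first exact: sqrtr_ge0.
rewrite -sqrtr_sqr ler_sqrt; last by apply: sumr_ge0 => j _; rewrite -expr2 sqr_ge0.
by rewrite /dot (bigD1 i)//= -expr2 lerDl sumr_ge0// => j _; rewrite -expr2 sqr_ge0.
Qed.

Lemma enorm_ge0 y : 0 <= enorm y. Proof. exact: sqrtr_ge0. Qed.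

Lemma enormZ (a : R) y : enorm (a *: y) = `|a| * enorm y.
Proof.
rewrite /enorm -sqrtr_sqr -sqrtrM ?sqr_ge0//; congr Num.sqrt.
by rewrite /dot mulr_sumr; apply: eq_bigr => i _; rewrite !mxE; ring.
Qed.

Lemma enormN y : enorm (- y) = enorm y.
Proof. by rewrite -scaleN1r enormZ normrN1 mul1r. Qed.

Lemma continuous_dot v : continuous (fun y : 'rV[R]_d => dot y v).
Proof.
rewrite (_ : (fun y => _) = \sum_i (fun y : 'rV[R]_d => y ord0 i * v ord0 i)).
  by apply: (Ck_continuous (k := 0)); apply: Ck_sum => i; apply: (@CkM _ _ _ (fun y => y ord0 i) (cst (v ord0 i)));
    [exact: Ck_coord|exact: Ck_cst].
by apply/funext => y; rewrite fct_sumE.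
Qed.

Lemma continuous_enorm : continuous (@enorm R d).
Proof.
move=> x; apply: continuous_comp; last exact: sqrt_continuous.
have : Ck 0 (\sum_i (fun y : 'rV[R]_d => y ord0 i * y ord0 i)).
  by apply: Ck_sum => i; apply: (@CkM _ _ _ (fun y => y ord0 i) (fun y => y ord0 i)); exact: Ck_coord.
move=> /Ck_continuous/(_ x).
by rewrite (_ : \sum_i _ = fun y => dot y y)//; apply/funext => y; rewrite fct_sumE.
Qed.

Lemma continuous_measurable_rVR f : continuous f -> measurable_fun setT f.
Proof.
move=> cf; apply: (measurability _ (RGenOpens.measurableE R)) => _ [_ [a [b ->] <-]].
rewrite setTI; apply: open_measurable_rV.
by apply: open_comp; [move=> x _; exact: cf|exact: interval_open].
Qed.

End taylor.

(** * The operator and its generator property *)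

Section levy_operator.
Context {R : realType} {d : nat}.
Variables (b : 'rV[R]_d) (nu : {measure set 'rV[R]_d -> \bar R}).
Hypothesis hnu : levy_measure nu.
Implicit Types (x y z : 'rV[R]_d) (f g : 'rV[R]_d -> R).

Local Notation L := (levy_op b nu).

Definition levy_int f x y : R :=
  f (x + y) - f x - dot y (grad f x) * \1_[set z | enorm z < 1] y.

Lemma levy_opE f x : L f x = dot b (grad f x) + \int[nu]_y levy_int f x y.
Proof. by []. Qed.

Lemma continuous_addl x : continuous (fun y : 'rV[R]_d => x + y).
Proof. by move=> y; apply: continuousD; [exact: cst_continuous|exact: cvg_id]. Qed.

Lemma measurable_enorm_lt (c : R) : measurable [set z : 'rV[R]_d | enorm z < c].
Proof.
apply: open_measurable_rV.
rewrite (_ : mkset _ = @enorm R d @^-1` [set t | t < c])//.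
by apply: open_comp => [z _|]; [exact: continuous_enorm|exact: open_lt].
Qed.

Lemma measurable_enorm_ge (c : R) : measurable [set z : 'rV[R]_d | c <= enorm z].
Proof.
rewrite (_ : mkset _ = ~` [set z | enorm z < c]); last first.
  by apply/seteqP; split => z /=; rewrite leNgt => /negP.
by apply: measurableC; exact: measurable_enorm_lt.
Qed.

Lemma measurable_levy_int f x : continuous f -> measurable_fun setT (levy_int f x).
Proof.
move=> cf; apply: measurable_funB.
  apply: measurable_funB => //; apply: continuous_measurable_rVR => y.
  by apply: continuous_comp; [exact: continuous_addl|exact: cf].
apply: measurable_funM; last exact: (measurable_indic (measurable_enorm_lt 1)).
by apply: continuous_measurable_rVR; exact: continuous_dot.
Qed.

(** Jumps shorter than 1 carry the compensator and are handled by Taylor's bound, the others by the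
    supremum of f. The constant is uniform in x. *)
Lemma levy_int_bound f : Cck 2 setT f -> exists2 C : R, 0 < C &
  forall x y, `|levy_int f x y| <= C * Num.min 1 (enorm y ^+ 2).
Proof.
move=> Cf; have [M M0 fM] := Cck_bounded_supp Cf; have [C2 _ _] := Cf.
have [B B0 HB] := taylor2 C2 fM.
have [A A0 HA] := continuous_bounded_supp (Ck_continuous C2) fM.
exists (B + 2 * A); first by rewrite addr_gt0// mulr_gt0.
move=> x y; rewrite /levy_int indicE; have [y1|y1] := ltP (enorm y) 1.
  rewrite mem_set//= mulr1 min_r; last by rewrite expr_le1 ?enorm_ge0// ltW.
  apply: (le_trans (HB x y)); apply: (@le_trans _ _ (B * enorm y ^+ 2)).
    by rewrite ler_wpM2l ?(ltW B0)// lerXn2r ?nnegrE ?enorm_ge0// norm_le_enorm.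
  by rewrite ler_wpM2r ?sqr_ge0// lerDl mulr_ge0// ltW.
rewrite memNset /= ?mulr0 ?subr0; last by apply/negP; rewrite -leNgt.
rewrite min_l ?mulr1; last by rewrite exprn_ege1.
apply: (le_trans (ler_normB _ _)); apply: (le_trans (lerD (HA _) (HA _))).
by rewrite mulr_natl mulr2n lerDr ltW.
Qed.

Lemma integrable_levy_weight :
  nu.-integrable setT (fun y => (Num.min 1 (enorm y ^+ 2))%:E).
Proof.
have m : measurable_fun setT (fun y : 'rV[R]_d => Num.min 1 (enorm y ^+ 2)).
  apply: measurable_minr => //; apply: measurable_funX.
  exact: (continuous_measurable_rVR continuous_enorm).
apply/integrableP; split; first exact/measurable_EFinP.
under eq_integral => y _ do rewrite gee0_abs ?lee_fin ?le_min ?ler01 ?sqr_ge0//.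
by case: hnu.
Qed.

Lemma integrable_levy_int f x : Cck 2 setT f ->
  nu.-integrable setT (EFin \o levy_int f x).
Proof.
move=> Cf; have [C C0 HC] := levy_int_bound Cf; have [C2 _ _] := Cf.
apply: (@le_integrable _ _ _ _ _ measurableT _
  (fun y => C%:E * (Num.min 1 (enorm y ^+ 2))%:E)%E).
- by apply/measurable_EFinP; apply: measurable_levy_int; exact: (Ck_continuous C2).
- move=> y _ /=; rewrite lee_fin [leRHS]ger0_norm//.
  by rewrite mulr_ge0 ?(ltW C0)// le_min ler01 sqr_ge0.
- by apply: integrableZl => //; exact: integrable_levy_weight.
Qed.

Lemma dotDr x y z : dot x (y + z) = dot x y + dot x z.
Proof. by rewrite /dot -big_split; apply: eq_bigr => i _; rewrite mxE mulrDr. Qed.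

Lemma dotZr (a : R) x y : dot x (a *: y) = a * dot x y.
Proof. by rewrite /dot mulr_sumr; apply: eq_bigr => i _; rewrite mxE mulrCA. Qed.

Lemma dot0r x : dot x 0 = 0.
Proof. by rewrite /dot big1// => i _; rewrite mxE mulr0. Qed.

Lemma gradD f g x : Ck 1 f -> Ck 1 g -> grad (f + g) x = grad f x + grad g x.
Proof.
move=> Cf Cg; apply/rowP => i; rewrite !mxE.
by have [_ E] := is_deriveD (Ck_is_derive Cf i x) (Ck_is_derive Cg i x); exact: E.
Qed.

Lemma gradZ (a : R) f x : Ck 1 f -> grad (fun x => a * f x) x = a *: grad f x.
Proof.
move=> Cf; apply/rowP => i; rewrite !mxE.
by have [_ E] := is_deriveZ a (Ck_is_derive Cf i x); exact: E.
Qed.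

Lemma grad_affine (a : R) z f x : Ck 1 f ->
  grad (fun x => f (a *: x + z)) x = a *: grad f (a *: x + z).
Proof.
move=> Cf; apply/rowP => i; rewrite !mxE.
by have [_ E] := is_derive_affine (Ck_is_derive Cf i (a *: x + z)); exact: E.
Qed.

Lemma grad_ramp m f x : Ck 1 f ->
  grad (fun x => ramp m (f x)) x = dramp m (f x) *: grad f x.
Proof.
move=> Cf; apply/rowP => i; rewrite !mxE.
by have [_ E] := is_derive_comp (Ck_is_derive Cf i x) (is_derive_ramp m (f x)); exact: E.
Qed.

Lemma grad_near_cst f x (c : R) : (\near x, f x = c) -> grad f x = 0.
Proof.
move=> H; apply/rowP => i; rewrite !mxE (@partial_eq _ _ _ (cst c))//.
exact: partial_cst.
Qed.

Lemma CckD k V f g : Cck k V f -> Cck k V g -> Cck k V (f + g).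
Proof.
move=> [Cf cf sf] [Cg cg sg].
apply: (@CckI _ _ _ _ (supp f `|` supp g)); first exact: CkD.
- exact: compactU.
- by move=> x /not_orP[/supp_eq0 fx /supp_eq0 gx]; rewrite !fctE fx gx addr0.
- by rewrite subUset.
Qed.

Lemma CckZ k V (a : R) f : Cck k V f -> Cck k V (fun x => a * f x).
Proof.
move=> [Cf cf sf]; apply: (@CckI _ _ _ _ (supp f)) => //; first exact: CkZ.
by move=> x /supp_eq0 ->; rewrite mulr0.
Qed.

Lemma CckB k V f g : Cck k V f -> Cck k V g -> Cck k V (f - g).
Proof.
move=> Cf Cg; rewrite (_ : f - g = f + (fun x => -1 * g x)).
  by apply: CckD => //; exact: CckZ.
by apply/funext => x; rewrite !fctE mulN1r.
Qed.

Lemma Cck_affine k (a : R) z f : a != 0 -> Cck k setT f ->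
  Cck k setT (fun x => f (a *: x + z)).
Proof.
move=> a0 Cf; have [M M0 fM] := Cck_bounded_supp Cf; have [C2 _ _] := Cf.
have a0' : 0 < `|a| by rewrite normr_gt0.
apply: (@CckT_bounded _ _ _ _ ((M + `|z|) / `|a|)); first exact: Ck_affine.
move=> x; rewrite ltr_pdivrMr// => H; apply: fM.
by rewrite (lt_le_trans _ (lerB_normD _ _))// normrZ ltrBrDr mulrC.
Qed.

Lemma levy_opD f g x : Cck 2 setT f -> Cck 2 setT g ->
  L (f + g) x = L f x + L g x.
Proof.
move=> Cf Cg; rewrite !levy_opE gradD; [|by case: Cf => /Ck_pred|by case: Cg => /Ck_pred].
rewrite dotDr [RHS]addrACA; congr +%R.
rewrite -RintegralD ?integrable_levy_int//; apply: eq_Rintegral => y _.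
rewrite /levy_int gradD; [|by case: Cf => /Ck_pred|by case: Cg => /Ck_pred].
by rewrite dotDr !fctE; ring.
Qed.

Lemma levy_opZ (a : R) f x : Cck 2 setT f ->
  L (fun x => a * f x) x = a * L f x.
Proof.
move=> Cf; rewrite !levy_opE gradZ; last by case: Cf => /Ck_pred.
rewrite dotZr [RHS]mulrDr; congr +%R.
rewrite -RintegralZl ?integrable_levy_int//; apply: eq_Rintegral => y _.
rewrite /levy_int gradZ; last by case: Cf => /Ck_pred.
by rewrite dotZr; ring.
Qed.

Lemma levy_opB f g x : Cck 2 setT f -> Cck 2 setT g ->
  L (f - g) x = L f x - L g x.
Proof.
move=> Cf Cg; have -> : f - g = f + (fun y => -1 * g y).
  by apply/funext => y; rewrite !fctE mulN1r.
by rewrite levy_opD// ?levy_opZ// ?mulN1r//; exact: CckZ.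
Qed.

Lemma levy_op_translate z f x : Ck 1 f ->
  L (fun x => f (x + z)) x = L f (x + z).
Proof.
move=> Cf.
have gE : grad (fun x => f (x + z)) x = grad f (x + z).
  have E : (fun x => f (1 *: x + z)) = (fun x => f (x + z)).
    by apply/funext => y; rewrite scale1r.
  by have := grad_affine 1 z x Cf; rewrite E !scale1r.
have iE : levy_int (fun x => f (x + z)) x = levy_int f (x + z).
  by apply/funext => y; rewrite /levy_int gE [x + y + z]addrAC.
by rewrite levy_opE gE iE.
Qed.

Lemma Cck_ramp k m f : 0 < m -> Cck k setT f -> Cck k setT (fun x => ramp m (f x)).
Proof.
move=> m0 Cf; have [M M0 fM] := Cck_bounded_supp Cf; have [C2 _ _] := Cf.
by apply: (@CckT_bounded _ _ _ _ M); [exact: Ck_ramp|move=> x /fM ->; rewrite ramp_le0].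
Qed.

(** Convexity bounds the increments of the composition below by [dramp m (f x)] times those of f,
    and by the chain rule the gradient terms match exactly, so the inequality passes through the
    integral. *)
Lemma levy_op_ramp m f x : 0 < m -> Cck 2 setT f ->
  dramp m (f x) * L f x <= L (fun x => ramp m (f x)) x.
Proof.
move=> m0 Cf; rewrite !levy_opE grad_ramp; last by case: Cf => /Ck_pred.
rewrite dotZr mulrDr lerD2l -RintegralZl ?integrable_levy_int//.
apply: le_Rintegral => //.
- have := integrable_levy_int x (CckZ (dramp m (f x)) Cf).
  apply: eq_integrable => // y _ /=; rewrite /levy_int gradZ ?dotZr; last by case: Cf => /Ck_pred.
  by congr EFin; ring.
- exact: (integrable_levy_int x (Cck_ramp m0 Cf)).
move=> y _; rewrite /levy_int grad_ramp; last by case: Cf => /Ck_pred.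
rewrite dotZr mulrBr lerB// ?mulrA//.
exact: ramp_convex.
Qed.

(** The value and the gradient at x vanish, hence also the drift and the compensator: only the jumps
    remain. *)
Lemma levy_op_near0 f x : (\near x, f x = 0) -> L f x = \int[nu]_y f (x + y).
Proof.
move=> H; rewrite levy_opE (grad_near_cst H) dot0r add0r; apply: eq_Rintegral => y _.
by rewrite /levy_int (grad_near_cst H) dot0r mul0r (nbhs_singleton H) !subr0.
Qed.

Lemma levy_op_near0_ge0 f x : (\near x, f x = 0) -> (forall y, 0 <= f y) -> 0 <= L f x.
Proof. by move=> H f0; rewrite levy_op_near0// Rintegral_ge0. Qed.

(** Markov's inequality: the weight min(1, |y|^2) is at least min(1, c^2) on these jumps. *)
Lemma nu_far_lty (c : R) : 0 < c -> (nu [set y | (c <= enorm y)%R] < +oo)%E.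
Proof.
move=> c0; pose m := Num.min 1 (c ^+ 2).
have m0 : 0 < m by rewrite lt_min ltr01 exprn_gt0.
have mE := measurable_enorm_ge c.
have H : (m%:E * nu [set y | (c <= enorm y)%R] <= \int[nu]_y (Num.min 1 (enorm y ^+ 2))%:E)%E.
  rewrite -integral_cst// integral_mkcond; apply: ge0_le_integral => //.
  - by move=> y _; rewrite erestrict_ge0// => z _; rewrite lee_fin ltW.
  - by apply/(measurable_restrictT _ _).1 => //; exact: measurable_cst.
  - by case/integrableP: integrable_levy_weight.
  - move=> y _; rewrite patchE; case: ifPn; last by rewrite lee_fin le_min ler01 sqr_ge0.
    rewrite inE /= => cy; rewrite lee_fin /m le_min !ge_min lexx /=.
    by rewrite lerXn2r ?nnegrE ?enorm_ge0 ?(ltW c0)// orbT.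
have [_ foo] := hnu; have := le_lt_trans H foo.
by rewrite -lte_pdivlMl// mulry gtr0_sg ?invr_gt0// mul1e.
Qed.

End levy_operator.

(** * Duality by reflection *)

Section dual_operator.
Context {R : realType} {d : nat}.
Variables (b : 'rV[R]_d) (nu : {measure set 'rV[R]_d -> \bar R}).
Hypothesis hnu : levy_measure nu.
Implicit Types (x y z : 'rV[R]_d) (f g : 'rV[R]_d -> R).

Lemma levy_measure_refl : levy_measure (refl_measure nu).
Proof.
have [h1 h2] := hnu; split.
  rewrite /refl_measure /= /pushforward (_ : _ @^-1` _ = [set 0])//.
  by apply/seteqP; split=> x /=; [move=> /eqP; rewrite oppr_eq0 => /eqP|move=> ->; rewrite oppr0].
rewrite /refl_measure /= ge0_integral_pushforward//=.
- by rewrite preimage_setT; under eq_integral => y _ do rewrite /= enormN.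
- exact: oppr_measurable_rV.
- by case/integrableP: (integrable_levy_weight hnu).
- by move=> y _; rewrite lee_fin le_min ler01 sqr_ge0.
Qed.

(** The dual operator is L conjugated by x -> - x. Stability and the generator property are
    transferred to it through this identity. *)
Lemma levy_op_dualE f x : Cck 2 setT f ->
  levy_op_dual b nu f x = levy_op b nu (fun z => f (- z)) (- x).
Proof.
move=> Cf; have C1f : Ck 1 f by case: Cf => /Ck_pred.
have fE : (fun z => f (- z)) = (fun z => f (-1 *: z + 0)).
  by apply/funext => z; rewrite scaleN1r addr0.
have Cg : Cck 2 setT (fun z => f (- z)).
  by rewrite fE; apply: Cck_affine => //; rewrite oppr_eq0 oner_eq0.
have gE : grad (fun z => f (- z)) (- x) = - grad f x.
  by rewrite fE grad_affine// !scaleN1r addr0 opprK.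
have iE y : levy_int (fun z => f (- z)) (- x) y = levy_int f x (- y).
  rewrite /levy_int gE opprD !opprK; congr (_ - _).
  rewrite (_ : \1_[set z | enorm z < 1] (- y) = \1_[set z | enorm z < 1] y).
    congr (_ * _); rewrite /dot; apply: eq_bigr => i _.
    by rewrite !mxE mulrN mulNr.
  have iE z : \1_[set z : 'rV[R]_d | enorm z < 1] z = ((enorm z < 1)%R : nat)%:R :> R.
    by rewrite indicE mem_setE.
  by rewrite !iE enormN.
rewrite /levy_op_dual !levy_opE gE; congr +%R.
  by rewrite /dot; apply: eq_bigr => i _; rewrite !mxE mulrN mulNr.
rewrite /Rintegral /refl_measure /= integral_pushforward//.
- by rewrite preimage_setT; congr fine; apply: eq_integral => y _; rewrite /= iE.
- exact: oppr_measurable_rV.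
- by apply/measurable_EFinP; apply: measurable_levy_int; exact: (Ck_continuous C1f).
- rewrite preimage_setT.
  by apply: eq_integrable (integrable_levy_int hnu (- x) Cg) => // y _; rewrite /= iE.
Qed.

Lemma Cck_opp k f : Cck k setT f -> Cck k setT (fun z => f (- z)).
Proof.
move=> Cf; rewrite (_ : (fun z => f (- z)) = (fun z => f (-1 *: z + 0))).
  by apply: Cck_affine => //; rewrite oppr_eq0 oner_eq0.
by apply/funext => z; rewrite scaleN1r addr0.
Qed.

Lemma strictly_stable_dual s : strictly_stable s b nu ->
  strictly_stable s (- b) (refl_measure nu).
Proof.
move=> H a a0 f Cf x.
have Cfa : Cck 2 setT (fun z => f (a *: z)).
  rewrite (_ : (fun z => f (a *: z)) = (fun z => f (a *: z + 0))).
    by apply: Cck_affine; rewrite ?gt_eqF.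
  by apply/funext => z; rewrite addr0.
rewrite -/(levy_op_dual b nu _ _) -/(levy_op_dual b nu _ _) !levy_op_dualE//.
have E : (fun z => f (a *: - z)) = (fun z => f (- (a *: z))).
  by apply/funext => z; rewrite scalerN.
by rewrite -scalerN -(H _ a0 _ (Cck_opp Cf)) E.
Qed.

Lemma generated_by_dual dO (Omega : measurableType dO) (P : probability Omega R)
    (X : R -> Omega -> 'rV[R]_d) : generated_by P X (levy_op b nu) ->
  generated_by P (fun t w => - X t w) (levy_op_dual b nu).
Proof.
move=> H f Cf e e0; have [h h0 Hh] := H _ (Cck_opp Cf) e e0.
exists h => // t x th; have := Hh t (- x) th.
rewrite levy_op_dualE// opprK.
by under eq_Rintegral => w _ do rewrite opprD opprK.
Qed.

End dual_operator.

Lemma dist_third (R : realFieldType) (a c u v e : R) : `|u - a| <= e / 3 ->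
  `|c - v| <= e / 3 -> `|u - v| <= e / 3 -> `|a - c| <= e.
Proof. by rewrite !ler_norml => /andP[? ?] /andP[? ?] /andP[? ?]; apply/andP; split; lra. Qed.

Lemma dist_quotient (R : realFieldType) (p q u v t c e : R) : 0 < t ->
  `|p - q| <= c -> `|u - v| <= c -> 2 * c <= e * t ->
  `|(p - u) / t - (q - v) / t| <= e.
Proof.
move=> t0; rewrite -mulrBl normrM normfV (gtr0_norm t0) ler_pdivrMr//.
by rewrite !ler_norml => /andP[? ?] /andP[? ?] ?; apply/andP; split; lra.
Qed.

(** * Consequences of the generator property *)

Section generator.
Context {R : realType} {d : nat} {dO : measure_display} {Omega : measurableType dO}.
Variables (P : probability Omega R) (Y : R -> Omega -> 'rV[R]_d).
Variables (b : 'rV[R]_d) (nu : {measure set 'rV[R]_d -> \bar R}).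
Hypothesis hnu : levy_measure nu.
Hypothesis mY : forall t, 0 <= t -> measurable_fun setT (Y t).
Hypothesis hgen : generated_by P Y (levy_op b nu).
Implicit Types (x y z : 'rV[R]_d) (f g : 'rV[R]_d -> R).

Local Notation L := (levy_op b nu).

Lemma integrable_shift f (A : R) t x : 0 <= t -> continuous f ->
  (forall y, `|f y| <= A) -> P.-integrable setT (EFin \o (fun w => f (x + Y t w))).
Proof.
move=> t0 cf fA; apply: measurable_bounded_integrable => //.
- exact: (le_lt_trans (probability_le1 P measurableT) (ltry 1)).
- apply: (measurableT_comp (f := fun y => f (x + y))); last exact: mY.
  apply: continuous_measurable_rVR => y.
  by apply: continuous_comp; [exact: continuous_addl|exact: cf].
- exists A; split; first exact: num_real.
  by move=> M AM w _; rewrite /= (le_trans (fA _))// ltW.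
Qed.

(** The semigroup averages translates, so it keeps the Lipschitz constant of f. *)
Lemma semigroup_lipschitz f (A B : R) t x z : 0 <= t -> continuous f ->
  (forall y, `|f y| <= A) ->
  (forall x y, `|f (x + y) - f x| <= B * `|y|) ->
  `|\int[P]_w f (x + z + Y t w) - \int[P]_w f (x + Y t w)| <= B * `|z|.
Proof.
move=> t0 cf fA fB.
rewrite -RintegralB//; [|exact: (integrable_shift _ t0 cf fA)..].
apply: (le_trans (le_normr_Rintegral _ _)) => //.
  have := integrableB measurableT (integrable_shift (x + z) t0 cf fA) (integrable_shift x t0 cf fA).
  by apply: eq_integrable.
rewrite -[leRHS]mulr1 -[X in _ * X](_ : fine (P setT) = 1); last first.
  by rewrite probability_setT.
rewrite -Rintegral_cst//; apply: le_Rintegral => //.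
- apply: integrable_norm => //.
  have := integrableB measurableT (integrable_shift (x + z) t0 cf fA) (integrable_shift x t0 cf fA).
  by apply: eq_integrable.
- exact: finite_measure_integrable_cst.
- by move=> w _; rewrite [x + z + _]addrAC; exact: fB.
Qed.

(** Convergence to the generator is uniform in x, so one fixed time compares L f everywhere with a
    bounded difference quotient. *)
Lemma levy_op_bounded f : Cck 2 setT f -> exists2 C : R, 0 < C & forall x, `|L f x| <= C.
Proof.
move=> Cf; have [M M0 fM] := Cck_bounded_supp Cf; have [C2 _ _] := Cf.
have [A A0 HA] := continuous_bounded_supp (Ck_continuous C2) fM.
have [h h0 Hh] := hgen Cf ltr01.
pose t := h / 2; have t0 : 0 < t by rewrite divr_gt0.
exists (1 + 2 * A / t); first by rewrite addr_gt0// divr_gt0// mulr_gt0.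
move=> x; have th : 0 < t < h by rewrite t0 /= ltr_pdivrMr// ltr_pMr// ltr1n.
have := Hh t x th; rewrite distrC => H.
rewrite -[L f x](subrK ((\int[P]_w f (x + Y t w) - f x) / t)).
apply: (le_trans (ler_normD _ _)); rewrite lerD// normrM normfV (gtr0_norm t0).
rewrite ler_pM2r ?invr_gt0// (le_trans (ler_normB _ _))// mulr_natl mulr2n lerD//.
have iS := integrable_shift x (ltW t0) (Ck_continuous C2) HA.
apply: (le_trans (le_normr_Rintegral _ _)) => //.
rewrite -[leRHS]mulr1 -[X in _ * X](_ : fine (P setT) = 1); last first.
  by rewrite probability_setT.
rewrite -Rintegral_cst//; apply: le_Rintegral => //.
- exact: integrable_norm.
- exact: finite_measure_integrable_cst.
Qed.

(** Up to e/3, uniformly, L f is a difference quotient at one fixed time, and that quotient is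
    Lipschitz in x. *)
Lemma levy_op_continuous f : Cck 2 setT f -> continuous (L f).
Proof.
move=> Cf x; have [M M0 fM] := Cck_bounded_supp Cf; have [C2 _ _] := Cf.
have cf := Ck_continuous C2.
have [A A0 HA] := continuous_bounded_supp cf fM.
have [B B0 HB] := lipschitz_C1 (Ck_pred C2) fM.
apply: (@cvgrPdist_le _ _ _ (nbhs (x : 'rV[R]_d)) _ (L f) (L f x)).2 => e e0.
have e3 : 0 < e / 3 by rewrite divr_gt0.
have [h h0 Hh] := hgen Cf e3.
pose t := h / 2; have t0 : 0 < t by rewrite divr_gt0.
have th : 0 < t < h by rewrite t0 /= ltr_pdivrMr// ltr_pMr// ltr1n.
near=> y.
have H1 := Hh t x th; have := Hh t y th; rewrite distrC => H2.
apply: (dist_third H1 H2).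
have xy : y + (x - y) = x by rewrite addrC subrK.
apply: (dist_quotient (c := B * `|x - y|)) => //.
- by rewrite -{1}xy; exact: (semigroup_lipschitz _ _ (ltW t0) cf HA HB).
- by rewrite -{1}xy; exact: HB.
rewrite mulrCA -ler_pdivlMl// -ler_pdivlMl ?mulr_gt0//.
near: y; apply: (@cvgr_dist_le _ _ _ (nbhs x) _ id x) => //.
by rewrite mulr_gt0 ?invr_gt0// mulr_gt0 ?invr_gt0// mulr_gt0.
Unshelve. all: by end_near. Qed.

End generator.

(** * Approximation of a law by point masses *)

Section discretization.
Context {R : realType} {d : nat} {dO : measure_display} {Omega : measurableType dO}.
Variable P : probability Omega R.
Implicit Types (x y z : 'rV[R]_d) (f g : 'rV[R]_d -> R).

Lemma Rintegral_sum (dT : measure_display) (T : measurableType dT)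
    (mu : {measure set T -> \bar R}) n (F : nat -> T -> R) :
  (forall i, mu.-integrable setT (EFin \o F i)) ->
  mu.-integrable setT (EFin \o (fun w => \sum_(i < n) F i w)) /\
  \int[mu]_w (\sum_(i < n) F i w) = \sum_(i < n) \int[mu]_w F i w.
Proof.
move=> iF; elim: n => [|n [IH1 IH2]].
  split.
    by apply: eq_integrable (integrable0 _ _) => // w _; rewrite /= big_ord0.
  rewrite big_ord0 (_ : (fun w => _) = cst 0); last by apply/funext => w; rewrite big_ord0.
  by rewrite /Rintegral integral0.
have E : (fun w => \sum_(i < n.+1) F i w) = (fun w => \sum_(i < n) F i w + F n w).
  by apply/funext => w; rewrite big_ord_recr.
rewrite E; split.
  by apply: eq_integrable (integrableD _ IH1 (iF n)).
by rewrite RintegralD// IH2 big_ord_recr.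
Qed.

Lemma Rintegral_probability_cst (c : R) : \int[P]_w c = c.
Proof.
rewrite Rintegral_cst// -[RHS]mulr1; congr (_ * _).
by have : fine (P setT) = 1 by rewrite probability_setT.
Qed.

Lemma dense_seq_rV : exists q : nat -> 'rV[R]_d, forall y r, 0 < r ->
  exists k, `|y - q k| < r.
Proof.
pose q k : 'rV[R]_d := if unpickle k is Some v then map_mx ratr (v : 'rV[rat]_d) else 0.
exists q => y r r0.
have r2 : 0 < r / 2 by rewrite divr_gt0.
have /choice[v Hv] : forall i : 'I_d, exists t : rat, `|y ord0 i - ratr t| < r / 2.
  move=> i; have [t tP] : exists t : rat,
      ratr t \in `](y ord0 i - r / 2), (y ord0 i + r / 2)[.
    by apply: rat_in_itvoo; rewrite ltrD2l gtrN.
  by exists t; rewrite ltr_distlC; move: tP; rewrite in_itv.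
exists (pickle (\row_i v i : 'rV[rat]_d)); rewrite /q pickleK.
apply: (@le_lt_trans _ _ (r / 2)); last by rewrite ltr_pdivrMr// ltr_pMr// ltr1n.
by apply/rV_normP => [|i]; [exact: ltW|rewrite !mxE ltW].
Qed.

(** Turns an average over the law of Z into a finite combination of translates, which keeps
    smoothness and compact support and is compatible with L. The error is uniform in x because f is
    bounded and Lipschitz; mass may be lost, hence total weight at most 1. *)
Lemma discretize_law (Z : Omega -> 'rV[R]_d) f (A B e : R) :
  measurable_fun setT Z -> 0 < A -> 0 < B -> continuous f -> (forall y, `|f y| <= A) ->
  (forall x y, `|f (x + y) - f x| <= B * `|y|) -> 0 < e ->
  exists n (a : nat -> R) (z : nat -> 'rV[R]_d),
  [/\ forall i, 0 <= a i, \sum_(i < n) a i <= 1 &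
     forall x, `|\int[P]_w f (x + Z w) - \sum_(i < n) a i * f (x + z i)| <= e].
Proof.
move=> mZ A0 B0 cf fA fB e0.
have [q Hq] := dense_seq_rV.
(* Half of the error pays for moving [Z w] to the centre of its cell, at cost B r, and half for the
   cells after the first n, at cost A times their mass. *)
pose r := e / 2 / B; have r0 : 0 < r by rewrite !divr_gt0.
pose F k : set Omega := Z @^-1` [set y | `|y - q k| < r].
have mF k : measurable (F k).
  rewrite -[F k]setTI; apply: mZ => //; apply: open_measurable_rV.
  rewrite (_ : mkset _ = (fun y => y - q k) @^-1` [set y | `|y| < r])//.
  apply: open_comp => [y _|]; last exact: open_norm_lt.
  by apply: continuousB; [exact: cvg_id|exact: cst_continuous].
pose D := seqDU F.
have mD k : measurable (D k) by exact: seqDU_measurable.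
have tD : trivIset setT D by exact: trivIset_seqDU.
have UD : \bigcup_k D k = setT.
  rewrite -seqDU_bigcup_eq; apply/seteqP; split => // w _.
  by have [k Hk] := Hq (Z w) r r0; exists k.
pose a k := fine (P (D k)).
have aE k : (a k)%:E = P (D k) by rewrite fineK// fin_num_measure.
have a0 k : 0 <= a k by rewrite fine_ge0.
have ca : (\sum_(0 <= k < n) a k) @[n --> \oo] --> (1 : R).
  have H := measure_sigma_additive (mu := P) mD tD.
  have {H} : (\sum_(0 <= i < n) P (D i))%E @[n --> \oo] --> (1 : R)%:E.
    by rewrite -(probability_setT P) -UD; exact: H.
  move/fine_cvg.
  rewrite (_ : fine \o _ = (fun n => \sum_(0 <= k < n) a k))//.
  by apply/funext => n /=; rewrite -(eq_bigr _ (fun k _ => aE k)) sumEFin.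
have [n an] : exists n, 1 - \sum_(i < n) a i <= e / 2 / A.
  have e2 : 0 < e / 2 / A by rewrite !divr_gt0.
  have /cvgrPdist_le/(_ _ e2)[n _ Hn] := ca.
  exists n; have := Hn n (leqnn n); rewrite big_mkord; exact: le_trans (ler_norm _).
have i1 k : P.-integrable setT (EFin \o (\1_(D k) : Omega -> R)).
  exact: integrable_indic.
have I1 k : \int[P]_w (\1_(D k) w) = a k by rewrite /Rintegral integral_indic// setIT.
have sD w : (exists2 k : 'I_n, D k w & forall j : 'I_n, j != k -> ~ D j w) \/
    (forall k : 'I_n, ~ D k w).
  have [[k Dk]|H] := pselect (exists k : 'I_n, D k w); [left|right].
    exists k => // j jk Dj; move/eqP: jk; apply; apply/val_inj.
    by apply: (tD j k) => //; exists w.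
  by move=> k Dk; apply: H; exists k.
have ind1 k w : D k w -> \1_(D k) w = 1 :> R by move=> h; rewrite indicE mem_set.
have ind0 k w : ~ D k w -> \1_(D k) w = 0 :> R by move=> h; rewrite indicE memNset.
have [iS1 IS1_] := Rintegral_sum n i1.
have IS1 : \int[P]_w (\sum_(i < n) \1_(D i) w) = \sum_(i < n) a i.
  by rewrite IS1_; apply: eq_bigr => i _; exact: I1.
have sum1 : \sum_(i < n) a i <= 1.
  rewrite -IS1.
  rewrite -[leRHS](Rintegral_probability_cst 1).
  apply: le_Rintegral => //; first exact: finite_measure_integrable_cst.
  move=> w _; have [[k Dk Hk]|H] := sD w.
    by rewrite (bigD1 k)//= ind1// big1 ?addr0// => j /Hk; exact: ind0.
  by rewrite big1// => j _; apply: ind0; exact: H.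
exists n, a, q; split => // x.
have ic (c : R) k : P.-integrable setT (EFin \o (fun w => \1_(D k) w * c)).
  have := integrableZl measurableT c (i1 k).
  by apply: eq_integrable => // w _; rewrite /= mulrC.
have Ic (c : R) k : \int[P]_w (\1_(D k) w * c) = a k * c.
  by rewrite RintegralZr// I1.
have [iS IS] := Rintegral_sum n (fun k => ic (f (x + q k)) k).
have -> : \sum_(i < n) a i * f (x + q i) = \int[P]_w \sum_(i < n) \1_(D i) w * f (x + q i).
  by rewrite IS; apply: eq_bigr => i _; rewrite Ic.
have iZ : P.-integrable setT (EFin \o (fun w => f (x + Z w))).
  by apply: (@integrable_shift _ _ _ _ P (fun=> Z) (fun _ _ => mZ) f A 0).
rewrite -RintegralB//.
have iB := integrableB measurableT iZ iS.
apply: (le_trans (le_normr_Rintegral _ _)) => //.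
(* On a retained cell the bracket vanishes and B r remains; on the discarded cells the discrete sum
   is 0 and |f| <= A. *)
pose bd w := B * r + A * (1 - \sum_(i < n) \1_(D i) w).
have i1S : P.-integrable setT (EFin \o (fun w => 1 - \sum_(i < n) (\1_(D i) w : R))).
  have := integrableB measurableT (finite_measure_integrable_cst P (1:R) measurableT) iS1.
  by apply: eq_integrable.
have ibd2 : P.-integrable setT (EFin \o (fun w => A * (1 - \sum_(i < n) (\1_(D i) w : R)))).
  by have := integrableZl measurableT A i1S; apply: eq_integrable.
have ibd1 : P.-integrable setT (EFin \o (fun _ : Omega => B * r)).
  exact: finite_measure_integrable_cst.
have ibd : P.-integrable setT (EFin \o bd).
  by have := integrableD measurableT ibd1 ibd2; apply: eq_integrable.
apply: (@le_trans _ _ (\int[P]_w bd w)).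
  apply: le_Rintegral => //.
    by apply: integrable_norm.
  move=> w _; rewrite /bd; have [[k Dk Hk]|H] := sD w.
    have Z0 j : j != k -> \1_(D j) w = 0 :> R by move=> /Hk; exact: ind0.
    rewrite (bigD1 k)//= ind1// big1 ?addr0; last by move=> j /Z0 ->; rewrite mul0r.
    rewrite (bigD1 k)//= ind1// big1 ?addr0; last by move=> j /Z0 ->.
    rewrite subrr mulr0 addr0 mul1r.
    have -> : x + Z w = (x + q k) + (Z w - q k) by rewrite addrACA subrr addr0.
    apply: (le_trans (fB _ _)); rewrite ler_wpM2l ?ltW//.
    by have := @subset_seqDU _ F k _ Dk.
  have Z0 (j : 'I_n) : \1_(D j) w = 0 :> R by apply: ind0; exact: H.
  rewrite big1 ?subr0; last by move=> j _; rewrite Z0 mul0r.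
  rewrite big1 ?subr0; last by move=> j _; rewrite Z0.
  by rewrite mulr1 (le_trans (fA _))// lerDr mulr_ge0 ?ltW.
rewrite /bd RintegralD// Rintegral_probability_cst RintegralZl//.
rewrite RintegralB//; last exact: (finite_measure_integrable_cst P (1:R) measurableT).
rewrite Rintegral_probability_cst IS1.
have -> : B * r = e / 2 by rewrite /r mulrC divfK// gt_eqF.
rewrite [leRHS](splitr e) lerD2l mulrC.
by rewrite -ler_pdivlMr.
Qed.

End discretization.

(** * Polarity of the origin *)

Section lebesgue_cube.
Context {R : realType} {d : nat}.
Implicit Types (x z : 'rV[R]_d) (r : R).

Lemma leb_cube z r : 0 <= r ->
  leb d [set x : 'rV[R]_d | `|x + z| <= r] = ((2 * r) ^+ d)%:E.
Proof.
move=> r0.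
have -> : [set x : 'rV[R]_d | `|x + z| <= r] =
    [set x | forall i, `[- r - z ord0 i, r - z ord0 i]%classic (x ord0 i)].
  apply/seteqP; split => x /=.
    move=> /(rV_normP _ r0) H i; have := H i; rewrite !mxE ler_norml in_itv/=.
    by rewrite lerBlDr lerBrDr.
  move=> H; apply/rV_normP => // i; have := H i.
  by rewrite /= in_itv/= !mxE ler_norml lerBlDr lerBrDr.
rewrite (leb_cylinder (fun i => measurable_itv _)).
rewrite (eq_bigr (fun=> (2 * r)%:E)); last first.
  move=> i _; rewrite lebesgue_measure_itv/= lte_fin ltrD2r.
  have [_|] := ltP (- r) r; first by rewrite -EFinB; congr EFin; ring.
  move=> h; have -> : r = 0 by apply/eqP; rewrite eq_le r0 andbT; lra.
  by rewrite mulr0.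
by rewrite prodEFin prodr_const card_ord.
Qed.

Lemma leb_ball_lty r : (leb d [set x : 'rV[R]_d | (`|x| <= r)%R] < +oo)%E.
Proof.
have [r0|r0] := leP 0 r.
  rewrite (_ : mkset _ = [set x : 'rV[R]_d | (`|x + 0| <= r)%R]) ?leb_cube ?ltry//.
  by apply/seteqP; split => x /=; rewrite addr0.
rewrite (_ : mkset _ = set0) ?measure0//.
by apply/seteqP; split => x //= xr; have := le_lt_trans xr r0; rewrite ltNge normr_ge0.
Qed.

End lebesgue_cube.

(** * Discrete resolvents *)

Section potential.
Context {R : realType} {d : nat}.
Variables (b : 'rV[R]_d) (nu : {measure set 'rV[R]_d -> \bar R}).
Hypothesis hnu : levy_measure nu.
Implicit Types (x y z : 'rV[R]_d) (f g F : 'rV[R]_d -> R).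

Local Notation L := (levy_op b nu).

Variables (n : nat) (a : nat -> R) (z : nat -> 'rV[R]_d).
Hypothesis a0 : forall i, 0 <= a i.
Hypothesis a1 : \sum_(i < n) a i <= 1.

(** Plays the role of the semigroup at time h: a sub-Markov average of translates. *)
Let S F x : R := \sum_(i < n) a i * F (x + z i).

Let S_ge0 F : (forall x, 0 <= F x) -> forall x, 0 <= S F x.
Proof. by move=> F0 x; apply: sumr_ge0 => i _; rewrite mulr_ge0. Qed.

Let S_norm F (c : R) : 0 <= c -> (forall x, `|F x| <= c) -> forall x, `|S F x| <= c.
Proof.
move=> c0 Fc x; apply: (le_trans (ler_norm_sum _ _ _)).
apply: (@le_trans _ _ (\sum_(i < n) a i * c)).
  by apply: ler_sum => i _; rewrite normrM (ger0_norm (a0 i)) ler_wpM2l.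
by rewrite -mulr_suml ler_piMl.
Qed.

Let Cck_transl k F y : Cck k setT F -> Cck k setT (fun x => F (x + y)).
Proof.
move=> CF; rewrite (_ : (fun x => _) = (fun x => F (1 *: x + y))).
  by apply: Cck_affine => //; exact: oner_neq0.
by apply/funext => x; rewrite scale1r.
Qed.

Let Cck0 k : Cck k setT (fun _ : 'rV[R]_d => 0 : R).
Proof. by apply: (@CckT_bounded _ _ _ _ 0) => //; exact: Ck_cst. Qed.

Lemma Cck_levy_sum N (c : nat -> R) (F : nat -> 'rV[R]_d -> R) :
  (forall k i, Cck k setT (F i)) ->
  (forall k, Cck k setT (fun x => \sum_(i < N) c i * F i x)) /\
  forall x, L (fun x => \sum_(i < N) c i * F i x) x = \sum_(i < N) c i * L (F i) x.
Proof.
move=> CF; elim: N => [|N [IH1 IH2]].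
  have E : (fun x => \sum_(i < 0) c i * F i x) = fun=> 0 by apply/funext => x; rewrite big_ord0.
  rewrite E; split => // x; rewrite big_ord0.
  by have := levy_opZ b hnu 0 x (Cck0 2); rewrite !mul0r.
have E : (fun x => \sum_(i < N.+1) c i * F i x) =
    (fun x => \sum_(i < N) c i * F i x) + (fun x => c N * F N x).
  by apply/funext => x; rewrite big_ord_recr.
rewrite E; split => [k|x]; first by apply: CckD => //; exact: CckZ.
by rewrite levy_opD// ?levy_opZ// ?IH2 ?big_ord_recr//; exact: CckZ.
Qed.

Let Cck_S F : (forall k, Cck k setT F) -> forall k, Cck k setT (S F).
Proof.
move=> CF k; have [] := @Cck_levy_sum n a (fun i x => F (x + z i)) _ => //.
by move=> j i; exact: Cck_transl.
Qed.

Let levy_op_S F x : (forall k, Cck k setT F) -> L (S F) x = S (L F) x.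
Proof.
move=> CF.
have CFi k i : Cck k setT (fun x => F (x + z i)) by exact: Cck_transl.
have [_ E] := @Cck_levy_sum n a (fun i x => F (x + z i)) CFi.
rewrite [LHS]E; apply: eq_bigr => i _.
by rewrite levy_op_translate//; case: (CF 1).
Qed.

Variables (g : 'rV[R]_d -> R) (h e B : R).
Hypothesis h0 : 0 < h.
Hypothesis e0 : 0 <= e.
Hypothesis B0 : 0 <= B.
Hypothesis Cg : forall k, Cck k setT g.
Hypothesis g0 : forall x, 0 <= g x.
Hypothesis g1 : forall x, g x <= 1.
Hypothesis Lg : forall x, `|L g x| <= B.
Hypothesis Sg : forall x, `|L g x - (S g x - g x) / h| <= e.

Let W k := iter k S g.

Let CW k j : Cck j setT (W k).
Proof. by elim: k j => [|k IH] j; [exact: Cg|exact: Cck_S]. Qed.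

Let W0 k x : 0 <= W k x.
Proof. by elim: k x => [|k IH] x; [exact: g0|exact: S_ge0]. Qed.

Let W1 k x : W k x <= 1.
Proof.
apply: (le_trans (ler_norm _)); elim: k x => [|k IH] x.
  by rewrite /W /= ger0_norm.
exact: S_norm.
Qed.

Let LW k x : `|L (W k) x| <= B.
Proof.
elim: k x => [|k IH] x; first exact: Lg.
rewrite (_ : W k.+1 = S (W k))// levy_op_S; last exact: CW.
exact: (S_norm (F := L (W k)) B0 IH).
Qed.

(** The generator estimate is assumed for g alone. S commutes with L and contracts the sup norm, so
    every iterate inherits the estimate with the same e. *)
Let LWd k x : `|L (W k) x - (W k.+1 x - W k x) / h| <= e.
Proof.
elim: k x => [|k IH] x; first exact: Sg.
rewrite (_ : L (W k.+1) x = S (L (W k)) x); last by apply: levy_op_S; exact: CW.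
have -> : S (L (W k)) x - (W k.+2 x - W k.+1 x) / h =
    S (fun y => L (W k) y - (W k.+1 y - W k y) / h) x.
  rewrite (_ : W k.+2 x = S (W k.+1) x)// (_ : W k.+1 x = S (W k) x)//.
  rewrite /S -sumrB mulr_suml -sumrB.
  by apply: eq_bigr => i _; rewrite -[a i * W k.+1 _ - _]mulrBr -mulrA -mulrBr.
exact: (S_norm (F := fun y => L (W k) y - (W k.+1 y - W k y) / h) e0 IH).
Qed.

Let W_lower k x : W k.+1 x - W k x >= - (h * (B + e)).
Proof.
have := LW k x; have := LWd k x.
move: (L _ _) => l; rewrite !ler_norml => /andP[h1 h2] /andP[h3 h4].
have : - (B + e) <= (W k.+1 x - W k x) / h by lra.
by rewrite ler_pdivlMr// mulNr mulrC.
Qed.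

(** Each step costs at most h (B + e), so the value at 0 stays above 1/2 as long as k h (B + e) <=
    1/2. *)
Let W_lower0 k : g 0 = 1 -> 1 - k%:R * (h * (B + e)) <= W k 0.
Proof.
move=> g01; elim: k => [|k IH]; first by rewrite mul0r subr0 /W /= g01.
have := W_lower k 0; rewrite -natr1 mulrDl mul1r; lra.
Qed.

Let q := (1 + h)^-1.

Let q0 : 0 < q. Proof. by rewrite invr_gt0 addr_gt0. Qed.

Let qh : (1 + h) * q = 1.
Proof. by rewrite divff// gt_eqF// addr_gt0. Qed.

(* The truncated resolvent sum_k h q^k S^k g, with q = (1 + h)^-1, of the discrete
   generator (S - 1) / h. *)
Definition resolvent_sum N x : R := \sum_(k < N) (h * q ^+ k) * W k x.

Let sum_weights N : \sum_(k < N) (h * q ^+ k) = (1 + h) * (1 - q ^+ N).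
Proof.
elim: N => [|N IH]; first by rewrite big_ord0 expr0 subrr mulr0.
rewrite big_ord_recr /= IH exprS.
have -> : (1 + h) * (1 - q * q ^+ N) = (1 + h) - ((1 + h) * q) * q ^+ N by ring.
by rewrite qh; ring.
Qed.

(** Abel summation: (1 + h) q = 1 makes q^(k-1) - q^k equal to h q^k, so the differences of W
    reassemble into the resolvent sum itself. *)
Let sum_by_parts N x : \sum_(k < N) q ^+ k * (W k.+1 x - W k x) =
  resolvent_sum N x + (1 + h) * (q ^+ N * W N x - W 0%N x).
Proof.
rewrite /resolvent_sum.
elim: N => [|N IH]; first by rewrite !big_ord0 expr0 mul1r subrr mulr0 addr0.
rewrite !big_ord_recr /= IH exprS -[S (W N) x]/(W N.+1 x).
have -> : (1 + h) * (q * q ^+ N * W N.+1 x - W 0%N x) =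
  ((1 + h) * q) * q ^+ N * W N.+1 x - (1 + h) * W 0%N x by ring.
by rewrite qh; ring.
Qed.

Lemma Cck_resolvent_sum N k : Cck k setT (resolvent_sum N).
Proof. by have [C _] := Cck_levy_sum N (fun k => h * q ^+ k) (fun k i => CW i k). Qed.

Lemma resolvent_sum_ge0 N x : 0 <= resolvent_sum N x.
Proof. by apply: sumr_ge0 => i _; rewrite !mulr_ge0 ?exprn_ge0 ?(ltW q0) ?(ltW h0). Qed.

(** The discrete resolvent equation, with the term coming from g >= 0 dropped. Truncation costs q^N
    and the generator error costs e, both times the total weight, at most 1 + h. *)
Lemma levy_op_resolvent_sum N x :
  L (resolvent_sum N) x <= resolvent_sum N x + (1 + h) * (q ^+ N + e).
Proof.
have [_ ->] := Cck_levy_sum N (fun k => h * q ^+ k) (fun k i => CW i k).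
apply: (@le_trans _ _ (\sum_(k < N) (q ^+ k * (W k.+1 x - W k x) + h * q ^+ k * e))).
  apply: ler_sum => k _.
  have -> : q ^+ k * (W k.+1 x - W k x) + h * q ^+ k * e =
    h * q ^+ k * ((W k.+1 x - W k x) / h + e).
    by move: (W k.+1 x - W k x) (q ^+ k) => v p; field; rewrite gt_eqF.
  apply: ler_wpM2l; first by rewrite mulr_ge0 ?exprn_ge0 ?(ltW q0) ?(ltW h0).
  by have := LWd k x; rewrite ler_norml => /andP[_]; rewrite lerBlDl.
rewrite big_split /= sum_by_parts -mulr_suml sum_weights.
have qN : 0 < q ^+ N by rewrite exprn_gt0.
have h1 : 0 < 1 + h by rewrite addr_gt0.
have w1 : q ^+ N * W N x <= q ^+ N by rewrite ler_piMr ?(ltW qN) ?W1.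
have w0 := W0 0%N x.
rewrite -addrA lerD2l -mulrA -mulrDr ler_wpM2l ?(ltW h1)//.
have : q ^+ N * e >= 0 by rewrite mulr_ge0// ltW.
nra.
Qed.

(** The first K iterates are at least 1/2 at 0. Their weights add up to at least K h / 2: by
    Bernoulli q^K <= 1 / (1 + K h), and 1 / (1 + y) <= 1 - y / 2 for 0 <= y <= 1. *)
Lemma resolvent_sum_lower N K : (K <= N)%N -> g 0 = 1 ->
  K%:R * (h * (B + e)) <= 2^-1 -> K%:R * h <= 1 ->
  K%:R * h / 4 <= resolvent_sum N 0.
Proof.
move=> KN g01 KB Kh1.
have t0 k : 0 <= h * q ^+ k by rewrite mulr_ge0 ?exprn_ge0 ?(ltW q0) ?(ltW h0).
apply: (@le_trans _ _ (resolvent_sum K 0)); last first.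
  rewrite /resolvent_sum -(subnKC KN) big_split_ord /= lerDl.
  by apply: sumr_ge0 => i _; rewrite mulr_ge0.
have hBe : 0 <= h * (B + e) by rewrite mulr_ge0 ?(ltW h0)// addr_ge0.
apply: (@le_trans _ _ (\sum_(k < K) (h * q ^+ k) * 2^-1)); last first.
  apply: ler_sum => k _; rewrite ler_wpM2l//.
  apply: le_trans (W_lower0 k g01).
  have : k%:R * (h * (B + e)) <= K%:R * (h * (B + e)).
    by rewrite ler_wpM2r// ler_nat ltnW.
  lra.
rewrite -mulr_suml sum_weights.
have bern : 1 + K%:R * h <= (1 + h) ^+ K.
  elim: K {KN KB Kh1} => [|K IH]; first by rewrite mul0r addr0 expr0.
  rewrite exprS -natr1.
  have : (1 + h) * (1 + K%:R * h) <= (1 + h) * (1 + h) ^+ K.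
    by rewrite ler_wpM2l// addr_ge0// ltW.
  have : 0 <= K%:R * h * h by rewrite !mulr_ge0 ?(ltW h0).
  lra.
have Kh0 : 0 <= K%:R * h by rewrite mulr_ge0// ltW.
have qK : q ^+ K <= (1 + K%:R * h)^-1.
  have p1 : 0 < 1 + K%:R * h by lra.
  by rewrite /q exprVn lef_pV2// posrE exprn_gt0// addr_gt0.
have : (1 + K%:R * h)^-1 <= 1 - K%:R * h / 2.
  rewrite -[X in X <= _]mul1r ler_pdivrMr; last lra.
  nra.
have : 0 <= 1 - q ^+ K.
  by rewrite subr_ge0; apply: (le_trans qK); rewrite invf_le1; lra.
move=> Q0 Q1; have : 0 <= h * (1 - q ^+ K) by rewrite mulr_ge0// ltW.
have := le_trans qK Q1; lra.
Qed.

(** The mass bound is assumed for all translates of g because the iterates are combinations of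
    translates; the induction carries it for every shift y. The weights add up to at most 1 + h <=
    2. *)
Lemma resolvent_sum_mass N (m : R) : h <= 1 -> 0 <= m ->
  (forall y, \int[leb d]_x (g (x + y))%:E <= m%:E)%E ->
  (\int[leb d]_x (resolvent_sum N x)%:E <= (2 * m)%:E)%E.
Proof.
move=> h1 m0 gm.
have mF F y : continuous F -> measurable_fun setT (fun x : 'rV[R]_d => F (x + y)).
  move=> cF; apply: continuous_measurable_rVR => x.
  apply: continuous_comp; last exact: cF.
  by apply: continuousD; [exact: cvg_id|exact: cst_continuous].
have cW k : continuous (W k) by have [/Ck_continuous] := CW k 0.
have sum_int K (c : nat -> R) (F : nat -> 'rV[R]_d -> R) : (forall i, 0 <= c i) ->
   (forall i x, 0 <= F i x) -> (forall i, measurable_fun setT (F i)) ->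
   (forall i, \int[leb d]_x (F i x)%:E <= m%:E)%E ->
   (\int[leb d]_x (\sum_(i < K) c i * F i x)%:E <= ((\sum_(i < K) c i) * m)%:E)%E.
  move=> c0 F0 mF' Fm.
  under eq_integral => x _ do rewrite -sumEFin.
  rewrite ge0_integral_sum//; last 2 first.
  - by move=> i; apply/measurable_EFinP; exact: measurable_funM.
  - by move=> i x _; rewrite lee_fin mulr_ge0.
  rewrite mulr_suml -sumEFin; apply: lee_sum => i _.
  under eq_integral => x _ do rewrite EFinM.
  rewrite ge0_integralZl_EFin//; last 2 first.
  - by move=> x _; rewrite lee_fin.
  - exact/measurable_EFinP.
  by rewrite EFinM lee_wpmul2l ?lee_fin.
have Wm k y : (\int[leb d]_x (W k (x + y))%:E <= m%:E)%E.
  elim: k y => [|k IH] y; first exact: gm.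
  have := sum_int n a (fun i x => W k (x + (y + z i))) a0 (fun i x => W0 k _)
    (fun i => mF _ _ (cW k)) (fun i => IH _).
  under eq_integral => x _ do under eq_bigr => i _ do rewrite addrA.
  by move=> H; apply: (le_trans H); rewrite lee_fin ler_piMl.
have := sum_int N (fun k => h * q ^+ k) (fun k x => W k x) _ (fun i x => W0 i _).
move=> H; apply: (le_trans (H _ _ _)).
- by move=> i; rewrite mulr_ge0 ?exprn_ge0 ?(ltW q0) ?(ltW h0).
- by move=> i; apply: continuous_measurable_rVR.
- by move=> i; have := Wm i 0; under eq_integral => x _ do rewrite addr0.
rewrite lee_fin ler_wpM2r// sum_weights.
have : 0 <= (1 + h) * q ^+ N by rewrite mulr_ge0 ?exprn_ge0 ?(ltW q0)// addr_ge0// ltW.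
lra.
Qed.

End potential.

(** * Potentials that are large at the origin and of small mass *)

Section polar.
Context {R : realType} {d : nat} {dO : measure_display} {Omega : measurableType dO}.
Variables (P : probability Omega R) (Y : R -> Omega -> 'rV[R]_d).
Variables (b : 'rV[R]_d) (nu : {measure set 'rV[R]_d -> \bar R}).
Hypothesis hnu : levy_measure nu.
Hypothesis mY : forall t, 0 <= t -> measurable_fun setT (Y t).
Hypothesis hgen : generated_by P Y (levy_op b nu).
Implicit Types (x y z : 'rV[R]_d) (f g : 'rV[R]_d -> R).

Local Notation L := (levy_op b nu).

Lemma exists_potential g (B m e : R) : (forall k, Cck k setT g) ->
  (forall x, 0 <= g x) -> (forall x, g x <= 1) -> g 0 = 1 -> 0 <= B ->
  (forall x, `|L g x| <= B) -> 0 <= m ->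
  (forall y, \int[leb d]_x (g (x + y))%:E <= m%:E)%E -> 0 < e ->
  exists G : 'rV[R]_d -> R, [/\ forall k, Cck k setT G, forall x, 0 <= G x,
    (16 * (B + 1))^-1 <= G 0, forall x, L G x <= G x + e &
    (\int[leb d]_x (G x)%:E <= (2 * m)%:E)%E].
Proof.
move=> Cg g0 g1 g01 B0 Lg m0 gm e0.
(* The total error is (1 + h) (q^N + e1) <= 2 (e1 + e1) <= e, and e1 <= 1 keeps the loss B + e1
   below B + 1. *)
pose e1 := Num.min 1 (e / 4).
have e10 : 0 < e1 by rewrite lt_min ltr01 divr_gt0.
have e11 : e1 <= 1 by rewrite ge_min lexx.
have e1e : e1 <= e / 4 by rewrite ge_min lexx orbT.
have B1 : 0 < B + 1 by lra.
(* The time during which the iterates stay above 1/2 at 0. With h <= tau / 2 and K the integer part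
   of tau / h, K h >= tau / 2, so the value at 0 is at least tau / 8 = 1 / (16 (B + 1)). *)
pose tau := (2 * (B + 1))^-1.
have tau0 : 0 < tau by rewrite invr_gt0; lra.
have tauB : tau * (B + 1) = 2^-1 by rewrite /tau; field; lra.
have tau1 : tau <= 1 by rewrite /tau invf_le1; lra.
have e12 : 0 < e1 / 2 by rewrite divr_gt0.
have [h1 h10 Hh] := hgen (Cg 2) e12.
pose h := Num.min (h1 / 2) (tau / 2).
have h0 : 0 < h by rewrite lt_min !divr_gt0.
have hh1 : h < h1 by rewrite (@le_lt_trans _ _ (h1 / 2)) ?ge_min ?lexx//; lra.
have htau : h <= tau / 2 by rewrite ge_min lexx orbT.
have [M M0 gM] := Cck_bounded_supp (Cg 1); have [C1 _ _] := Cg 1.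
have [B' B'0 HB'] := lipschitz_C1 C1 gM.
have gn1 y : `|g y| <= 1 by rewrite ger0_norm.
(* The discretization error is divided by h in the difference quotient, hence the factor h here. *)
have e1h : 0 < e1 / 2 * h by rewrite mulr_gt0.
have [n [a [z [a0 a1 Ha]]]] := discretize_law P (mY (ltW h0)) ltr01 B'0
  (Ck_continuous C1) gn1 HB' e1h.
have Sg x : `|L g x - (\sum_(i < n) a i * g (x + z i) - g x) / h| <= e1.
  have := Hh h x; rewrite h0 hh1 => /(_ isT) H1; have H2 := Ha x.
  move: H1 H2; move: (L g x) (\int[P]_w _) (\sum_(i < n) _) (g x) => l E S' gx H1 H2.
  have H3 : `|(E - S') / h| <= e1 / 2.
    by rewrite normrM normfV (gtr0_norm h0) ler_pdivrMr.
  have -> : l - (S' - gx) / h = - ((E - gx) / h - l) + (E - S') / h.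
    by field; rewrite gt_eqF.
  by apply: (le_trans (ler_normD _ _)); rewrite normrN [leRHS]splitr lerD.
pose K := Num.truncn (tau / h).
have tauh : 0 <= tau / h by rewrite divr_ge0// ltW.
have Kh : K%:R * h <= tau by rewrite -ler_pdivlMr// truncn_le.
have Kh' : tau < K.+1%:R * h by rewrite -ltr_pdivrMr// truncnS_gt.
pose q := (1 + h)^-1.
have q0 : 0 < q by rewrite invr_gt0; lra.
have q1 : q < 1 by rewrite /q invf_lt1; lra.
have [N0 HN0] : exists N0, q ^+ N0 <= e1.
  have qn : `|q| < 1 by rewrite gtr0_norm.
  have /cvgrPdist_le/(_ _ e10)[N _ HN] := cvg_expr qn.
  exists N; have := HN N (leqnn N); rewrite sub0r normrN.
  exact: le_trans (ler_norm _).
(* At least K terms for the lower bound at 0, and at least N0 for the truncation error. *)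
pose N := (K + N0)%N.
have qN : q ^+ N <= e1.
  by rewrite /N exprD (le_trans _ HN0)// ler_piMl ?exprn_ge0 ?(ltW q0)// exprn_ile1// ltW.
exists (resolvent_sum n a z g h N); split.
- move=> k; exact: (Cck_resolvent_sum b hnu).
- exact: (resolvent_sum_ge0 n z a0 h0 g0).
- have KN : (K <= N)%N by rewrite leq_addr.
  have hB : K%:R * (h * (B + e1)) <= 2^-1.
    rewrite mulrA -tauB; apply: (@le_trans _ _ (K%:R * h * (B + 1))).
      by rewrite ler_wpM2l ?lerD2l// mulr_ge0// ltW.
    by rewrite ler_wpM2r// ltW.
  have := resolvent_sum_lower hnu a0 a1 h0 (ltW e10) B0 Cg g0 Lg Sg KN g01 hB (le_trans Kh tau1).
  apply: le_trans.
  have -> : (16 * (B + 1))^-1 = tau / 8 by rewrite /tau; field; lra.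
  by move: Kh'; rewrite -natr1 mulrDl mul1r; lra.
- move=> x; have := levy_op_resolvent_sum hnu a0 a1 h0 (ltW e10) Cg g0 g1 Sg N x.
  move/le_trans; apply; rewrite lerD2l.
  have : (1 + h) * (q ^+ N + e1) <= 2 * (e1 + e1).
    apply: ler_pM; [lra| |lra|lra].
    by rewrite addr_ge0 ?exprn_ge0 ?(ltW q0) ?(ltW e10).
  by rewrite -/q; lra.
- have h1' : h <= 1 by lra.
  exact: (@resolvent_sum_mass _ _ b _ hnu _ _ _ a0 a1 _ _ h0 Cg g0).
Qed.

(** For g = cutoff(r .), stability gives |L g| <= B0 Q with Q = r^(2s). Multiplying the potential of
    g by a factor c of order M Q lifts its value at 0 to M, and the mass becomes of order Q / r^d,
    small for large r because 2s < d. *)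
Lemma exists_polar (s M e : R) : 0 < s -> 2 * s < d%:R ->
  strictly_stable s b nu -> 0 < M -> 0 < e ->
  exists G : 'rV[R]_d -> R, [/\ forall k, Cck k setT G, forall x, 0 <= G x,
    M <= G 0, forall x, L G x <= G x + e &
    (\int[leb d]_x (G x)%:E <= e%:E)%E].
Proof.
move=> s0 sd hst M0 e0.
have Cc k : Cck k setT (@cutoff R d).
  apply: (@CckT_bounded _ _ _ _ 2); first exact: Ck_cutoff.
  by move=> x /ltW; exact: cutoff_eq0.
have [B0 B00 HB0] := levy_op_bounded mY hgen (Cc 2).
(* Chosen so that c * (2 * m) = C * Q / r^d for the factor c and the mass bound m below; r is then
   taken so large that this is at most e. *)
pose C := 32 * (B0 + 1) * M * 4 ^+ d.
have C0 : 0 < C by rewrite !mulr_gt0 ?exprn_gt0//; lra.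
have sd0 : 0 < d%:R - 2 * s by lra.
(* r >= 1 gives Q >= 1, so that B0 Q + 1 <= (B0 + 1) Q. *)
pose r := Num.max 1 ((C / e) `^ (d%:R - 2 * s)^-1).
have r1 : 1 <= r by rewrite le_max lexx.
have r0 : 0 < r by lra.
have rC : C / e <= r `^ (d%:R - 2 * s).
  have Ce : 0 < C / e by rewrite divr_gt0.
  have E : C / e = ((C / e) `^ (d%:R - 2 * s)^-1) `^ (d%:R - 2 * s).
    by rewrite -powRrM mulVf ?gt_eqF// powRr1// ltW.
  rewrite [leLHS]E ge0_ler_powR ?nnegrE ?powR_ge0 ?(ltW sd0) ?(ltW r0)//.
  by rewrite /r le_max lexx orbT.
pose g x : R := cutoff (r *: x).
have Cg k : Cck k setT g.
  rewrite (_ : g = fun x => cutoff (r *: x + 0)).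
    by apply: Cck_affine => //; rewrite gt_eqF.
  by apply/funext => x; rewrite addr0.
pose Q := r `^ (2 * s).
have Q1 : 1 <= Q by rewrite -(powRr0 r) ler_powR//; lra.
have Lg x : `|L g x| <= B0 * Q.
  rewrite hst// normrM mulrC [`|_ `^ _|]ger0_norm ?powR_ge0//.
  by apply: ler_wpM2r; [exact: powR_ge0|exact: HB0].
pose rho := r^-1.
have rho0 : 0 < rho by rewrite invr_gt0.
pose m := (2 * (2 * rho)) ^+ d.
have m0 : 0 < m by rewrite exprn_gt0//; lra.
have gm y : (\int[leb d]_x (g (x + y))%:E <= m%:E)%E.
  have mE : measurable [set x : 'rV[R]_d | `|x + y| <= 2 * rho].
    rewrite (_ : mkset _ = ~` [set x | 2 * rho < `|x + y|]); last first.
      by apply/seteqP; split => x /=; rewrite leNgt => /negP.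
    apply: measurableC; apply: open_measurable_rV.
    rewrite (_ : mkset _ = (fun x => `|x + y|) @^-1` [set t | 2 * rho < t])//.
    apply: open_comp => [x _|]; last exact: open_gt.
    apply: (continuous_comp (f := fun x => x + y)); last exact: norm_continuous.
    by apply: continuousD; [exact: cvg_id|exact: cst_continuous].
  have r2 : 0 <= 2 * rho by lra.
  rewrite /m -(leb_cube y r2) -[leRHS]mul1e -integral_cst// integral_mkcond.
  apply: ge0_le_integral => //.
  - by move=> x _; rewrite lee_fin cutoff_ge0.
  - apply/measurable_EFinP; apply: continuous_measurable_rVR => x.
    apply: (continuous_comp (f := fun x => x + y)).
      by apply: continuousD; [exact: cvg_id|exact: cst_continuous].
    by have [/Ck_continuous cg _ _] := Cg 0; exact: cg.
  - by apply/(measurable_restrictT _ _).1 => //; exact: measurable_cst.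
  - move=> x _; rewrite patchE; case: ifPn; first by rewrite lee_fin cutoff_le1.
    rewrite notin_setE /= => /negP; rewrite -ltNge => h.
    rewrite /g cutoff_eq0// normrZ gtr0_norm// mulrC -ler_pdivrMr//; exact: ltW.
pose c := 16 * (B0 + 1) * M * Q.
have c0 : 0 < c by rewrite !mulr_gt0//; lra.
have g01 : g 0 = 1 by rewrite /g cutoff_eq1// scaler0 normr0.
have BQ0 : 0 <= B0 * Q by rewrite mulr_ge0 ?ltW//; lra.
(* The error is divided by c beforehand because the potential is multiplied by c. *)
have ec : 0 < e / c by rewrite divr_gt0.
have [G [CG G0 G01 LG Gm]] := exists_potential Cg (fun x => cutoff_ge0 _)
  (fun x => cutoff_le1 _) g01 BQ0 Lg (ltW m0) gm ec.
exists (fun x => c * G x); split.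
- by move=> k; exact: CckZ.
- by move=> x; rewrite mulr_ge0// ltW.
- apply: (@le_trans _ _ (c * (16 * (B0 * Q + 1))^-1)); last by rewrite ler_wpM2l// ltW.
  rewrite ler_pdivlMr; last lra.
  rewrite /c.
  have : 0 <= M * (Q - 1) by rewrite mulr_ge0 ?(ltW M0)//; lra.
  lra.
- move=> x; rewrite levy_opZ//.
  apply: (@le_trans _ _ (c * (G x + e / c))); first by rewrite ler_wpM2l// ltW.
  by rewrite mulrDr mulrCA divff ?mulr1// gt_eqF.
- under eq_integral => x _ do rewrite EFinM.
  rewrite ge0_integralZl_EFin//; last 3 first.
  - by move=> x _; rewrite lee_fin.
  - apply/measurable_EFinP; apply: continuous_measurable_rVR.
    by have [/Ck_continuous] := CG 0.
  - exact: ltW.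
  apply: (@le_trans _ _ (c%:E * (2 * m)%:E)%E); first by rewrite lee_wpmul2l// lee_fin ltW.
  rewrite -EFinM lee_fin.
  have -> : c * (2 * m) = C * (Q / r ^+ d).
    by rewrite /c /C /m /rho mulrA exprMn exprVn -natrM; ring.
  move: rC; rewrite ler_pdivrMr// -ler_pdivrMl ?powR_gt0//.
  rewrite powRB; last by rewrite (gt_eqF r0) implybT.
  by rewrite invf_div powR_mulrn ?(ltW r0)// mulrC.
Qed.

End polar.

(** * Integrals against a density and a Dirac mass *)

Section density_integral.
Context {R : realType} {d : nat}.
Variable f : 'rV[R]_d -> R.
Hypotheses (f0 : forall x, 0 <= f x) (mf : measurable_fun setT f).
Local Open Scope ereal_scope.

Let mfE : measurable_fun setT (fun x => (f x)%:E).
Proof. exact/measurable_EFinP. Qed.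

Let density0 : density f set0 = 0.
Proof. by rewrite /density integral_set0. Qed.

Let density_ge0 A : 0 <= density f A.
Proof. by apply: integral_ge0 => x _; rewrite lee_fin. Qed.

Let density_additive : semi_sigma_additive (density f).
Proof. by apply: semi_sigma_additive_nng_induced => // x; rewrite lee_fin. Qed.

(** A separate name for [density f], carrying the measure structure that the section hypotheses
    provide. *)
Definition density_measure : set 'rV[R]_d -> \bar R := density f.

HB.instance Definition _ := isMeasure.Build _ _ _ density_measure
  density0 density_ge0 density_additive.

Import HBNNSimple.

(** Both sides are monotone limits along simple functions increasing to g, and for indicators the
    identity is the definition of [density]. *)
Lemma ge0_integral_density (E : set 'rV[R]_d) (g : 'rV[R]_d -> \bar R) :
  measurable E -> measurable_fun E g -> (forall x, 0 <= g x) ->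
  \int[density f]_(x in E) g x = \int[leb d]_(x in E) (g x * (f x)%:E).
Proof.
move=> mE mg g0; pose h := nnsfun_approx mE mg.
rewrite -[density f]/density_measure.
have -> : \int[density_measure]_(x in E) g x =
    lim (\int[density_measure]_(x in E) (EFin \o h n) x @[n --> \oo]).
  have gE x : E x -> g x = lim ((EFin \o h n) x @[n --> \oo]).
    by move=> Ex; apply/esym/cvg_lim => //; exact: cvg_nnsfun_approx.
  under eq_integral => x /[!inE] /gE -> //.
  apply: monotone_convergence => //.
  - move=> n; apply/measurable_EFinP.
    by apply: (measurable_funS measurableT) => //; exact/measurable_funP.
  - by move=> n x Ex //=; rewrite lee_fin.
  - by move=> x Ex a b ab; rewrite lee_fin; exact/lefP/nd_nnsfun_approx.
have -> : \int[leb d]_(x in E) (g x * (f x)%:E) =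
    lim (\int[leb d]_(x in E) ((EFin \o h n) \* (EFin \o f)) x @[n --> \oo]).
  have fg x : E x -> g x * (f x)%:E = lim (((EFin \o h n) \* (EFin \o f)) x @[n --> \oo]).
    by move=> Ex; apply/esym/cvg_lim => //; apply: cvgeZr => //;
      exact: cvg_nnsfun_approx.
  under eq_integral => x /[!inE] /fg -> //.
  apply: monotone_convergence => [//| | |].
  - move=> n; apply/emeasurable_funM; apply/measurable_funTS => //.
    exact/measurable_EFinP.
  - by move=> n x Ex /=; rewrite mule_ge0 ?lee_fin ?f0.
  - by move=> x Ex a b ab/=; rewrite lee_wpmul2r ?lee_fin ?f0//; exact/lefP/nd_nnsfun_approx.
suff suf n : \int[leb d]_(x in E) ((EFin \o h n) x * (f x)%:E) =
    \int[density_measure]_(x in E) (EFin \o h n) x.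
  by congr (limn _); apply/funext => n; rewrite -suf.
transitivity (\int[density_measure]_(x in E)
   (\sum_(y \in range (h n)) (y * \1_(h n @^-1` [set y]) x)%:E)); last first.
  by apply: eq_integral => t tE; rewrite /= fimfunE -fsumEFin.
have indich m r : measurable_fun E (fun x => (r * \1_(h m @^-1` [set r]) x)%:E).
  by apply: (measurable_comp measurableT) => //; exact: measurable_funM.
rewrite ge0_integral_fsum//; last by move=> m y Ey; exact: nnfun_muleindic_ge0.
transitivity (\int[leb d]_(x in E) (\sum_(y \in range (h n))
    (y * \1_(h n @^-1` [set y]) x)%:E * (f x)%:E)).
  under [RHS]eq_integral => x xE.
    rewrite -ge0_mule_fsuml => [|y]; last exact: nnfun_muleindic_ge0.
    rewrite fsumEFin // -(fimfunE _ x); over.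
  by [].
rewrite ge0_integral_fsum//; last 2 first.
  - by move=> y; apply: emeasurable_funM => //; apply: measurable_funTS.
  - move=> m y Ey; apply: mule_ge0; last by rewrite lee_fin.
    exact: nnfun_muleindic_ge0.
apply: eq_fsbigr => r rhn.
under [RHS]eq_integral do rewrite EFinM.
rewrite integralZl_indic_nnsfun => //.
under eq_integral do rewrite EFinM -muleA.
rewrite ge0_integralZl//.
- under eq_integral do rewrite muleC.
  rewrite (eq_integral ((EFin \o f) \_ (h n @^-1` [set r]))); last first.
    by move=> x xE; rewrite epatch_indic.
  by rewrite -integral_mkcondr integral_indic// setIC.
- apply: emeasurable_funM; first exact/measurable_EFinP.
  exact/measurable_funTS.
- by move=> x _; rewrite mule_ge0 ?lee_fin.
- by move: rhn; rewrite inE => -[t _ <-]; rewrite lee_fin.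
Qed.

(** Since f >= 0, taking positive and negative parts commutes with multiplication by f. *)
Lemma integral_density (E : set 'rV[R]_d) (g : 'rV[R]_d -> R) :
  measurable E -> measurable_fun E g ->
  \int[density f]_(x in E) (g x)%:E = \int[leb d]_(x in E) (g x * f x)%:E.
Proof.
move=> mE mg; have mgE : measurable_fun E (EFin \o g) by exact/measurable_EFinP.
have fE (x : 'rV[R]_d) (c : \bar R) : maxe (c * (f x)%:E) 0 = maxe c 0 * (f x)%:E.
  by rewrite [c * _]muleC [RHS]muleC maxe_pMr ?lee_fin// mule0.
have -> : \int[density f]_(x in E) (g x)%:E =
    \int[density f]_(x in E) (EFin \o g)^\+ x - \int[density f]_(x in E) (EFin \o g)^\- x.
  by rewrite -[density f]/density_measure integralE.
rewrite !ge0_integral_density//; last 2 first.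
- exact: measurable_funeneg.
- exact: measurable_funepos.
rewrite [RHS]integralE.
have -> : \int[leb d]_(x in E) ((EFin \o g)^\+ x * (f x)%:E) =
    \int[leb d]_(x in E) (fun x => (g x * f x)%:E)^\+ x.
  by apply: eq_integral => x _; rewrite !funeposE EFinM fE.
have -> // : \int[leb d]_(x in E) ((EFin \o g)^\- x * (f x)%:E) =
    \int[leb d]_(x in E) (fun x => (g x * f x)%:E)^\- x.
by apply: eq_integral => x _; rewrite !funenegE EFinM -[in RHS]mulNe fE.
Qed.

Lemma integral_density_dirac (k : R) (a : 'rV[R]_d) (E : set 'rV[R]_d) (g : 'rV[R]_d -> R) :
  (0 <= k)%R -> measurable E -> E a -> measurable_fun E g ->
  (leb d).-integrable E (fun x => (g x * f x)%:E) ->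
  \int[(fun A => density f A + k%:E * \d_a A)]_(x in E) (g x)%:E =
  \int[leb d]_(x in E) (g x * f x)%:E + (k * g a)%:E.
Proof.
move=> k0 mE Ea mg /integrableP[_ igf]; have mgE : measurable_fun E (EFin \o g) by exact/measurable_EFinP.
pose m2 := mscale (NngNum k0) (dirac a : {measure set 'rV[R]_d -> \bar R}).
have dE (h : 'rV[R]_d -> \bar R) : measurable_fun E h ->
    \int[(dirac a : {measure set 'rV[R]_d -> \bar R})]_(x in E) h x = h a.
  by move=> mh; rewrite integral_dirac// diracE mem_set// mul1e.
have m2E (h : 'rV[R]_d -> \bar R) : measurable_fun E h -> (forall x, 0 <= h x) ->
    \int[m2]_(x in E) h x = k%:E * h a.
  by move=> mh h0; rewrite ge0_integral_mscale// dE.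
have -> : (fun A => density f A + k%:E * \d_a A) = measure_add density_measure m2.
  by apply/funext => A; rewrite measure_addE.
have mabs : measurable_fun E (fun x => `|(EFin \o g) x|) by exact: measurableT_comp.
rewrite integral_measure_add//.
- congr (_ + _); first exact: integral_density.
  rewrite integralE !m2E//; last 2 first.
  + exact: measurable_funeneg.
  + exact: measurable_funepos.
  have -> : (fun x => (g x)%:E)^\+ a = (Num.max (g a) 0)%:E by rewrite funeposE EFin_max.
  have -> : (fun x => (g x)%:E)^\- a = (Num.max (- g a) 0)%:E by rewrite funenegE EFin_max.
  rewrite -!EFinM -EFinB -mulrBr; congr (_ * _)%:E.
  have [h|/ltW h] := leP 0%R (g a).
    by rewrite (max_idPr _) ?subr0// oppr_le0.
  by rewrite (max_idPl _) ?sub0r ?opprK// oppr_ge0.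
- apply/integrableP; split => //; rewrite -/density_measure.
  rewrite [X in X < _](_ : _ = \int[density f]_(x in E) `|(EFin \o g) x|)//.
  rewrite ge0_integral_density//; move: igf; congr (_ < _); apply: eq_integral => x _.
  by rewrite /= normrM (ger0_norm (f0 x)).
- by apply/integrableP; split => //; rewrite m2E// /= -EFinM ltry.
Qed.

End density_integral.

(** * Tails of the Levy measure *)

Lemma annulus_arith (R : realFieldType) (r : R) : 0 < r ->
  [/\ 2 * r + r <= 8 * r, 2 * r + 2 * r <= 4 * r & 4 * r + 2 * r <= 6 * r].
Proof. by move=> r0; split; lra. Qed.

Section far_mass.
Context {R : realType} {d : nat}.
Variables (b : 'rV[R]_d) (mu : {measure set 'rV[R]_d -> \bar R}).
Hypothesis hmu : levy_measure mu.
Implicit Types (x y z : 'rV[R]_d) (f g : 'rV[R]_d -> R) (K : set 'rV[R]_d).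

Local Notation L := (levy_op b mu).

(** The mass of the jumps from x of size at least c that land in K. Taken for [nu] and for its
    reflection, it gives the two summands of [tail_weight], with the radius c freed from K and V. *)
Definition far_mass (c : R) K x : \bar R :=
  mu [set y | (c <= enorm y)%R /\ K (x + y)%R].

Lemma measurable_translate K x : measurable K -> measurable [set y | K (x + y)].
Proof.
move=> mK; have m : measurable_fun setT (fun y : 'rV[R]_d => x + y).
  by apply: continuous_measurable_rV; exact: continuous_addl.
by have := m measurableT K mK; rewrite setTI.
Qed.

Lemma measurable_far_set c K x : measurable K ->
  measurable [set y | c <= enorm y /\ K (x + y)].
Proof.
move=> mK; apply: measurableI; first exact: measurable_enorm_ge.
exact: measurable_translate.
Qed.

Lemma far_mass_le c c' K K' x : measurable K -> measurable K' ->
  c' <= c -> K `<=` K' -> (far_mass c K x <= far_mass c' K' x)%E.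
Proof.
move=> mK mK' cc KK; apply: le_measure; rewrite ?inE; try exact: measurable_far_set.
by move=> y [cy Ky]; split; [exact: le_trans cy|exact: KK].
Qed.

Lemma far_mass_lty c K x : 0 < c -> measurable K ->
  (far_mass c K x <= mu [set y | (c <= enorm y)%R])%E.
Proof.
move=> c0 mK; apply: le_measure; rewrite ?inE.
- exact: measurable_far_set.
- exact: measurable_enorm_ge.
- by move=> y [].
Qed.

Lemma far_massU c K K' x : measurable K -> measurable K' ->
  (far_mass c (K `|` K') x <= far_mass c K x + far_mass c K' x)%E.
Proof.
move=> mK mK'.
have m1 := measurable_far_set c x mK; have m2 := measurable_far_set c x mK'.
rewrite /far_mass (_ : [set y | _ /\ (K `|` K') _] =
  [set y | c <= enorm y /\ K (x + y)] `|` [set y | c <= enorm y /\ K' (x + y)]).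
  exact: measureU2.
by apply/seteqP; split => y /=; [case=> h [k|k]; [left|right]|
  case=> -[h k]; split => //; [left|right]].
Qed.

(** The far mass is the measure of the x-section of the measurable set of pairs with sum in K; c > 0
    makes the measure restricted to far jumps finite. *)
Lemma measurable_fun_far_mass c K : 0 < c -> measurable K ->
  measurable_fun setT (far_mass c K).
Proof.
move=> c0 mK; pose E := [set y : 'rV[R]_d | c <= enorm y].
have mE : measurable E by exact: measurable_enorm_ge.
have Efin : (mu E < +oo)%E by exact: nu_far_lty.
pose A : set ('rV[R]_d * 'rV[R]_d) := [set p | K (p.1 + p.2)].
have mA : measurable A.
  have madd : measurable_fun setT (fun p : 'rV[R]_d * 'rV[R]_d => p.1 + p.2).
    apply: measurable_fun_rV => i.
    rewrite (_ : (fun _ => _) = (fun p : 'rV[R]_d * 'rV[R]_d => p.1 ord0 i + p.2 ord0 i)).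
      apply: measurable_funD.
        exact: (measurableT_comp (measurable_coord i) measurable_fst).
      exact: (measurableT_comp (measurable_coord i) measurable_snd).
    by apply/funext => p; rewrite mxE.
  by have := madd measurableT K mK; rewrite setTI.
have := @measurable_fun_xsection _ _ _ _ R (mfrestr mE Efin) A mA.
rewrite (_ : _ \o _ = far_mass c K)//; apply/funext => x.
rewrite /= /mfrestr /mrestr /far_mass; congr (mu _).
by apply/seteqP; split => y; [case; rewrite /xsection /= inE|
  case=> h k; split => //; rewrite /xsection /= inE].
Qed.

Lemma integrable_translate f x : Cck 2 setT f -> (\near x, f x = 0) ->
  mu.-integrable setT (EFin \o (fun y => f (x + y))).
Proof.
move=> Cf H; have := integrable_levy_int hmu x Cf.
apply: eq_integrable => // y _ /=.
by rewrite /levy_int (grad_near_cst H) dot0r mul0r (nbhs_singleton H) !subr0.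
Qed.

Lemma measure_le_integral (A : set 'rV[R]_d) f : measurable A ->
  measurable_fun setT f -> (forall y, 0 <= f y) -> (forall y, A y -> 1 <= f y) ->
  (mu A <= \int[mu]_y (f y)%:E)%E.
Proof.
move=> mA mf f0 f1; have <- : (\int[mu]_y (\1_A y)%:E = mu A)%E.
  by rewrite integral_indic// setIT.
apply: ge0_le_integral => //.
- by apply/measurable_EFinP; exact: measurable_indic.
- exact/measurable_EFinP.
- move=> y _; rewrite lee_fin indicE; case: (boolP (y \in A)); last by rewrite f0.
  by rewrite inE => /f1.
Qed.

Lemma integral_le_measure (A : set 'rV[R]_d) f : measurable A ->
  measurable_fun setT f -> (forall y, 0 <= f y) -> (forall y, f y <= 1) ->
  (forall y, ~ A y -> f y = 0) -> (\int[mu]_y (f y)%:E <= mu A)%E.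
Proof.
move=> mA mf f0 f1 fA; have <- : (\int[mu]_y (\1_A y)%:E = mu A)%E.
  by rewrite integral_indic// setIT.
apply: ge0_le_integral => //.
- by move=> y _; rewrite lee_fin.
- exact/measurable_EFinP.
- by apply/measurable_EFinP; exact: measurable_indic.
- move=> y _; rewrite lee_fin indicE; case: (boolP (y \in A)); first by rewrite f1.
  by rewrite notin_setE => /fA ->.
Qed.

Lemma levy_op_near_origin f : (\forall y \near (0 : 'rV[R]_d), f y = 0) ->
  L f 0 = \int[mu]_y f y.
Proof.
have E : (fun y : 'rV[R]_d => f (0 + y)) = f by apply/funext => y; rewrite add0r.
by move=> /(levy_op_near0 b mu); rewrite E.
Qed.

Lemma integrable_near_origin f : Cck 2 setT f -> (\forall y \near (0 : 'rV[R]_d), f y = 0) ->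
  mu.-integrable setT (EFin \o f).
Proof.
have E : (fun y : 'rV[R]_d => f (0 + y)) = f by apply/funext => y; rewrite add0r.
by move=> Cf /(integrable_translate Cf); rewrite E.
Qed.

Variable s : R.
Hypothesis s0 : 0 < s.
Hypothesis hst : strictly_stable s b mu.

Lemma measurable_norm_le (r : R) : measurable [set z : 'rV[R]_d | `|z| <= r].
Proof.
rewrite (_ : mkset _ = ~` [set z | r < `|z|]); last first.
  by apply/seteqP; split => x /=; rewrite leNgt => /negP.
apply: measurableC; apply: open_measurable_rV.
rewrite (_ : mkset _ = (fun x : 'rV[R]_d => `|x|) @^-1` [set t | r < t])//.
by apply: open_comp => [x _|]; [exact: norm_continuous|exact: open_gt].
Qed.

Lemma measurable_norm_lt (r : R) : measurable [set z : 'rV[R]_d | `|z| < r].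
Proof. by apply: open_measurable_rV; exact: open_norm_lt. Qed.

Lemma measurable_annulus (r r' : R) : measurable [set z : 'rV[R]_d | r <= `|z| <= r'].
Proof.
rewrite (_ : mkset _ = [set z | `|z| <= r'] `\` [set z | `|z| < r]).
  by apply: measurableD; [exact: measurable_norm_le|exact: measurable_norm_lt].
apply/seteqP; split => z /=; first by case/andP => h1 h2; split => //; apply/negP; rewrite -leNgt.
by case=> h1 /negP; rewrite -leNgt => h2; rewrite h2 h1.
Qed.

Lemma norm_ge_add (r r' : R) x y : r + r' <= `|x| -> `|y| <= r' -> r <= `|x + y|.
Proof. by move=> h1 h2; have := lerB_normD x y; lra. Qed.

(* For v supported away from 0, stability gives L v 0 <= L (v (a .)) 0 when
   a >= 1, and there L is integration against mu.  With v = 1 on the ball around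
   -x, a is chosen so that v (a .) is supported in the annulus. *)
Lemma ball_le_annulus (r : R) x : 0 < r -> 8 * r <= `|x| ->
  (mu [set y | (`|x + y| <= r)%R] <= mu [set y | (2 * r <= `|x + y| <= 6 * r)%R])%E.
Proof.
move=> r0 xr; have x0 : 0 < `|x| by lra.
(* With a = 1 / (1 - t), x + y = t x + (1 - t)(x + a y). On the support of v(a .) the last term has
   norm at most 2 r while |t x| = 4 r, so x + y lies between the radii 2 r and 6 r. The hypothesis 8
   r <= |x| gives t <= 1/2. *)
pose t := 4 * r / `|x|.
have t0 : 0 < t by rewrite divr_gt0//; lra.
have t2 : t <= 2^-1 by rewrite ler_pdivrMr//; lra.
pose a := (1 - t)^-1.
have at0 : 0 < 1 - t by lra.
have a0 : 0 < a by rewrite invr_gt0.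
have a1 : 1 <= a by rewrite invf_ge1; lra.
have aE : (1 - t) * a = 1 by rewrite divff// gt_eqF.
have tE : t * `|x| = 4 * r by rewrite divfK// gt_eqF.
clearbody a t.
have [v vE] : exists v : 'rV[R]_d -> R, v = fun y => bump r (1 *: y + x) by exists (fun y => bump r (1 *: y + x)).
have v_ y : v y = bump r (x + y) by rewrite vE scale1r addrC.
have Cv : Cck 2 setT v.
  by rewrite vE; apply: Cck_affine; [exact: oner_neq0|exact: Cck_bump].
clear vE.
have [le8 le24 le46] := annulus_arith r0.
have [w wE] : exists w : 'rV[R]_d -> R, w = fun y => v (a *: y) by exists (fun y => v (a *: y)).
have Cw : Cck 2 setT w.
  rewrite wE (_ : (fun y => _) = (fun y => v (a *: y + 0))); last first.
    by apply/funext => y; rewrite addr0.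
  by apply: Cck_affine Cv; rewrite gt_eqF.
have Lw : L w 0 = a `^ (2 * s) * L v 0.
  by have := hst a0 Cv 0; rewrite scaler0 -wE.
have w_ y : w y = v (a *: y) by rewrite wE.
clear wE.
have v0 : \forall y \near (0 : 'rV[R]_d), v y = 0.
  have : \forall y \near (0 : 'rV[R]_d), `|y| < r.
    by apply: (open_nbhs_nbhs (A := [set y : 'rV[R]_d | `|y| < r])); split;
      [exact: open_norm_lt|rewrite /= normr0].
  apply: filterS => y yr; rewrite v_ bump_eq0//.
  by apply: norm_ge_add (ltW yr); apply: le_trans xr; apply: le8.
have w0 : \forall y \near (0 : 'rV[R]_d), w y = 0.
  have : \forall y \near (0 : 'rV[R]_d), `|y| < r / a.
    apply: (open_nbhs_nbhs (A := [set y : 'rV[R]_d | `|y| < r / a])); split.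
      exact: open_norm_lt.
    by rewrite /= normr0 divr_gt0.
  apply: filterS => y yr; rewrite w_ v_ bump_eq0//.
  apply: (@norm_ge_add _ r); first by apply: le_trans xr; apply: le8.
  by rewrite normrZ (gtr0_norm a0) mulrC -ler_pdivlMr// ltW.
have iv := integrable_near_origin Cv v0; have iw := integrable_near_origin Cw w0.
have Iv := levy_op_near_origin v0; have Iw := levy_op_near_origin w0.
have Lv0 : 0 <= L v 0 by apply: levy_op_near0_ge0 v0 _ => y; rewrite v_; exact: bump_ge0.
have as1 : 1 <= a `^ (2 * s).
  by have := ler_powR a1 (mulr_ge0 (ler0n R 2) (ltW s0)); rewrite powRr0; exact.
have vw : \int[mu]_y v y <= \int[mu]_y w y.
  move: Lw Lv0; rewrite Iv Iw => ->; move: (\int[mu]_y v y) => l l0.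
  by rewrite ler_peMl.
have toE f : mu.-integrable setT (EFin \o f) ->
    (\int[mu]_y (f y)%:E = (\int[mu]_y f y)%:E)%E.
  by move=> if_; rewrite /Rintegral fineK//; exact: integrable_fin_num.
have mf f : Cck 2 setT f -> measurable_fun setT f.
  by move=> [/Ck_continuous cf _ _]; exact: continuous_measurable_rVR.
have mB : measurable [set y | `|x + y| <= r].
  exact: (measurable_translate x (measurable_norm_le r)).
have mA : measurable [set y | 2 * r <= `|x + y| <= 6 * r].
  exact: (measurable_translate x (measurable_annulus (2 * r) (6 * r))).
apply: (@le_trans _ _ (\int[mu]_y (v y)%:E)%E).
  apply: (measure_le_integral mB (mf _ Cv)) => y; rewrite v_; first exact: bump_ge0.
  by move=> yr; rewrite bump_eq1.
apply: (@le_trans _ _ (\int[mu]_y (w y)%:E)%E); first by rewrite (toE _ iv) (toE _ iw) lee_fin.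
apply: (integral_le_measure mA (mf _ Cw)) => y; rewrite w_ v_.
- exact: bump_ge0.
- exact: bump_le1.
- move=> /= h; have [zr|zr] := leP (2 * r) `|x + a *: y|; first by rewrite bump_eq0.
  exfalso; apply: h.
  have E : x + y = t *: x + (1 - t) *: (x + a *: y).
    rewrite scalerDr scalerA aE scale1r scalerBl scale1r.
    by rewrite addrA addrCA subrr addr0.
  have tx : `|t *: x| = 4 * r by rewrite normrZ (gtr0_norm t0) tE.
  have sx : `|(1 - t) *: (x + a *: y)| <= 2 * r.
    rewrite normrZ (gtr0_norm at0); apply: (@le_trans _ _ (1 * `|x + a *: y|)).
      by apply: ler_wpM2r; [exact: normr_ge0|rewrite gerBl (ltW t0)].
    by rewrite mul1r ltW.
  rewrite E; apply/andP; split.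
    by apply: norm_ge_add sx; rewrite tx.
  apply: (le_trans (ler_normD _ _)); rewrite tx; exact: (le_trans (lerD (lexx _) sx)).
Qed.

(** The balls shrink to the point - x, which could a priori carry an atom. [ball_le_annulus]
    compares them with sets that omit this point and decrease to the empty set, so continuity from
    above applies; 12 r <= |x| keeps these sets at distance at least 6 r from 0, where the mass is
    finite. *)
Lemma ball_mass_cvg0 (r : R) x : 0 < r -> 12 * r <= `|x| ->
  mu [set y | `|x + y| <= r / n.+1%:R] @[n --> \oo] --> 0%E.
Proof.
move=> r0 xr; have x0 : 0 < `|x| by lra.
pose F n : set 'rV[R]_d := [set y | `|x + y| <= 6 * (r / n.+1%:R)] `\ (- x).
have n0 n : (0 : R) < n.+1%:R by [].
have rn n : r / n.+1%:R <= r.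
  by rewrite ler_pdivrMr// ler_peMr ?(ltW r0)// ler1n.
have rn0 n : 0 < r / n.+1%:R by rewrite divr_gt0.
have mF n : measurable (F n).
  apply: measurableD; first exact: (measurable_translate x (measurable_norm_le _)).
  rewrite (_ : [set - x] = [set y | [set z : 'rV[R]_d | `|z| <= 0] (x + y)]).
    exact: (measurable_translate x (measurable_norm_le _)).
  apply/seteqP; split => y /=; first by move=> ->; rewrite subrr normr0.
  by rewrite normr_le0 addrC addr_eq0 => /eqP.
have F0 : (mu (F 0%N) < +oo)%E.
  have r60 : 0 < 6 * r by lra.
  apply: (le_lt_trans _ (nu_far_lty hmu r60)); apply: le_measure; rewrite ?inE //.
    exact: measurable_enorm_ge.
  move=> y [/= h _]; apply: (le_trans _ (norm_le_enorm y)).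
  rewrite divr1 in h; have := lerB_normD x y; lra.
have capF : \bigcap_n F n = set0.
  apply/seteqP; split => // y H.
  have y0 : 0 < `|x + y|.
    rewrite normr_gt0 addrC addr_eq0; apply/eqP; have [_ h] := H 0%N I; exact: h.
  have [n Hn] : exists n, 6 * r / `|x + y| < n.+1%:R.
    by exists (Num.truncn (6 * r / `|x + y|)); exact: truncnS_gt.
  have [/= + _] := H n I; rewrite mulrA ler_pdivlMr//.
  by move: Hn; rewrite ltr_pdivrMr// [ltRHS]mulrC => /lt_le_trans h /h; rewrite ltxx.
have dF : nonincreasing_seq F.
  move=> m n mn; apply/subsetPset => y [/= h1 h2]; split => //=.
  apply: (le_trans h1); rewrite ler_wpM2l// ler_wpM2l ?(ltW r0)//.
  by rewrite lef_pV2 ?posrE// ler_nat.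
have := nonincreasing_cvg_mu F0 mF _ dF; rewrite capF measure0.
move=> /(_ measurable0) cF.
apply: (squeeze_cvge _ (@cvg_cst _ 0%E _ _ _) cF).
near=> n; rewrite measure_ge0 /=.
have xn : 8 * (r / n.+1%:R) <= `|x| by move: (rn n) xr r0; move: (r / n.+1%:R) => q; lra.
apply: (le_trans (ball_le_annulus (rn0 n) xn)); apply: le_measure; rewrite ?inE //.
  exact: (measurable_translate x (measurable_annulus _ _)).
move=> y /= /andP[h1 h2]; split => //= yx.
by move: h1; rewrite yx subrr normr0; move: (rn0 n); move: (r / n.+1%:R) => q; lra.
Unshelve. all: by end_near. Qed.

End far_mass.

(** * Tail spaces *)

Section tails.
Context {R : realType} {d : nat}.
Implicit Types (K V : set 'rV[R]_d) (u : 'rV[R]_d -> R) (c : R)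
  (nu : {measure set 'rV[R]_d -> \bar R}).

Lemma near_dist_lt (x : 'rV[R]_d) (e : R) : 0 < e -> \forall y \near x, `|x - y| < e.
Proof. by move=> e0; apply/nbhs_normP; exists e. Qed.

Lemma compact_margin K V : compact K -> open V -> K `<=` V ->
  exists2 e : R, 0 < e & forall x y : 'rV[R]_d, K x -> `|y| <= e -> V (x + y).
Proof.
move=> cK oV KV.
pose Q (e : R) (x : 'rV[R]_d) := forall y, `|y| < e -> V (x + y).
have : \forall e \near (0 : R)^'+, K `<=` Q e.
  move/compact_near_coveringP : cK; apply => x Kx.
  have /nbhs_normP[r /= r0 rV] := open_nbhs_nbhs (conj oV (KV _ Kx)).
  have r2 : 0 < r / 2 by rewrite divr_gt0.
  exists ([set x' | `|x - x'| < r / 2], [set e : R | e < r / 2]).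
    split => /=; last exact: nbhs_right_lt.
    exact: (near_dist_lt x r2).
  move=> [x' e] /= [h1 h2] y ye; apply: rV => /=.
  rewrite opprD addrA (le_lt_trans (ler_normB _ _))//.
  by rewrite [ltRHS]splitr ltrD// (lt_trans ye).
move=> H; have : \forall e \near (0 : R)^'+, 0 < e /\ K `<=` Q e.
  by near=> e; split; [near: e; exact: nbhs_right_gt|near: e].
case/filter_ex => e [e0 KQ]; exists (e / 2); first by rewrite divr_gt0.
move=> x y Kx ye; apply: (KQ _ Kx); apply: (le_lt_trans ye).
by rewrite ltr_pdivrMr// ltr_pMr// ltr1n.
Unshelve. all: by end_near. Qed.

Lemma tail_radius_gt0 K V : compact K -> open V -> K `<=` V -> 0 < tail_radius K V.
Proof.
move=> cK oV KV; have [e e0 He] := compact_margin cK oV KV.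
have ed : (e%:E <= edistance K (~` V))%E.
  apply: le_ereal_inf_tmp => _ [x Kx] [y Vy] <-; rewrite lee_fin leNgt; apply/negP => h.
  apply: Vy; rewrite -(subrKC x y); apply: He => //.
  by rewrite distrC (le_trans (norm_le_enorm _))// ltW.
rewrite /tail_radius; set m := Order.min _ _.
have m1 : (m <= 1)%E by rewrite ge_min lexx orbT.
have me : ((Num.min (2 * e) 1)%:E <= m)%E.
  rewrite le_min; apply/andP; split.
    apply: (@le_trans _ _ (2%:E * e%:E)%E); last by rewrite lee_pmul2l.
    by rewrite -EFinM lee_fin ge_min lexx.
  by rewrite lee_fin ge_min lexx orbT.
have m0 : 0 < Num.min (2 * e) 1 by rewrite lt_min ltr01 mulr_gt0.
(* m lies between two reals, so [fine] does not return its default value 0. *)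
by move: m m1 me => [q| |]//= _; rewrite lee_fin; exact: lt_le_trans.
Qed.

Lemma tail_radius_le K V x y : K x -> ~ V y -> tail_radius K V <= 2 * enorm (x - y).
Proof.
move=> Kx Vy; rewrite /tail_radius.
have e0 : (0 <= edistance K (~` V))%E.
  by apply: le_ereal_inf_tmp => _ [x' _] [y' _] <-; rewrite lee_fin enorm_ge0.
have : (edistance K (~` V) <= (enorm (x - y))%:E)%E.
  by apply: ereal_inf_lbound; exists x => //; exists y.
move: (edistance _ _) e0 => [q| |]//=; rewrite ?leye_eq// !lee_fin => q0 h.
rewrite -EFinM -EFin_min /=; apply: (@le_trans _ _ (2 * q)); first by rewrite ge_min lexx.
by rewrite ler_pM2l.
Qed.

Lemma tail_weightE nu K V : measurable K -> tail_weight nu K V =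
  (fun x => far_mass nu (tail_radius K V) K x +
            far_mass (refl_measure nu) (tail_radius K V) K x)%E.
Proof.
move=> mK; apply/funext => x; congr (_ + _)%E.
  by rewrite /far_mass; congr (nu _); apply/seteqP; split => y [h]; rewrite /= addrC.
rewrite /far_mass /refl_measure /image_measure /= /pushforward; congr (nu _).
by apply/seteqP; split => y /=; rewrite enormN.
Qed.

(** The tail condition with the cutoff radius c independent of K and V, and for one measure at a
    time, so that [nu] and its reflection can be treated in turn. *)
Definition tails nu V u : Prop := forall K c,
  compact K -> K `<=` V -> 0 < c ->
  (\int[leb d]_x (`|u x|%:E * far_mass nu c K x) < +oo)%E.

Lemma compact_measurable_rV K : compact K -> measurable K.
Proof.
move=> cK; rewrite -[K]setCK; apply: measurableC; apply: open_measurable_rV.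
by apply: closed_openC; apply: compact_closed cK; exact: norm_hausdorff.
Qed.

Lemma measurable_tail_integrand nu u c K : levy_measure nu -> 0 < c ->
  measurable_fun setT u -> compact K ->
  measurable_fun setT (fun x => `|u x|%:E * far_mass nu c K x)%E.
Proof.
move=> hnu c0 mu cK; apply: emeasurable_funM.
  by apply/measurable_EFinP; exact: measurableT_comp.
by apply: measurable_fun_far_mass => //; exact: compact_measurable_rV.
Qed.

Lemma tail_space_of_tails nu V u : open V -> levy_measure nu ->
  measurable_fun setT u -> tails nu V u -> tails (refl_measure nu) V u ->
  tail_space nu V u.
Proof.
move=> oV hnu mu t1 t2; split => // K cK KV.
have r0 := tail_radius_gt0 cK oV KV.
rewrite tail_weightE; last exact: compact_measurable_rV.
have g0 (m : {measure set 'rV[R]_d -> \bar R}) x :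
  (0 <= `|u x|%:E * far_mass m (tail_radius K V) K x)%E by rewrite mule_ge0.
under eq_integral => x _ do rewrite ge0_muleDr//.
have m1 := measurable_tail_integrand hnu r0 mu cK.
have m2 := measurable_tail_integrand (levy_measure_refl hnu) r0 mu cK.
rewrite (ge0_integralD _ _ _ m1 _ m2)//.
by apply: lte_add_pinfty; [exact: t1|exact: t2].
Qed.

Lemma open_punctured V : open V -> open (V `\ 0).
Proof.
move=> oV; apply: openI => //; apply: closed_openC.
by apply: compact_closed (@compact_set1 _ _); exact: norm_hausdorff.
Qed.

(* Adding to K a point close to the removed origin makes the radius r_{K,V} as
   small as desired. *)
Lemma tails_of_tail_space nu (D : set 'rV[R]_d) u : (0 < d)%N -> open D -> D 0 ->
  levy_measure nu -> tail_space nu (D `\ 0) u ->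
  tails nu (D `\ 0) u /\ tails (refl_measure nu) (D `\ 0) u.
Proof.
move=> d0 oD D0 hnu [mu tu]; pose V : set 'rV[R]_d := D `\ 0.
have oV : open V by exact: open_punctured.
(* A smaller radius and a larger set only increase the far mass, so it suffices to enlarge K until
   its tail radius is at most c. *)
suff H K (c : R) : compact K -> K `<=` D `\ 0 -> 0 < c ->
    exists2 K', compact K' & [/\ K' `<=` D `\ 0, K `<=` K' & tail_radius K' (D `\ 0) <= c].
  have main (m : {measure set 'rV[R]_d -> \bar R}) : levy_measure m ->
      (forall K, measurable K -> forall x,
        far_mass m (tail_radius K V) K x <= tail_weight nu K V x)%E ->
      tails m V u.
    move=> hm le_m K c cK KV c0; have [K' cK' [K'V KK' rc]] := H K c cK KV c0.
    have mK := compact_measurable_rV cK; have mK' := compact_measurable_rV cK'.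
    apply: le_lt_trans (tu _ cK' K'V); apply: ge0_le_integral => //.
    - by move=> x _; rewrite mule_ge0.
    - exact: measurable_tail_integrand.
    - apply: emeasurable_funM; first by apply/measurable_EFinP; exact: measurableT_comp.
      rewrite tail_weightE//; apply: emeasurable_funD;
        (apply: measurable_fun_far_mass; [|exact: (tail_radius_gt0 cK' oV K'V)|by []]) => //.
      exact: levy_measure_refl.
    - move=> x _; rewrite lee_wpmul2l ?lee_fin//; apply: le_trans (le_m _ mK' x).
      exact: far_mass_le.
  split; apply: main => //.
  - by move=> K mK x; rewrite tail_weightE// leeDl.
  - exact: levy_measure_refl.
  - by move=> K mK x; rewrite tail_weightE// leeDr.
(* A nonzero direction, available since d > 0. The factor t keeps t e inside D and at Euclidean
   distance at most c / 2 from 0, which is in the complement of the punctured set. *)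
move=> cK KV c0; pose e : 'rV[R]_d := delta_mx ord0 (Ordinal d0).
have e0 : 0 < `|e|.
  rewrite normr_gt0; apply/eqP => /rowP /(_ (Ordinal d0)).
  by rewrite !mxE !eqxx /=; move/eqP; rewrite oner_eq0.
have /nbhs_normP[r /= r0 rD] := open_nbhs_nbhs (conj oD D0).
have q0 : 0 < enorm e by apply: (lt_le_trans e0); exact: norm_le_enorm.
pose t := Num.min (r / 2 / `|e|) (c / 2 / enorm e).
have t0 : 0 < t by rewrite lt_min !divr_gt0.
exists (K `|` [set t *: e]); first by apply: compactU => //; exact: compact_set1.
split; [|by move=> x; left|].
  move=> x [/KV //|->]; split => /=.
    apply: rD => /=; rewrite sub0r normrN normrZ gtr0_norm//.
    apply: (@le_lt_trans _ _ (r / 2)); first by rewrite -ler_pdivlMr// ge_min lexx.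
    by rewrite ltr_pdivrMr// ltr_pMr// ltr1n.
  by move=> /eqP; rewrite scaler_eq0 gt_eqF//= -normr_eq0 gt_eqF.
apply: (le_trans (tail_radius_le (x := t *: e) (y := 0) _ _)).
- by right.
- by case=> _ /=; apply.
rewrite subr0 enormZ gtr0_norm// mulrC -ler_pdivlMr// -ler_pdivlMr//.
by rewrite ge_min lexx orbT.
Qed.

End tails.

(** * Limit theorems almost everywhere *)

Section convergence.
Context dT (T : measurableType dT) {R : realType} (m : {measure set T -> \bar R}).
Implicit Types (F : nat -> T -> R) (f g : T -> R).

Lemma integrable_EFinZ (k : R) f : m.-integrable setT (EFin \o f) ->
  m.-integrable setT (EFin \o (fun x => k * f x)).
Proof.
by move=> h; apply: eq_integrable (integrableZl measurableT k h) => // x _ /=; rewrite EFinM.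
Qed.

Lemma integrable_EFinD f g : m.-integrable setT (EFin \o f) ->
  m.-integrable setT (EFin \o g) -> m.-integrable setT (EFin \o (fun x => f x + g x)).
Proof.
by move=> h1 h2; apply: eq_integrable (integrableD measurableT h1 h2) => // x _ /=; rewrite EFinD.
Qed.

(** The integrals are summable, so the series of the F n is finite almost everywhere and its terms
    tend to 0, without passing to a subsequence. *)
Lemma ge0_series_ae_cvg0 F : (forall n, measurable_fun setT (F n)) ->
  (forall n x, 0 <= F n x) ->
  (forall n, (\int[m]_x (F n x)%:E <= (1 / (2 ^ n.+1)%:R)%:E)%E) ->
  {ae m, forall x, F n x @[n --> \oo] --> (0 : R)}.
Proof.
move=> mF F0 Fn; have mFE n : measurable_fun setT (fun x => (F n x)%:E) by exact/measurable_EFinP.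
pose S x := (\sum_(n <oo) (F n x)%:E)%E.
have S0 x : (0 <= S x)%E by apply: nneseries_ge0 => n _ _; rewrite lee_fin.
have mS : measurable_fun setT S.
  by apply: ge0_emeasurable_sum => // n x _ _; rewrite lee_fin.
have iS : m.-integrable setT S.
  apply/integrableP; split => //; under eq_integral => x _ do rewrite gee0_abs//.
  rewrite /S integral_nneseries//; last by move=> n x _; rewrite lee_fin.
  apply: (@le_lt_trans _ _ 1%E); last by rewrite ltey.
  apply: le_trans (epsilon_trick0 xpredT (@ler01 R)); apply: lee_nneseries => // n _ _.
  by apply: integral_ge0 => x _; rewrite lee_fin.
apply: filterS (integrable_ae measurableT iS) => x /(_ I) Sx.
apply: cvg_series_cvg_0; apply: nnseries_is_cvg => //.
by move: Sx; rewrite ge0_fin_numE.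
Qed.

Lemma fatou_ae F f (C : \bar R) : (forall n, measurable_fun setT (F n)) ->
  (forall n x, 0 <= F n x) -> measurable_fun setT f -> (forall x, 0 <= f x) ->
  {ae m, forall x, F n x @[n --> \oo] --> f x} ->
  (forall n, (\int[m]_x (F n x)%:E <= C)%E) -> (\int[m]_x (f x)%:E <= C)%E.
Proof.
move=> mF F0 mf f0 Ff FC.
have mFE n : measurable_fun setT (fun x => (F n x)%:E) by exact/measurable_EFinP.
have FE0 n x : setT x -> (0 <= (F n x)%:E)%E by rewrite lee_fin.
apply: (@le_trans _ _ (\int[m]_x limn_einf (fun n => (F n x)%:E))%E).
  apply: ae_ge0_le_integral => //.
  - by move=> x _; rewrite lee_fin.
  - exact/measurable_EFinP.
  - move=> x _; rewrite limn_einf_lim; apply: lime_ge; first exact: is_cvg_einfs.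
    by apply: nearW => n; apply: le_ereal_inf_tmp => _ [k _ <-]; rewrite lee_fin.
  - rewrite /limn_einf; apply: measurableT_comp => //.
    by apply: measurable_fun_limn_esup => n; exact: measurableT_comp.
  - apply: filterS Ff => x Fx _.
    have /cvg_limn_einf_sup[-> _] // : (F n x)%:E @[n --> \oo] --> (f x)%:E.
    by apply/cvg_EFin => //; exact: nearW.
apply: (le_trans (fatou m measurableT mFE FE0)).
rewrite limn_einf_lim; apply: lime_le; first exact: is_cvg_einfs.
apply: nearW => n; apply: le_trans (FC n).
by apply: ereal_inf_lbound; exists n => /=.
Qed.

Lemma Rintegral_cvg_ae F f g : (forall n, measurable_fun setT (F n)) ->
  measurable_fun setT f -> {ae m, forall x, F n x @[n --> \oo] --> f x} ->
  m.-integrable setT (EFin \o g) -> (forall n x, `|F n x| <= g x) ->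
  m.-integrable setT (EFin \o f) /\
  \int[m]_x F n x @[n --> \oo] --> \int[m]_x f x.
Proof.
move=> mF mf Ff ig Fg.
have mFE n : measurable_fun setT (fun x => (F n x)%:E) by exact/measurable_EFinP.
have mfE : measurable_fun setT (EFin \o f) by exact/measurable_EFinP.
have [] := @dominated_convergence _ T R m setT measurableT _ _ _ mFE mfE _ ig _.
- by apply: filterS Ff => x Fx _; apply/cvg_EFin => //; exact: nearW.
- by apply: aeW => x n _; rewrite lee_fin.
move=> if_ _ cF; split => //.
have E : ((\int[m]_x f x)%:E = \int[m]_x (EFin \o f) x)%E.
  by rewrite /Rintegral fineK//; exact: integrable_fin_num.
by rewrite -E in cF; exact: (fine_cvg cF).
Qed.

End convergence.

(** * The equation near the origin *)

Section removable_singularity.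
Context {R : realType} {d : nat} {dO : measure_display} {Omega : measurableType dO}.
Variables (P : probability Omega R) (Y : R -> Omega -> 'rV[R]_d).
Variables (b : 'rV[R]_d) (mu : {measure set 'rV[R]_d -> \bar R}) (s : R).
Hypothesis hmu : levy_measure mu.
Hypothesis mY : forall t, 0 <= t -> measurable_fun setT (Y t).
Hypothesis hgen : generated_by P Y (levy_op b mu).
Hypothesis s0 : 0 < s.
Hypothesis sd : 2 * s < d%:R.
Hypothesis hst : strictly_stable s b mu.
Implicit Types (x y z : 'rV[R]_d) (f g eta : 'rV[R]_d -> R) (K V : set 'rV[R]_d).

Local Notation L := (levy_op b mu).

(** At such an x only the jumps landing where [eta] is nonzero contribute, each by at most M. *)
Lemma levy_op_far_le eta x K (M e : R) : measurable K -> measurable_fun setT eta ->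
  (\near x, eta x = 0) -> (forall z, `|eta z| <= M) ->
  (forall y, eta (x + y) != 0 -> e <= enorm y /\ K (x + y)) ->
  (`|L eta x|%:E <= M%:E * far_mass mu e K x)%E.
Proof.
move=> mK meta eta0 M1 etaK; rewrite (levy_op_near0 b mu eta0) /Rintegral.
have mA := measurable_far_set e x mK.
have M0 : 0 <= M by apply: le_trans (normr_ge0 _) (M1 0).
have ms : measurable_fun setT (fun y => eta (x + y)).
  apply: (measurableT_comp meta); apply: continuous_measurable_rV.
  exact: continuous_addl.
have fineE (I : \bar R) : (`|fine I|%:E <= `|I|)%E by case: I => [r| |] /=; rewrite ?normr0 ?leey.
apply: (le_trans (fineE _)).
apply: (le_trans (le_abse_integral mu measurableT _)); first exact/measurable_EFinP.
pose A := [set y | e <= enorm y /\ K (x + y)].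
have <- : (\int[mu]_y (\1_A y)%:E = far_mass mu e K x)%E.
  by rewrite integral_indic// setIT.
rewrite -ge0_integralZl//; last by apply/measurable_EFinP; exact: measurable_indic.
apply: ge0_le_integral => //.
- by apply/measurable_EFinP; apply: measurableT_comp => //; exact/measurable_EFinP.
- by apply/measurable_EFinP; apply: measurable_funM => //; exact: measurable_indic.
- move=> y _; rewrite -EFinM lee_fin indicE.
  have [->|h] := eqVneq (eta (x + y)) 0; first by rewrite normr0 mulr_ge0.
  by rewrite mem_set ?mulr1//; exact: etaK.
Qed.

Variable u : 'rV[R]_d -> R.
Hypothesis u0 : forall x, 0 <= u x.
Hypothesis mfu : measurable_fun setT u.

(** On the closed e-neighbourhood K' of the support, L eta is bounded and u is integrable. Off K' a
    jump into the support has size at least e, so the tail condition takes over. *)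
Lemma integrable_levy_op V eta : open V ->
  (forall K, compact K -> K `<=` V -> (\int[leb d]_(x in K) (u x)%:E < +oo)%E) ->
  tails mu V u -> Cck 2 V eta ->
  (leb d).-integrable setT (EFin \o (fun x => u x * L eta x)).
Proof.
move=> oV uL1 tu Ceta; have [C2 cK KV] := Ceta.
have [e e0 KeV] := compact_margin cK oV KV.
pose K := supp eta.
pose K' := (fun p : 'rV[R]_d * 'rV[R]_d => p.1 + p.2) @` (K `*` [set y | `|y| <= e]).
have cK' : compact K'.
  apply: continuous_compact; last by apply: compact_setX => //; exact: compact_norm_le.
  by apply: continuous_subspaceT => p; exact: add_continuous.
have K'V : K' `<=` V by move=> _ [[x y] /= [Kx ye] <-]; exact: KeV.
have mK := compact_measurable_rV cK; have mK' := compact_measurable_rV cK'.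
have C2T := Cck_setT Ceta.
have [C C0 LC] := levy_op_bounded mY hgen C2T.
have [A A0 etaA] := Cck_bounded_supp Ceta.
have [M M0 etaM] := continuous_bounded_supp (Ck_continuous C2) etaA.
have mL : measurable_fun setT (L eta).
  by apply: continuous_measurable_rVR; exact: (levy_op_continuous mY hgen C2T).
have mt := measurable_tail_integrand hmu e0 mfu cK.
have mf : measurable_fun setT (fun x => u x * L eta x) by exact: measurable_funM.
apply/integrableP; split; first exact/measurable_EFinP.
pose g1 x := (C%:E * ((u x)%:E * (\1_K' x)%:E))%E.
pose g2 x := (M%:E * (`|u x|%:E * far_mass mu e K x))%E.
have mg1 : measurable_fun setT (fun x => ((u x)%:E * (\1_K' x)%:E)%E).
  by apply: emeasurable_funM; apply/measurable_EFinP => //; exact: measurable_indic.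
apply: (@le_lt_trans _ _ (\int[leb d]_x (g1 x + g2 x))%E).
  apply: ge0_le_integral => //.
  - by apply/measurable_EFinP; apply: measurableT_comp => //; exact/measurable_EFinP.
  - by apply: emeasurable_funD; apply: measurable_funeM.
  - move=> x _ /=; rewrite normrM (ger0_norm (u0 x)) /g1 /g2 indicE.
    have [K'x|] := boolP (x \in K').
      rewrite mule1 (ger0_norm (u0 x)); apply: (@le_trans _ _ (C%:E * (u x)%:E)%E).
        by rewrite -EFinM lee_fin mulrC ler_wpM2r.
      by rewrite leeDl// mule_ge0 ?lee_fin ?(ltW M0)// mule_ge0 ?lee_fin.
    rewrite notin_setE => K'x; rewrite mule0 mule0 add0e (ger0_norm (u0 x)).
    rewrite muleCA EFinM lee_wpmul2l ?lee_fin//.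
    apply: levy_op_far_le => //.
    - by apply: continuous_measurable_rVR; exact: Ck_continuous C2.
    - apply: filterS (near_dist_lt x e0) => z xz; apply: supp_eq0 => Kz.
      by apply: K'x; exists (z, x - z); rewrite /= ?subrKC//; split => //=; exact: ltW.
    - move=> y etay; have Kxy : K (x + y) by exact: subset_closure.
      split => //; apply: le_trans (norm_le_enorm y); rewrite leNgt; apply/negP => ye.
      apply: K'x; exists (x + y, - y); rewrite /= ?addrK//; split => //=.
      by rewrite normrN ltW.
have p1 x : (0 <= (u x)%:E * (\1_K' x)%:E)%E by rewrite mule_ge0 ?lee_fin ?u0.
have p2 x : (0 <= `|u x|%:E * far_mass mu e K x)%E by rewrite mule_ge0.
have g10 x : (0 <= g1 x)%E by rewrite /g1 mule_ge0// lee_fin ltW.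
have g20 x : (0 <= g2 x)%E by rewrite /g2 mule_ge0// lee_fin ltW.
rewrite ge0_integralD//; do ?exact: measurable_funeM.
rewrite (ge0_integralZl _ _ mg1)// ?lee_fin ?(ltW C0)//.
rewrite (ge0_integralZl _ _ mt)// ?lee_fin ?(ltW M0)//.
apply: lte_add_pinfty; apply: lte_mul_pinfty; rewrite ?lee_fin ?(ltW C0) ?(ltW M0)//.
- have := uL1 _ cK' K'V; congr (_ < _)%E; rewrite [LHS]integral_mkcond.
  apply: eq_integral => x _; rewrite patchE indicE; case: ifPn => _; first by rewrite mule1.
  by rewrite mule0.
- exact: tu.
Qed.
Lemma integral_mul_indic g K : measurable K ->
  (\int[leb d]_x ((g x)%:E * (\1_K x)%:E) = \int[leb d]_(x in K) (g x)%:E)%E.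
Proof.
move=> mK; rewrite [RHS]integral_mkcond; apply: eq_integral => x _.
by rewrite patchE indicE; case: ifPn => _; rewrite ?mule1 ?mule0.
Qed.

Lemma integrable_bounded_supp g f K (C : R) : measurable_fun setT g ->
  (forall x, 0 <= g x) -> measurable_fun setT f -> (forall x, `|f x| <= C) ->
  (forall x, ~ K x -> f x = 0) -> measurable K ->
  (\int[leb d]_(x in K) (g x)%:E < +oo)%E ->
  (leb d).-integrable setT (EFin \o (fun x => g x * f x)).
Proof.
move=> mg g0 mf fC fK mK gK.
have mgf : measurable_fun setT (fun x => g x * f x) by exact: measurable_funM.
have C0 : 0 <= C by apply: le_trans (fC 0).
have mg1 : measurable_fun setT (fun x => ((g x)%:E * (\1_K x)%:E)%E).
  by apply: emeasurable_funM; apply/measurable_EFinP => //; exact: measurable_indic.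
have p1 x : (0 <= (g x)%:E * (\1_K x)%:E)%E by rewrite mule_ge0 ?lee_fin ?g0.
apply/integrableP; split; first exact/measurable_EFinP.
apply: (@le_lt_trans _ _ (\int[leb d]_x (C%:E * ((g x)%:E * (\1_K x)%:E)))%E).
  apply: ge0_le_integral => //.
  - by apply/measurable_EFinP; apply: measurableT_comp => //; exact/measurable_EFinP.
  - exact: measurable_funeM.
  - move=> x _; rewrite -!EFinM lee_fin normrM (ger0_norm (g0 x)) indicE mulrCA.
    rewrite ler_wpM2l//; case: (boolP (x \in K)) => [_|]; first by rewrite mulr1.
    by rewrite notin_setE => /fK ->; rewrite normr0 mulr0.
rewrite (ge0_integralZl _ _ mg1)// ?lee_fin// integral_mul_indic//.
by apply: lte_mul_pinfty; rewrite ?lee_fin.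
Qed.

Variable p : R.
Hypothesis p1 : 1 < p.

Local Notation up := (fun x => u x `^ p).

Lemma measurable_up : measurable_fun setT up.
Proof. exact: (measurableT_comp (measurable_powR p) mfu). Qed.

Lemma leb_compact_lty K : compact K -> (leb d K < +oo)%E.
Proof.
move=> cK; have [M M0 KM] := compact_norm_bounded cK.
apply: le_lt_trans (leb_ball_lty M); apply: le_measure; rewrite ?inE.
- exact: compact_measurable_rV.
- exact: measurable_norm_le.
- by move=> x /KM.
Qed.

(** The pointwise bound is u <= 1 + u^p, and compact sets have finite measure. *)
Lemma integral_u_lty K : compact K -> (\int[leb d]_(x in K) (up x)%:E < +oo)%E ->
  (\int[leb d]_(x in K) (u x)%:E < +oo)%E.
Proof.
move=> cK h; have mK := compact_measurable_rV cK.
apply: (@le_lt_trans _ _ (\int[leb d]_(x in K) (1 + (up x)%:E))%E).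
  apply: ge0_le_integral => //.
  - by move=> x _; rewrite lee_fin.
  - by apply/measurable_EFinP; exact: measurable_funTS.
  - by apply: emeasurable_funD => //; apply/measurable_EFinP; apply: measurable_funTS; exact: measurable_up.
  - move=> x _; rewrite -EFinD lee_fin.
    by have := le_add_powR (ltW p1) ltr01 (u0 x); rewrite powR1 mul1r.
rewrite ge0_integralD//.
- rewrite integral_cst// mul1e; apply: lte_add_pinfty => //; exact: leb_compact_lty.
- by move=> x _; rewrite lee_fin powR_ge0.
- by apply/measurable_EFinP; apply: measurable_funTS; exact: measurable_up.
Qed.

Variable D : set 'rV[R]_d.
Hypothesis oD : open D.
Hypothesis D0 : D 0.
Let V0 : set 'rV[R]_d := D `\ 0.
Hypothesis tu0 : tails mu V0 u.
Hypothesis uLp0 : forall K, compact K -> K `<=` V0 ->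
  (\int[leb d]_(x in K) (up x)%:E < +oo)%E.
Hypothesis equ : forall eta, Ccinfty V0 eta ->
  \int[leb d]_x (u x * L eta x) + \int[leb d]_x (up x * eta x) = 0.

Let oV0 : open V0. Proof. exact: open_punctured. Qed.

(** * Test functions cut off by a potential *)

Lemma continuous_dramp (m : R) : continuous (dramp m).
Proof.
move=> t; have c n : continuous (exp_inv (R := R) n) := C1k_continuous (C1k_exp_inv 0 n).
apply: cvgD; (apply: (@continuous_comp _ _ _ (fun t => m * t)); last exact: c);
  by apply: cvgM; [exact: cvg_cst|exact: cvg_id].
Qed.

(** Both w and the factor [dramp] of l vanish outside the compact set K, the support of zeta
    deprived of a ball around 0 where zeta < Gam. Hence only the integrability known on the
    punctured set is used, although zeta itself may be positive at 0. *)
Lemma polar_test zeta Gam (m e : R) : Ccinfty D zeta -> (forall x, 0 <= zeta x) ->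
  (forall k, Cck k setT Gam) -> (forall x, 0 <= Gam x) -> zeta 0 < Gam 0 ->
  0 <= e <= 1 -> (forall x, L Gam x <= Gam x + e) -> 0 < m ->
  let w x := ramp m (zeta x - Gam x) in
  let l x := dramp m (zeta x - Gam x) * (L zeta x - Gam x - e) in
  [/\ (leb d).-integrable setT (EFin \o (fun x => up x * w x)),
      (leb d).-integrable setT (EFin \o (fun x => u x * l x)) &
      \int[leb d]_x (up x * w x) + \int[leb d]_x (u x * l x) <= 0].
Proof.
move=> Cz z0 CG G0 zG /andP[e0 e1] LG m0 w l.
have CzT k : Cck k setT zeta := Cck_setT (Cz k).
have Ct k : Cck k setT (zeta - Gam) by exact: CckB.
have cz : continuous zeta by case: (Cz 0%N) => /Ck_continuous.
have ct : continuous (zeta - Gam) by case: (Ct 0%N) => /Ck_continuous.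
have cG : continuous Gam by case: (CG 0%N) => /Ck_continuous.
have [r r0 Hr] : exists2 r : R, 0 < r & forall x, `|x| < r -> zeta x < Gam x.
  have oN : open ((zeta - Gam) @^-1` [set t | t < 0]).
    by apply: open_comp => [x _|]; [exact: ct|exact: open_lt].
  have N0 : ((zeta - Gam) @^-1` [set t | t < 0]) 0 by rewrite /= subr_lt0.
  have /nbhs_normP[r /= r0 H] := open_nbhs_nbhs (conj oN N0).
  exists r => // x xr; have := H x; rewrite /= sub0r normrN => /(_ xr).
  by rewrite subr_lt0.
pose K := supp zeta `&` [set x | r <= `|x|].
have tK x : ~ K x -> zeta x - Gam x <= 0.
  move=> Kx; have [xr|xr] := ltP `|x| r; first by rewrite subr_le0 ltW// Hr.
  by rewrite supp_eq0 ?sub0r ?oppr_le0// => h; apply: Kx.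
have cK : compact K.
  have [_ cs _] := Cz 0%N; apply: compact_closedI cs _.
  rewrite (_ : mkset _ = ~` [set x | `|x| < r]); first exact/open_closedC/open_norm_lt.
  by apply/seteqP; split => x /=; rewrite leNgt => /negP.
have mK := compact_measurable_rV cK.
have KV : K `<=` V0.
  move=> x [sx xr]; split; first by have [_ _] := Cz 0%N; apply.
  by move=> /= x0; move: xr; rewrite x0 /= normr0 leNgt r0.
have Cw : Ccinfty V0 w.
  move=> k; have [Ck_t _ _] := Ct k.
  apply: (CckI (K := K)) => //; first exact: (Ck_ramp m Ck_t).
  by move=> x /tK h; rewrite /w ramp_le0.
have [B B0 LB] := levy_op_bounded mY hgen (CzT 2%N).
have [M M0 zM] := Cck_bounded_supp (Cz 0%N).
have [A A0 zA] := continuous_bounded_supp cz zM.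
have up0 x : 0 <= up x by exact: powR_ge0.
have mw : measurable_fun setT w.
  by apply: continuous_measurable_rVR; have [/Ck_continuous] := Cw 0%N.
have wA x : `|w x| <= A.
  rewrite ger0_norm ?ramp_ge0//; apply: le_trans (ramp_le _ m0) _.
  rewrite ge_max (ltW A0) andbT lerBlDr (le_trans (ler_norm _))// (le_trans (zA x))//.
  by rewrite lerDl.
have iw : (leb d).-integrable setT (EFin \o (fun x => up x * w x)).
  apply: (integrable_bounded_supp measurable_up up0 mw wA _ mK (uLp0 cK KV)).
  by move=> x /tK h; rewrite /w ramp_le0.
have ml : measurable_fun setT l.
  apply: measurable_funM.
    apply: (measurableT_comp (f := dramp m) (g := zeta - Gam)).
      exact: continuous_measurable_fun (@continuous_dramp m).
    exact: continuous_measurable_rVR.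
  apply: measurable_funB; last exact: measurable_cst.
  apply: measurable_funB; last exact: continuous_measurable_rVR.
  by apply: continuous_measurable_rVR; exact: (levy_op_continuous mY hgen (CzT 2%N)).
have lC x : `|l x| <= B + A + 1.
  have C0 : 0 <= B + A + 1 by rewrite !addr_ge0 ?ltW.
  have [t0|t0] := leP (zeta x - Gam x) 0; first by rewrite /l dramp_le0// mul0r normr0.
  rewrite normrM (ger0_norm (dramp_ge0 _ _)) -[leRHS]mul1r.
  apply: ler_pM; rewrite ?dramp_ge0 ?dramp_le1 ?normr_ge0//.
  apply: (le_trans (ler_normB _ _)); rewrite (ger0_norm e0) lerD//.
  apply: (le_trans (ler_normB _ _)); rewrite (ger0_norm (G0 x)) lerD//.
  by move: t0; rewrite subr_gt0 => /ltW /le_trans; apply; exact: le_trans (ler_norm _) (zA x).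
have il : (leb d).-integrable setT (EFin \o (fun x => u x * l x)).
  apply: (integrable_bounded_supp mfu u0 ml lC _ mK (integral_u_lty cK (uLp0 cK KV))).
  by move=> x /tK h; rewrite /l dramp_le0// mul0r.
split => //; rewrite -(equ Cw) addrC lerD2r.
have iL : (leb d).-integrable setT (EFin \o (fun x => u x * L w x)).
  apply: (integrable_levy_op oV0 _ tu0 (Cw 2%N)) => K1 cK1 K1V.
  exact: integral_u_lty cK1 (uLp0 cK1 K1V).
apply: le_Rintegral => // x _; rewrite ler_wpM2l//.
apply: le_trans (levy_op_ramp b hmu x m0 (Ct 2%N)).
rewrite ler_wpM2l ?dramp_ge0// (levy_opB b hmu x (CzT 2%N) (CG 2%N)).
by rewrite -addrA -opprD lerD2l lerN2.
Qed.
Lemma continuous_ramp (m : R) : continuous (ramp m).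
Proof.
move=> t; have c : continuous (exp_inv (R := R) 0) := C1k_continuous (C1k_exp_inv 0 0).
apply: cvgM; first exact: cvg_id.
apply: (@continuous_comp _ _ _ (fun t => m * t)); last exact: c.
by apply: cvgM; [exact: cvg_cst|exact: cvg_id].
Qed.

(** The n-th potential has error and mass at most 2^(- n - 1), so the masses are summable and
    convergence holds almost everywhere. *)
Lemma exists_polar_seq (M : R) : 0 < M -> exists Gam : nat -> 'rV[R]_d -> R,
  [/\ forall n k, Cck k setT (Gam n), forall n x, 0 <= Gam n x,
      forall n, M <= Gam n 0,
      forall n x, L (Gam n) x <= Gam n x + 1 / (2 ^ n.+1)%:R &
      {ae leb d, forall x, Gam n x @[n --> \oo] --> (0 : R)}].
Proof.
move=> M0; have H (n : nat) := exists_polar hmu mY hgen s0 sd hst M0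
  (divr_gt0 (@ltr01 R) (_ : 0 < (2 ^ n.+1)%:R)).
have {H} /choice[Gam HG] : forall n, exists G : 'rV[R]_d -> R,
    [/\ forall k, Cck k setT G, forall x, 0 <= G x, M <= G 0,
     forall x, L G x <= G x + 1 / (2 ^ n.+1)%:R &
     (\int[leb d]_x (G x)%:E <= (1 / (2 ^ n.+1)%:R)%:E)%E].
  by apply: H => n; rewrite ltr0n expn_gt0.
exists Gam; split.
- by move=> n k; have [+ _ _ _ _] := HG n; exact.
- by move=> n x; have [_ + _ _ _] := HG n; exact.
- by move=> n; have [_ _ + _ _] := HG n.
- by move=> n x; have [_ _ _ + _] := HG n; exact.
- apply: ge0_series_ae_cvg0.
  + move=> n; apply: continuous_measurable_rVR.
    by have [+ _ _ _ _] := HG n; move=> /(_ 0%N)[/Ck_continuous].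
  + by move=> n x; have [_ + _ _ _] := HG n; exact.
  + by move=> n; have [_ _ _ _ +] := HG n.
Qed.

Lemma pow2_inv_itv (n : nat) : 0 <= (1 : R) / (2 ^ n.+1)%:R <= 1.
Proof.
rewrite divr_ge0//= ler_pdivrMr ?ltr0n ?expn_gt0// mul1r.
by rewrite ler1n expn_gt0.
Qed.

Lemma Ccinfty_bump (a : R) V : 0 < a -> [set x | `|x| <= 2 * a] `<=` V ->
  Ccinfty V (bump (d := d) a).
Proof.
move=> a0 aV k; have cQ := @compact_norm_le R d (2 * a).
apply: (CckI (Ck_bump a k) cQ _ aV) => x /negP; rewrite -ltNge => /ltW xa.
exact: bump_eq0.
Qed.

Let absorb_ge0 (C C' v dr q A : R) : 0 <= v -> 0 <= dr -> C * v * dr <= A + C' ->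
  - C <= q -> 0 <= A + C' + v * (dr * q).
Proof.
move=> v0 dr0 h Cq; have : 0 <= v * dr * (q + C).
  by rewrite !mulr_ge0//; rewrite -lerBlDr sub0r.
by move: h; nra.
Qed.

Let polar_lower (a c e B : R) : `|a| <= B -> c <= 1 -> e <= 1 ->
  - (B + 1 + 1) <= a - c - e.
Proof. by rewrite ler_norml => /andP[h _]; lra. Qed.

(** Where Gam < zeta <= 1, the factor L zeta - Gam - e is at least - (B + 2), and [dramp_absorb]
    turns half of the u^p term against it at the price of a constant on a cube. The resulting bound
    2 J does not depend on n, so Fatou's lemma removes Gam. *)
Lemma integral_up_cube (a : R) : 0 < a -> [set x | `|x| <= 2 * a] `<=` D ->
  (\int[leb d]_(x in [set x | (`|x| <= a)%R]) (up x)%:E < +oo)%E.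
Proof.
move=> a0 aD; pose zeta : 'rV[R]_d -> R := bump a.
have Cz : Ccinfty D zeta by exact: Ccinfty_bump.
have z0 x : 0 <= zeta x by exact: bump_ge0.
have z1 x : zeta x <= 1 by exact: bump_le1.
(* The height 2 exceeds zeta 0 <= 1. *)
have [Gam [CG G0 MG LG cvG]] := exists_polar_seq (@ltr0n R 2).
have [B B0 LB] := levy_op_bounded mY hgen (Cck_setT (Cz 2%N)).
have C0 : 0 < B + 1 + 1 by rewrite !addr_gt0.
have [C' C'0 HC] := dramp_absorb p1 C0.
pose Q := [set x : 'rV[R]_d | `|x| <= 2 * a].
have mQ : measurable Q by exact: measurable_norm_le.
have iQ : (leb d).-integrable setT (EFin \o (fun x => C' * \1_Q x)).
  apply: integrable_EFinZ; apply/integrableP; split.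
    by apply/measurable_EFinP; exact: measurable_indic.
  under eq_integral => x _ do rewrite gee0_abs ?lee_fin//.
  by rewrite integral_indic// setIT; exact: leb_ball_lty.
pose J := \int[leb d]_x (C' * \1_Q x).
have zG n : zeta 0 < Gam n 0.
  by apply: lt_le_trans (MG n); apply: (le_lt_trans (z1 0)); rewrite ltr1n.
have wJ n : (\int[leb d]_x (up x * ramp 1 (zeta x - Gam n x))%:E <= (2 * J)%:E)%E.
  have [iw il] := polar_test Cz z0 (CG n) (G0 n) (zG n) (pow2_inv_itv n) (LG n) ltr01.
  rewrite -[X in (X <= _)%E]fineK; last exact: integrable_fin_num.
  rewrite lee_fin -/(Rintegral _ _ _).
  move: (il) iw; set w := (fun x => up x * _); set l := (fun x => u x * _) => {}il iw h.
  have ih : (leb d).-integrable setT (EFin \o (fun x => 2^-1 * w x)).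
    exact: integrable_EFinZ.
  (* Pointwise this is the absorption inequality. Together with int w + int l <= 0 it yields int w
     <= 2 J. *)
  have : 0 <= \int[leb d]_x (2^-1 * w x + C' * \1_Q x + l x).
    apply: Rintegral_ge0 => x _; rewrite /w /l.
    have [t0|t0] := leP (zeta x - Gam n x) 0.
      rewrite ramp_le0// dramp_le0// mul0r !mulr0 add0r addr0.
      by rewrite mulr_ge0// indicE.
    have Qx : Q x.
      rewrite /Q /= leNgt; apply/negP => /ltW xa; move: t0.
      by rewrite /zeta bump_eq0// sub0r oppr_gt0 ltNge G0.
    rewrite indicE mem_set// mulr1.
    have t1 : zeta x - Gam n x <= 1 by rewrite lerBlDr (le_trans (z1 x))// lerDl.
    apply: absorb_ge0 (HC _ _ (u0 x) t1) _ => //; first exact: dramp_ge0.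
    have G1 : Gam n x <= 1 by apply: le_trans (z1 x); rewrite -subr_ge0 ltW.
    have /andP[_ e1] := pow2_inv_itv n.
    by apply: polar_lower (LB x) G1 e1.
  have ihQ : (leb d).-integrable setT (EFin \o (fun x => 2^-1 * w x + C' * \1_Q x)).
    exact: integrable_EFinD.
  rewrite (RintegralD _ ihQ il)// (RintegralD _ ih iQ)// [\int[leb d]_x (2^-1 * w x)]RintegralZl// -/J; move: h.
  move: (\int[leb d]_x w x) (\int[leb d]_x l x) => i j; lra.
have up0 x : 0 <= up x by exact: powR_ge0.
have mz : measurable_fun setT zeta.
  by apply: continuous_measurable_rVR; have [/Ck_continuous] := Cz 0%N.
have mrz : measurable_fun setT (fun x => up x * ramp 1 (zeta x)).
  apply: measurable_funM; first exact: measurable_up.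
  apply: (measurableT_comp (f := ramp 1)) => //.
  exact: continuous_measurable_fun (@continuous_ramp 1).
have c0 : 0 < ramp (R := R) 1 1 by exact: ramp_gt0.
have mup : measurable_fun setT (fun x => (up x * ramp 1 (zeta x))%:E).
  exact/measurable_EFinP.
have r0 x : 0 <= up x * ramp 1 (zeta x) by rewrite mulr_ge0 ?ramp_ge0.
have Fat : (\int[leb d]_x (up x * ramp 1 (zeta x))%:E <= (2 * J)%:E)%E.
  apply: fatou_ae _ _ mrz r0 _ wJ.
  - move=> n; apply: measurable_funM; first exact: measurable_up.
    apply: (measurableT_comp (f := ramp 1)).
      exact: continuous_measurable_fun (@continuous_ramp 1).
    apply: measurable_funB => //; apply: continuous_measurable_rVR.
    by have [/Ck_continuous] := CG n 0%N.
  - by move=> n x; rewrite mulr_ge0 ?ramp_ge0.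
  - apply: filterS cvG => x Gx; apply: cvgM; first exact: cvg_cst.
    have c : zeta x - Gam n x @[n --> \oo] --> zeta x.
      by rewrite -[X in _ --> X]subr0; apply: cvgB => //; exact: cvg_cst.
    exact: (cvg_comp _ _ c (@continuous_ramp 1 (zeta x))).
pose Qa := [set x : 'rV[R]_d | `|x| <= a].
have mQa : measurable Qa by exact: measurable_norm_le.
rewrite -(integral_mul_indic _ mQa).
apply: (@le_lt_trans _ _
  (\int[leb d]_x ((ramp 1 1)^-1%:E * (up x * ramp 1 (zeta x))%:E))%E).
  apply: ge0_le_integral => //.
  - by move=> x _; rewrite mule_ge0 ?lee_fin.
  - apply: emeasurable_funM; first by apply/measurable_EFinP; exact: measurable_up.
    by apply/measurable_EFinP; exact: measurable_indic.
  - exact: measurable_funeM.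
  - move=> x _; rewrite -!EFinM lee_fin indicE.
    case: (boolP (x \in Qa)) => [|_]; last by rewrite mulr0 mulr_ge0// invr_ge0 ltW.
    by rewrite inE /= => xa; rewrite /zeta bump_eq1// mulr1 mulrCA mulVf ?mulr1// gt_eqF.
have r0E x : setT x -> (0 <= (up x * ramp 1 (zeta x))%:E)%E by rewrite lee_fin.
rewrite (ge0_integralZl _ _ mup r0E)//; last by rewrite lee_fin invr_ge0 ltW.
apply: lte_mul_pinfty; rewrite ?lee_fin ?invr_ge0 ?(ltW c0)//.
by apply: le_lt_trans Fat _; rewrite ltry.
Qed.
(** The factor 16 leaves room for all the multiples of a that occur later, such as the radius 8 r in
    [tails_fill]. *)
Lemma exists_cube : exists2 a : R, 0 < a & [set x | `|x| <= 16 * a] `<=` D.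
Proof.
have /nbhs_normP[r /= r0 rD] := open_nbhs_nbhs (conj oD D0).
exists (r / 2 / 16); first by rewrite !divr_gt0.
move=> x /= xr; apply: rD => /=; rewrite sub0r normrN; apply: (le_lt_trans xr).
by rewrite mulrCA divff ?mulr1// ltr_pdivrMr// ltr_pMr// ltr1n.
Qed.

Lemma compact_annulusI K (a : R) : compact K -> compact (K `&` [set x | a <= `|x|]).
Proof.
move=> cK; apply: compact_closedI => //.
rewrite (_ : mkset _ = ~` [set x | `|x| < a]); first exact/open_closedC/open_norm_lt.
by apply/seteqP; split => x /=; rewrite leNgt => /negP.
Qed.

Lemma annulusI_sub K (a : R) : 0 < a -> K `<=` D -> K `&` [set x | a <= `|x|] `<=` V0.
Proof.
move=> a0 KD x [Kx /= xa]; split; first exact: KD.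
by move=> /= x0; move: xa; rewrite x0 normr0 leNgt a0.
Qed.

Lemma integral_up_lty K : compact K -> K `<=` D ->
  (\int[leb d]_(x in K) (up x)%:E < +oo)%E.
Proof.
move=> cK KD; have [a a0 aD] := exists_cube.
have a20 : 0 < 2 * a by rewrite mulr_gt0.
pose K1 := K `&` [set x | `|x| < a]; pose K2 := K `&` [set x | a <= `|x|].
have mK := compact_measurable_rV cK.
have cK2 : compact K2 by exact: compact_annulusI.
have mK1 : measurable K1 by apply: measurableI => //; exact: measurable_norm_lt.
have mK2 := compact_measurable_rV cK2.
have KE : K = K1 `|` K2.
  by rewrite -setIUr [X in K `&` X](_ : _ = setT) ?setIT// -subTset => x _ /=; case: ltP; [left|right].
have mE A : measurable_fun A (fun x => (up x)%:E).
  by apply/measurable_EFinP; apply: measurable_funTS; exact: measurable_up.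
rewrite KE ge0_integral_setU//; last 2 first.
- by move=> x _; rewrite lee_fin powR_ge0.
- apply/disj_setPS => x [[_ /= h1] [_ /= h2]].
  by move: h1; rewrite ltNge h2.
apply: lte_add_pinfty; last by apply: uLp0 => //; exact: annulusI_sub.
have aD2 : [set x | `|x| <= 2 * a] `<=` D.
  by move=> x /= xa; apply: aD => /=; apply: (le_trans xa); rewrite ler_pM2r// ler_nat.
apply: le_lt_trans (integral_up_cube a0 aD2); apply: ge0_subset_integral => //.
- exact: measurable_norm_le.
- by move=> x _; rewrite lee_fin powR_ge0.
- by move=> x [_ /= /ltW].
Qed.

(** The part of K away from 0 is covered by the hypothesis. For the cube of radius r around 0: seen
    from |x| <= 8 r, far jumps have finite mass and u is locally integrable; seen from |x| > 8 r,
    stability bounds its mass by that of the annulus A, a compact subset of the punctured set. The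
    pair (b', m) is arbitrary because both the measure of the equation and its reflection are
    needed. *)
Lemma tails_fill (b' : 'rV[R]_d) (m : {measure set 'rV[R]_d -> \bar R}) :
  levy_measure m -> strictly_stable s b' m -> tails m V0 u -> tails m D u.
Proof.
move=> hm hst' tm K c cK KD c0; have [r r0 rD] := exists_cube.
pose K2 := K `&` [set x | r <= `|x|].
have cK2 : compact K2 by exact: compact_annulusI.
pose Q (a : R) := [set x : 'rV[R]_d | `|x| <= a].
have mQ a : measurable (Q a) by exact: measurable_norm_le.
pose A := Q (6 * r) `&` [set x | 2 * r <= `|x|].
have cQ (a : R) : compact (Q a) by exact: compact_norm_le.
have cA : compact A by exact: compact_annulusI.
have r20 : 0 < 2 * r by rewrite mulr_gt0.
have QD (a : R) : a <= 16 -> Q (a * r) `<=` D.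
  by move=> a16 x /= xa; apply: rD => /=; apply: (le_trans xa); rewrite ler_pM2r.
have AV : A `<=` V0 by apply: annulusI_sub => //; apply: QD; rewrite ler_nat.
have mK := compact_measurable_rV cK; have mK2 := compact_measurable_rV cK2.
have mA := compact_measurable_rV cA.
have fin1 : m [set y | c <= enorm y] \is a fin_num by rewrite ge0_fin_numE//; exact: nu_far_lty.
pose q := fine (m [set y | c <= enorm y]).
have q0 : 0 <= q by rewrite fine_ge0.
have far_le x : (far_mass m c K x <=
    q%:E * (\1_(Q (8 * r)) x)%:E + far_mass m (2 * r) A x + far_mass m c K2 x)%E.
  have KE : K `<=` Q r `|` K2.
    by move=> z Kz; have [h|h] := leP `|z| r; [left|right; split => //=; exact: ltW].
  have mQK : measurable (Q r `|` K2) by exact: measurableU.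
  apply: (le_trans (far_mass_le _ x mK mQK (lexx c) KE)).
  apply: (le_trans (far_massU _ _ _ (mQ r) mK2)); rewrite leeD2r//.
  rewrite indicE; case: (boolP (x \in Q (8 * r))) => [_|].
    rewrite mule1 /q fineK//; apply: (@le_trans _ _ (m [set y | c <= enorm y])).
      exact: far_mass_lty.
    by rewrite leeDl.
  rewrite notin_setE /= => /negP; rewrite -ltNge => xr; rewrite mule0 add0e.
  apply: (@le_trans _ _ (m [set y | `|x + y| <= r])).
    apply: le_measure; rewrite ?inE; [exact: measurable_far_set| |by move=> y []].
    exact: (measurable_translate x (mQ r)).
  apply: (le_trans (ball_le_annulus hm s0 hst' r0 (ltW xr))).
  apply: le_measure; rewrite ?inE; first exact: (measurable_translate x (measurable_annulus _ _)).
    exact: measurable_far_set.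
  move=> y /= /andP[h1 h2]; split; last by split.
  apply: le_trans (norm_le_enorm y); move: (lerB_normD x y).
  move: xr h2; move: `|x| `|y| `|x + y| => i j k; lra.
have pu x : (0 <= `|u x|%:E)%E by [].
have m1 : measurable_fun setT (fun x => (`|u x|%:E * (\1_(Q (8 * r)) x)%:E)%E).
  apply: emeasurable_funM; apply/measurable_EFinP; last exact: measurable_indic.
  exact: measurableT_comp.
have m2 := measurable_tail_integrand hm r20 mfu cA.
have m3 := measurable_tail_integrand hm c0 mfu cK2.
pose g1 x := (q%:E * (`|u x|%:E * (\1_(Q (8 * r)) x)%:E))%E.
pose g2 x := (`|u x|%:E * far_mass m (2 * r) A x)%E.
pose g3 x := (`|u x|%:E * far_mass m c K2 x)%E.
have mg1 : measurable_fun setT g1 by exact: measurable_funeM.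
have p1' x : (0 <= `|u x|%:E * (\1_(Q (8 * r)) x)%:E)%E by rewrite mule_ge0 ?lee_fin.
have g10 x : (0 <= g1 x)%E by rewrite /g1 mule_ge0.
have g20 x : (0 <= g2 x)%E by rewrite /g2 mule_ge0.
have g30 x : (0 <= g3 x)%E by rewrite /g3 mule_ge0.
apply: (@le_lt_trans _ _ (\int[leb d]_x (g1 x + g2 x + g3 x))%E).
  apply: ge0_le_integral => //.
  - by move=> x _; rewrite mule_ge0.
  - exact: measurable_tail_integrand.
  - by apply: emeasurable_funD => //; exact: emeasurable_funD.
  - move=> x _; have qi : (0 <= q%:E * (\1_(Q (8 * r)) x)%:E)%E by rewrite mule_ge0 ?lee_fin.
    rewrite /g1 /g2 /g3 muleCA -ge0_muleDr// -ge0_muleDr ?adde_ge0//.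
    exact: lee_wpmul2l.
have g120 x : setT x -> (0 <= g1 x + g2 x)%E by rewrite adde_ge0.
have mg12 : measurable_fun setT (fun x => g1 x + g2 x)%E by exact: emeasurable_funD.
rewrite ge0_integralD// ge0_integralD//.
rewrite (ge0_integralZl _ _ m1)// ?lee_fin//.
apply: lte_add_pinfty; last exact: tm (annulusI_sub r0 KD) c0.
apply: lte_add_pinfty; last exact: tm.
apply: lte_mul_pinfty; rewrite ?lee_fin//.
rewrite integral_mul_indic//; under eq_integral => x _ do rewrite ger0_norm//.
apply: integral_u_lty => //; apply: integral_up_lty => //.
by apply: QD; rewrite ler_nat.
Qed.
Let tuD : tails mu D u.
Proof. exact: tails_fill hmu hst tu0. Qed.

Let uL1 K : compact K -> K `<=` D -> (\int[leb d]_(x in K) (u x)%:E < +oo)%E.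
Proof. by move=> cK KD; apply: integral_u_lty => //; exact: integral_up_lty. Qed.

Lemma integrable_u_levy eta : Cck 2 D eta ->
  (leb d).-integrable setT (EFin \o (fun x => u x * L eta x)).
Proof. exact: integrable_levy_op. Qed.

Lemma integrable_up eta k : Cck k D eta ->
  (leb d).-integrable setT (EFin \o (fun x => up x * eta x)).
Proof.
move=> Ce; have [Ck_e cK KD] := Ce; have c := Ck_continuous Ck_e.
have [M M0 eM] := Cck_bounded_supp Ce; have [A A0 eA] := continuous_bounded_supp c eM.
apply: (integrable_bounded_supp measurable_up _ _ eA (K := supp eta)).
- by move=> x; exact: powR_ge0.
- exact: continuous_measurable_rVR.
- by move=> x; exact: supp_eq0.
- exact: compact_measurable_rV.
- exact: integral_up_lty.
Qed.

Lemma pow2_inv_cvg0 : 1 / (2 ^ n.+1)%:R @[n --> \oo] --> (0 : R).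
Proof.
apply: (squeeze_cvgr _ (@cvg_cst _ (0 : R) _ _ _) (@cvg_harmonic R)).
apply: nearW => n; have /andP[-> _] /= := pow2_inv_itv n.
by rewrite div1r lef_pV2 ?posrE ?ltr0n ?expn_gt0// ler_nat ltnW// ltn_expl.
Qed.

(** The limit of [polar_test] as Gam tends to 0 and the ramp sharpens. The dominating functions, u^p
    zeta and a multiple of u on the support of zeta, are integrable since u^p is now known to be
    integrable near 0. Where zeta = 0 the approximants vanish for every n, whence the indicator. *)
Lemma residual_le0 zeta : Ccinfty D zeta -> (forall x, 0 <= zeta x) ->
  \int[leb d]_x (up x * zeta x) +
  \int[leb d]_x (u x * (\1_[set y | 0 < zeta y] x * L zeta x)) <= 0.
Proof.
move=> Cz z0; have CzT k : Cck k setT zeta := Cck_setT (Cz k).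
have M0 : 0 < zeta 0 + 1 by rewrite ltr_wpDl.
have [Gam [CG G0 MG LG cvG]] := exists_polar_seq M0.
have zG n : zeta 0 < Gam n 0 by apply: lt_le_trans (MG n); rewrite ltrDl.
have cz : continuous zeta by case: (Cz 0%N) => /Ck_continuous.
have mz : measurable_fun setT zeta by exact: continuous_measurable_rVR.
have mG n : measurable_fun setT (Gam n).
  by apply: continuous_measurable_rVR; have [/Ck_continuous] := CG n 0%N.
have mLz : measurable_fun setT (L zeta).
  by apply: continuous_measurable_rVR; exact: (levy_op_continuous mY hgen (CzT 2%N)).
have [B B0 LB] := levy_op_bounded mY hgen (CzT 2%N).
have [M _ zM] := Cck_bounded_supp (Cz 0%N).
have [A A0 zA] := continuous_bounded_supp cz zM.
have up0 x : 0 <= up x by exact: powR_ge0.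
have [_ cK KD] := Cz 0%N; have mK := compact_measurable_rV cK.
have mP : measurable [set y | 0 < zeta y].
  by have := mz measurableT _ (measurable_itv `]0, +oo[); rewrite setTI set_itvoy.
pose m n : R := n.+1%:R.
have m0 n : 0 < m n by [].
pose F n x := up x * ramp (m n) (zeta x - Gam n x).
pose G n x := u x * (dramp (m n) (zeta x - Gam n x) *
  (L zeta x - Gam n x - 1 / (2 ^ n.+1)%:R)).
have star n := polar_test Cz z0 (CG n) (G0 n) (zG n) (pow2_inv_itv n) (LG n) (m0 n).
have mF n : measurable_fun setT (F n).
  by have [/integrableP[/measurable_EFinP]] := star n.
have mGn n : measurable_fun setT (G n).
  by have [_ /integrableP[/measurable_EFinP]] := star n.
have cF : {ae leb d, forall x, F n x @[n --> \oo] --> up x * zeta x}.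
  apply: filterS cvG => x Gx; apply: cvgM; first exact: cvg_cst.
  have c : zeta x - Gam n x @[n --> \oo] --> zeta x.
    by rewrite -[X in _ --> X]subr0; apply: cvgB => //; exact: cvg_cst.
  have := z0 x; rewrite le_eqVlt => /predU1P[zx0|zx]; last exact: ramp_cvg.
  rewrite -zx0; under eq_fun => n do rewrite ramp_le0 ?sub0r ?oppr_le0//.
  exact: cvg_cst.
have cG : {ae leb d, forall x, G n x @[n --> \oo] -->
    u x * (\1_[set y | 0 < zeta y] x * L zeta x)}.
  apply: filterS cvG => x Gx; apply: cvgM; first exact: cvg_cst.
  have c : zeta x - Gam n x @[n --> \oo] --> zeta x.
    by rewrite -[X in _ --> X]subr0; apply: cvgB => //; exact: cvg_cst.
  have := z0 x; rewrite le_eqVlt => /predU1P[zx0|zx].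
    rewrite indicE memNset ?mul0r; last by rewrite /= -zx0 ltxx.
    under eq_fun => n do rewrite -zx0 dramp_le0 ?sub0r ?oppr_le0// mul0r.
    exact: cvg_cst.
  rewrite indicE mem_set//; apply: cvgM; first exact: (dramp_cvg zx c).
  rewrite -[X in _ --> X]subr0; apply: cvgB; last exact: pow2_inv_cvg0.
  by rewrite -[X in _ --> X]subr0; apply: cvgB => //; exact: cvg_cst.
have Fle n x : `|F n x| <= up x * zeta x.
  rewrite ger0_norm; last by rewrite mulr_ge0 ?ramp_ge0.
  rewrite ler_wpM2l//; apply: le_trans (ramp_le _ (m0 n)) _.
  by rewrite ge_max z0 andbT lerBlDr lerDl.
pose g x := u x * ((B + A + 1) * \1_(supp zeta) x).
have C0 : 0 <= B + A + 1 by rewrite !addr_ge0 ?ltW.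
have Gle n x : `|G n x| <= g x.
  rewrite normrM (ger0_norm (u0 x)) ler_wpM2l//.
  have [t0|t0] := leP (zeta x - Gam n x) 0.
    by rewrite dramp_le0// mul0r normr0 mulr_ge0// indicE.
  have sx : supp zeta x.
    apply: contrapT => /supp_eq0 zx; move: t0.
    by rewrite zx sub0r oppr_gt0 ltNge G0.
  rewrite indicE mem_set// mulr1 normrM (ger0_norm (dramp_ge0 _ _)) -[leRHS]mul1r.
  apply: ler_pM; rewrite ?dramp_ge0 ?dramp_le1 ?normr_ge0//.
  have /andP[e0 e1] := pow2_inv_itv n.
  apply: (le_trans (ler_normB _ _)); rewrite (ger0_norm e0) lerD//.
  apply: (le_trans (ler_normB _ _)); rewrite (ger0_norm (G0 _ _)) lerD//.
  by move: t0; rewrite subr_gt0 => /ltW /le_trans; apply; exact: le_trans (ler_norm _) (zA x).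
have ig : (leb d).-integrable setT (EFin \o g).
  apply: (integrable_bounded_supp mfu u0 _ _ _ mK (uL1 cK KD) (C := B + A + 1)).
  - by apply: measurable_funM => //; exact: measurable_indic.
  - move=> x; rewrite ger0_norm ?mulr_ge0// indicE.
    by case: (_ \in _); rewrite ?mulr1 ?mulr0.
  - by move=> x h; rewrite indicE memNset// mulr0.
have mf1 : measurable_fun setT (fun x => up x * zeta x).
  by apply: measurable_funM => //; exact: measurable_up.
have mf2 : measurable_fun setT (fun x => u x * (\1_[set y | 0 < zeta y] x * L zeta x)).
  by do 2 apply: measurable_funM => //; exact: measurable_indic.
have [_ c1] := Rintegral_cvg_ae mF mf1 cF (integrable_up (Cz 0%N)) Fle.
have [_ c2] := Rintegral_cvg_ae mGn mf2 cG ig Gle.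
move: c1 c2; set I1 := \int[leb d]_x (_ * zeta x); set I2 := \int[leb d]_x _ => c1 c2.
have c : \int[leb d]_x F n x + \int[leb d]_x G n x @[n --> \oo] --> I1 + I2.
  exact: cvgD c1 c2.
apply: (@cvgr_to_le _ _ _ _ _ _ 0 c).
by apply: nearW => n; have [] := star n.
Qed.

(** * The distribution - L u - u^p on D as a multiple of the Dirac mass *)

Definition residual eta : R :=
  - (\int[leb d]_x (u x * L eta x)) - \int[leb d]_x (up x * eta x).

Lemma residualD f g : Ccinfty D f -> Ccinfty D g ->
  residual (f + g) = residual f + residual g.
Proof.
move=> Cf Cg.
have E1 : (fun x : 'rV[R]_d => u x * L (f + g) x) = (fun x => u x * L f x + u x * L g x).
  apply/funext => x.
  by rewrite (levy_opD b hmu x (Cck_setT (Cf 2%N)) (Cck_setT (Cg 2%N))); exact: mulrDr.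
have E2 : (fun x : 'rV[R]_d => up x * (f + g) x) = (fun x => up x * f x + up x * g x).
  by apply/funext => x; exact: mulrDr.
have J1 := RintegralD measurableT (integrable_u_levy (Cf 2%N)) (integrable_u_levy (Cg 2%N)).
have J2 := RintegralD measurableT (integrable_up (Cf 2%N)) (integrable_up (Cg 2%N)).
have comb (i i1 i2 j j1 j2 : R) : i = i1 + i2 -> j = j1 + j2 ->
  - i - j = (- i1 - j1) + (- i2 - j2) by move=> -> ->; rewrite !opprD addrACA.
exact: (comb _ _ _ _ _ _ (etrans (congr1 (fun h => \int[leb d]_x h x) E1) J1)
  (etrans (congr1 (fun h => \int[leb d]_x h x) E2) J2)).
Qed.

Lemma residualZ (a : R) f : Ccinfty D f -> residual (fun x => a * f x) = a * residual f.
Proof.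
move=> Cf.
have E1 : (fun x : 'rV[R]_d => u x * L (fun z => a * f z) x) = (fun x => a * (u x * L f x)).
  apply/funext => x.
  by rewrite (levy_opZ b hmu a x (Cck_setT (Cf 2%N))); exact: mulrCA.
have E2 : (fun x : 'rV[R]_d => up x * (a * f x)) = (fun x => a * (up x * f x)).
  by apply/funext => x; exact: mulrCA.
have J1 := RintegralZl a measurableT (integrable_u_levy (Cf 2%N)).
have J2 := RintegralZl a measurableT (integrable_up (Cf 2%N)).
have comb (i i1 j j1 : R) : i = a * i1 -> j = a * j1 -> - i - j = a * (- i1 - j1).
  by move=> -> ->; rewrite mulrBr mulrN.
exact: (comb _ _ _ _ (etrans (congr1 (fun h => \int[leb d]_x h x) E1) J1)
  (etrans (congr1 (fun h => \int[leb d]_x h x) E2) J2)).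
Qed.

Lemma residual_eq0 f : Ccinfty V0 f -> residual f = 0.
Proof.
move=> Cf; have := equ Cf; rewrite /residual.
move: (\int[leb d]_x (u x * L f x)) (\int[leb d]_x (up x * f x)) => i j ij.
by rewrite -opprD ij oppr0.
Qed.

Lemma integrable_u_levy_indic (A : set 'rV[R]_d) eta : measurable A -> Cck 2 D eta ->
  (leb d).-integrable setT (EFin \o (fun x => u x * (\1_A x * L eta x))).
Proof.
move=> mA Ce; apply: (le_integrable measurableT _ _ (integrable_u_levy Ce)).
  apply/measurable_EFinP; apply: measurable_funM => //; apply: measurable_funM.
    exact: measurable_indic.
  by apply: continuous_measurable_rVR; exact: (levy_op_continuous mY hgen (Cck_setT Ce)).
move=> x _ /=; rewrite lee_fin !normrM ler_wpM2l// indicE.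
by case: (_ \in _); rewrite ?normr1 ?normr0 ?mul1r// mul0r.
Qed.

(** Completing the integral in [residual_le0] to the whole space leaves an error carried by the zero
    set of zeta. *)
Lemma residual_ge zeta : Ccinfty D zeta -> (forall x, 0 <= zeta x) ->
  0 <= residual zeta +
    \int[leb d]_x (u x * (\1_[set y | zeta y = 0] x * L zeta x)).
Proof.
move=> Cz z0; have := residual_le0 Cz z0; rewrite /residual.
have cz : continuous zeta by case: (Cz 0%N) => /Ck_continuous.
have mz : measurable_fun setT zeta by exact: continuous_measurable_rVR.
have mP : measurable [set y | 0 < zeta y].
  by have := mz measurableT _ (measurable_itv `]0, +oo[); rewrite setTI set_itvoy.
have mZ : measurable [set y | zeta y = 0].
  by have := mz measurableT _ (measurable_set1 0); rewrite setTI.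
have ind A mA := @integrable_u_levy_indic A zeta mA (Cz 2%N).
have E : \int[leb d]_x (u x * L zeta x) =
    \int[leb d]_x (u x * (\1_[set y | 0 < zeta y] x * L zeta x)) +
    \int[leb d]_x (u x * (\1_[set y | zeta y = 0] x * L zeta x)).
  rewrite -(RintegralD measurableT (ind _ mP) (ind _ mZ)).
  apply: eq_Rintegral => x _; rewrite -mulrDr -mulrDl !indicE.
  have := z0 x; rewrite le_eqVlt => /predU1P[zx|zx].
    by rewrite memNset ?mem_set ?add0r ?mul1r//= -zx ltxx.
  rewrite mem_set ?memNset ?addr0 ?mul1r//= => h; by move: zx; rewrite h ltxx.
rewrite E; move: (\int[leb d]_x _) (\int[leb d]_x _) (\int[leb d]_x _) => i j k; lra.
Qed.

Lemma ge0_of_addZ (a c : R) : (forall e, 0 < e -> 0 <= a + e * c) -> 0 <= a.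
Proof.
move=> H; rewrite leNgt; apply/negP => a0.
have c1 : 0 < `|c| + 1 by rewrite ltr_wpDl.
have e0 : 0 < - a / 2 / (`|c| + 1) by rewrite !divr_gt0// oppr_gt0.
have := H _ e0; have : - a / 2 / (`|c| + 1) * c <= - a / 2.
  rewrite mulrAC ler_pdivrMr// ler_wpM2l ?divr_ge0 ?oppr_ge0 ?ltW//.
  by rewrite (le_lt_trans (ler_norm _))// ltrDl.
by move: (_ * c) => q; lra.
Qed.

(* residual_ge is applied to zeta = eta * bump r + e * bump a, which vanishes
   exactly for |x| >= 2 a; then e -> 0 and r -> 0. *)
Lemma residual_ge0 eta : Ccinfty D eta -> 0 < eta 0 -> 0 <= residual eta.
Proof.
move=> Ce eta0; have [a a0 aD] := exists_cube.
have ce : continuous eta by case: (Ce 0%N) => /Ck_continuous.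
have CeT k : Cck k setT eta := Cck_setT (Ce k).
have [M M0 eM] := Cck_bounded_supp (Ce 0%N).
have [A A0 eA] := continuous_bounded_supp ce eM.
(* For |x| >= 2 a, 24 r0 <= 2 a provides the ratio 12 that [ball_mass_cvg0] asks between |x| and the
   radius 2 r0. Positivity of eta for |x| < 2 r0 makes eta times the bump nonnegative. *)
have [r0 [r00 ra epos]] : exists r0 : R, [/\ 0 < r0, 24 * r0 <= 2 * a &
    forall x, `|x| < 2 * r0 -> 0 < eta x].
  have oN : open (eta @^-1` [set t | 0 < t]).
    by apply: open_comp => [x _|]; [exact: ce|exact: open_gt].
  have /nbhs_normP[r /= r_gt0 H] := open_nbhs_nbhs (conj oN eta0).
  exists (Num.min (r / 2) (2 * a / 24)); split.
  - by rewrite lt_min !divr_gt0// mulr_gt0.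
  - by rewrite mulrC -ler_pdivlMr// ge_min lexx orbT.
  - move=> x xr; apply: H => /=; rewrite sub0r normrN; apply: (lt_le_trans xr).
    by rewrite mulrC -ler_pdivlMr// ge_min lexx.
pose rn (n : nat) : R := r0 / n.+1%:R.
have rn0 n : 0 < rn n by rewrite divr_gt0.
have rnr n : rn n <= r0 by rewrite ler_pdivrMr// ler_peMr ?(ltW r00)// ler1n.
have aD2 : [set x | `|x| <= 2 * a] `<=` D.
  by move=> x /= xa; apply: aD => /=; apply: (le_trans xa); rewrite ler_pM2r// ler_nat.
have Cba : Ccinfty D (bump (d := d) a) by exact: Ccinfty_bump.
pose h n x := eta x * bump (rn n) x.
have h_eq0 n x : 2 * rn n <= `|x| -> h n x = 0 by move=> xr; rewrite /h bump_eq0// mulr0.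
have h_ge0 n x : 0 <= h n x.
  have [xr|xr] := leP (2 * rn n) `|x|; first by rewrite h_eq0.
  rewrite mulr_ge0 ?bump_ge0// ltW// epos// (lt_le_trans xr)//.
  by rewrite ler_pM2l.
have hA n x : `|h n x| <= A.
  rewrite normrM -[leRHS]mulr1 ler_pM// ger0_norm ?bump_ge0//; exact: bump_le1.
have Ch n : Ccinfty D (h n).
  move=> k; have [Ck_e cK KD] := Ce k.
  apply: (CckI (CkM Ck_e (Ck_bump (rn n) k)) cK _ KD) => x /supp_eq0 e0.
  by rewrite /h /= -[LHS]/(eta x * _) e0 mul0r.
pose far := [set x : 'rV[R]_d | 2 * a <= `|x|].
(* The bump is 1 near 0, so eta - h n is a test function on the punctured set, where the residual
   vanishes. *)
have res_h n : residual (h n) = residual eta.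
  have Cd : Ccinfty V0 (eta - h n).
    move=> k; have [Ck_e cK KD] := Ce k; have [Ck_h _ _] := Ch n k.
    have A1 := compact_annulusI (a := rn n) cK.
    have A2 := annulusI_sub (rn0 n) KD.
    have A3 := CkB Ck_e Ck_h.
    apply: (CckI A3 A1 _ A2).
    move=> x hx; have [xr|xr] := leP (rn n) `|x|.
      by rewrite -[LHS]/(eta x - eta x * _) supp_eq0 ?mul0r ?subr0// => sx; apply: hx.
    by rewrite -[LHS]/(eta x - eta x * _) bump_eq1 ?mulr1 ?subrr// ltW.
  have CdD : Ccinfty D (eta - h n).
    by move=> k; have [c1 c2 c3] := Cd k; split => // x /c3 [].
  have E : eta = (eta - h n) + h n.
    by apply/funext => x; rewrite -[RHS]/(eta x - h n x + h n x) subrK.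
  by rewrite [in RHS]E residualD// (residual_eq0 Cd) add0r.
have mfar : measurable far.
  rewrite (_ : far = ~` [set x | `|x| < 2 * a]).
    by apply: measurableC; exact: measurable_norm_lt.
  by apply/seteqP; split => x; rewrite /far /= leNgt => /negP.
have rna n : 2 * rn n <= 2 * a.
  by move: ra (rnr n) r00; move: (rn n) => q; lra.
(* The added multiple of [bump a] fixes the zero set to [far] for all n; the zero set of h n alone
   would approach 0 as n grows. *)
have main n : 0 <= residual eta + \int[leb d]_x (u x * (\1_far x * L (h n) x)).
  apply: (@ge0_of_addZ _ (residual (bump a) +
      \int[leb d]_x (u x * (\1_far x * L (bump a) x)))) => e e0.
  have Ceb : Ccinfty D (fun x => e * bump a x) by move=> k; apply: CckZ; exact: Cba.
  pose z := h n + (fun x => e * bump a x).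
  have zE x : z x = h n x + e * bump a x by [].
  have Cz : Ccinfty D z by move=> k; apply: CckD; [exact: Ch|exact: Ceb].
  have z0 x : 0 <= z x by rewrite zE addr_ge0// mulr_ge0 ?bump_ge0// ltW.
  have farE : [set y | z y = 0] = far.
    apply/seteqP; split => x; rewrite /far /= zE.
      move=> zx; rewrite leNgt; apply/negP => xa.
      suff : 0 < h n x + e * bump a x by rewrite zx ltxx.
      by rewrite ltr_wpDl// mulr_gt0// bump_gt0.
    by move=> xa; rewrite (bump_eq0 a0 xa) mulr0 addr0 h_eq0// (le_trans (rna n)).
  have G1 : 0 <= residual z + \int[leb d]_x (u x * (\1_far x * L z x)).
    by rewrite -farE; exact: residual_ge.
  have Rz : residual z = residual eta + e * residual (bump a).
    by rewrite (residualD (Ch n) Ceb) (residualZ e Cba) res_h.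
  have E1 : (fun x : 'rV[R]_d => u x * (\1_far x * L z x)) =
      (fun x => u x * (\1_far x * L (h n) x) + e * (u x * (\1_far x * L (bump a) x))).
    apply/funext => x; have CbT := Cck_setT (Cba 2%N).
    have Lz := levy_opD b hmu x (Cck_setT (Ch n 2%N)) (Cck_setT (Ceb 2%N)).
    rewrite (levy_opZ b hmu e x CbT) in Lz.
    have dist (l l1 l2 u1 i1 : R) : l = l1 + e * l2 ->
      u1 * (i1 * l) = u1 * (i1 * l1) + e * (u1 * (i1 * l2)) by move=> ->; ring.
    exact: dist Lz.
  have i1 := integrable_u_levy_indic mfar (Ch n 2%N).
  have i2 := integrable_u_levy_indic mfar (Cba 2%N).
  have J1 := RintegralD measurableT i1 (integrable_EFinZ e i2).
  have J2 := RintegralZl e measurableT i2.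
  have comb (rz iz re rb j1 je j2 : R) : 0 <= rz + iz -> rz = re + e * rb ->
      iz = j1 + je -> je = e * j2 -> 0 <= re + j1 + e * (rb + j2).
    by move=> h0 e1 e2 e3; rewrite e1 e2 e3 in h0; rewrite mulrDr addrACA.
  exact: (comb _ _ _ _ _ _ _ G1 Rz (etrans (congr1 (fun h => \int[leb d]_x h x) E1) J1) J2).
pose Q := [set x : 'rV[R]_d | `|x| <= 2 * r0].
have mQ : measurable Q by exact: measurable_norm_le.
pose F n x := u x * (\1_far x * L (h n) x).
have far_fin x : far_mass mu a Q x \is a fin_num.
  rewrite ge0_fin_numE//; apply: le_lt_trans (far_mass_lty mu x a0 mQ) _.
  exact: nu_far_lty.
(* From a far x only the jumps into the cube of radius 2 rn count, and |h n| <= A. *)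
have Fle n x : `|F n x| <= u x * (\1_far x * (A * fine (mu [set y | (`|x + y| <= 2 * rn n)%R]))).
  rewrite /F normrM (ger0_norm (u0 x)) ler_wpM2l// normrM indicE.
  case: (boolP (x \in far)) => [|_]; last by rewrite normr0 !mul0r.
  rewrite inE /far /= => xfar; rewrite normr1 !mul1r.
  have xn y : `|x + y| <= 2 * rn n -> a <= `|y|.
    move=> hy; have := lerB_normD x y; move: ra (rnr n) xfar hy r00.
    by move: `|x + y| `|x| `|y| (rn n) => q1 q2 q3 q4; lra.
  have mE : measurable [set y | `|x + y| <= 2 * rn n].
    exact: (measurable_translate x (measurable_norm_le _)).
  have muE : mu [set y | `|x + y| <= 2 * rn n] \is a fin_num.
    rewrite ge0_fin_numE//; apply: le_lt_trans (nu_far_lty hmu a0).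
    apply: le_measure; rewrite ?inE//; first exact: measurable_enorm_ge.
    by move=> y /xn h1; apply: le_trans (norm_le_enorm y).
  rewrite -lee_fin EFinM fineK//.
  pose Qn := [set z : 'rV[R]_d | `|z| <= 2 * rn n].
  have mQn : measurable Qn by exact: measurable_norm_le.
  apply: (@le_trans _ _ (A%:E * far_mass mu a Qn x)%E).
    apply: levy_op_far_le => //.
    - by apply: continuous_measurable_rVR; have [/Ck_continuous] := Ch n 0%N.
    - have xr : 2 * rn n < `|x|.
        apply: (lt_le_trans _ xfar); move: ra (rnr n) r00 a0.
        by move: (rn n) => q; lra.
      by apply: filterS (near_norm_gt xr) => z /ltW; exact: h_eq0.
    - move=> y hy; have xy : `|x + y| <= 2 * rn n.
        by rewrite leNgt; apply/negP => /ltW /h_eq0 h1; move: hy; rewrite h1 eqxx.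
      by split => //; apply: le_trans (norm_le_enorm y); exact: xn.
  rewrite lee_wpmul2l ?lee_fin ?(ltW A0)//.
  by apply: le_measure; rewrite ?inE//; [exact: measurable_far_set|move=> y []].
pose E n x := mu [set y | (`|x + y| <= 2 * rn n)%R].
have E_le n x : far x -> (E n x <= far_mass mu a Q x)%E.
  move=> xfar; apply: le_measure; rewrite ?inE.
  - exact: (measurable_translate x (measurable_norm_le _)).
  - exact: measurable_far_set.
  - move=> y /= hy; split; last first.
      by apply: (le_trans hy); rewrite ler_pM2l.
    apply: le_trans (norm_le_enorm y); have := lerB_normD x y.
    move: ra (rnr n) xfar hy r00; rewrite /far /=.
    by move: `|x + y| `|x| `|y| (rn n) => q1 q2 q3 q4; lra.
have E_fin n x : far x -> E n x \is a fin_num.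
  move=> xfar; rewrite ge0_fin_numE//; apply: le_lt_trans (E_le n x xfar) _.
  by rewrite -ge0_fin_numE.
(* The dominating function is a tail integrand for a cube containing 0: this uses the tail condition
   on all of D. *)
pose g x := A * (u x * fine (far_mass mu a Q x)).
have Fg n x : `|F n x| <= g x.
  apply: (le_trans (Fle n x)); rewrite /g [leRHS]mulrCA ler_wpM2l// indicE.
  have A1 := ltW A0.
  case: (boolP (x \in far)) => [|_]; last by rewrite mul0r mulr_ge0 ?fine_ge0.
  rewrite inE mul1r => xfar; rewrite ler_wpM2l// fine_le//; first exact: E_fin.
  exact: E_le.
have ig : (leb d).-integrable setT (EFin \o g).
  apply: integrable_EFinZ.
  have mt := measurable_tail_integrand hmu a0 mfu (@compact_norm_le R d (2 * r0)).
  have gE : EFin \o (fun x => u x * fine (far_mass mu a Q x)) =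
      (fun x => `|u x|%:E * far_mass mu a Q x)%E.
    by apply/funext => x /=; rewrite EFinM fineK// ger0_norm.
  apply/integrableP; rewrite gE; split => //.
  under eq_integral => x _ do rewrite gee0_abs ?mule_ge0//.
  apply: tuD => //; first exact: compact_norm_le.
  move=> x xr; apply: aD2; apply: (le_trans xr).
  by move: ra r00; lra.
have mF n : measurable_fun setT (F n).
  by have /integrableP[/measurable_EFinP] := integrable_u_levy_indic mfar (Ch n 2%N).
have cF : {ae leb d, forall x, F n x @[n --> \oo] --> (0 : R)}.
  apply: aeW => x; have [xfar|xfar] := boolP (x \in far); last first.
    rewrite /F indicE (negbTE xfar); under eq_fun => n do rewrite mul0r mulr0.
    exact: cvg_cst.
  have xfar' : far x by rewrite inE in xfar.
  have c : E n x @[n --> \oo] --> 0%E.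
    have r20 : 0 < 2 * r0 by rewrite mulr_gt0.
    have x12 : 12 * (2 * r0) <= `|x| by apply: le_trans xfar'; move: ra; lra.
    have := ball_mass_cvg0 hmu s0 hst r20 x12.
    by under eq_fun => n do rewrite -mulrA.
  have c' : u x * (\1_far x * (A * fine (E n x))) @[n --> \oo] --> (0 : R).
    rewrite -[X in _ --> X](mulr0 (u x)); apply: cvgM; first exact: cvg_cst.
    rewrite -[X in _ --> X](mulr0 (\1_far x)); apply: cvgM; first exact: cvg_cst.
    rewrite -[X in _ --> X](mulr0 A); apply: cvgM; first exact: cvg_cst.
    exact: (fine_cvg c).
  apply/norm_cvg0P; apply: (squeeze_cvgr _ (@cvg_cst _ (0 : R) _ _ _) c').
  by apply: nearW => n; rewrite normr_ge0 Fle.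
have [_ cI] := Rintegral_cvg_ae mF (@measurable_cst _ _ _ _ _ (0 : R)) cF ig Fg.
have c : residual eta + \int[leb d]_x F n x @[n --> \oo] --> residual eta.
  rewrite -[X in _ --> X]addr0; apply: cvgD; first exact: cvg_cst.
  move: cI; rewrite (_ : \int[leb d]_x cst 0 x = 0)//.
  by rewrite /Rintegral integral0.
by apply: (@cvgr_to_ge _ _ _ _ _ _ 0 c); apply: nearW => n; exact: main.
Qed.

(** f + (e - f 0) bump takes the value e > 0 at 0, so its residual is nonnegative; e -> 0 gives one
    inequality, and the same for - f gives the other. *)
Lemma residualE (a : R) eta : 0 < a -> [set x | `|x| <= 2 * a] `<=` D ->
  Ccinfty D eta -> residual eta = eta 0 * residual (bump a).
Proof.
move=> a0 aD Ce; have Cb : Ccinfty D (bump (d := d) a) by exact: Ccinfty_bump.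
have b0 : bump (d := d) a 0 = 1 by rewrite bump_eq1// normr0 ltW.
have main f : Ccinfty D f -> f 0 * residual (bump a) <= residual f.
  move=> Cf; rewrite -subr_ge0; apply: (@ge0_of_addZ _ (residual (bump a))) => e e0.
  have Cz : Ccinfty D (fun x => (e - f 0) * bump a x) by move=> k; apply: CckZ; exact: Cb.
  have Cs : Ccinfty D (f + (fun x => (e - f 0) * bump a x)).
    by move=> k; apply: CckD; [exact: Cf|exact: Cz].
  have : 0 <= residual (f + (fun x => (e - f 0) * bump a x)).
    apply: residual_ge0 => //.
    by rewrite -[X in 0 < X]/(f 0 + (e - f 0) * bump a 0) b0 mulr1 subrKC.
  rewrite (residualD Cf Cz) (residualZ _ Cb).
  by move: (residual f) (residual _) => i j; rewrite mulrBl; lra.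
apply/eqP; rewrite eq_le main// andbT.
have CN : Ccinfty D (fun x => (-1) * eta x) by move=> k; apply: CckZ; exact: Ce.
have := main _ CN; rewrite (residualZ _ Ce).
by move: (residual eta) (residual _) (eta 0) => i j k; lra.
Qed.

(** * Sign of the mass, and its vanishing from the critical exponent on *)

Lemma residual_bump_ge0 (a : R) : 0 < a -> [set x | `|x| <= 2 * a] `<=` D ->
  0 <= residual (bump a).
Proof.
move=> a0 aD; apply: residual_ge0; first exact: Ccinfty_bump.
by rewrite bump_eq1 ?normr0 ?ltW.
Qed.

(* A balances the two terms of u <= A + A^(1 - p) u^p against the factor e^(-2s)
   coming from the scaling of L; hp makes the power of e in the first one
   nonnegative. *)
Lemma critical_exponents (e B : R) : 0 < e <= 1 -> 0 < B -> d%:R / (d%:R - 2 * s) <= p ->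
  let A := B * e `^ (- (2 * s / (p - 1))) in
  [/\ 0 < A, (e^-1) `^ (2 * s) * (A * (6 * e) ^+ d) <= 6 ^+ d * B &
      (e^-1) `^ (2 * s) * A `^ (1 - p) = B `^ (1 - p)].
Proof.
move=> /andP[e0 e1] B0 hp; set q := 2 * s / (p - 1); move=> A.
have p10 : 0 < p - 1 by rewrite subr_gt0.
have qE : q * (p - 1) = 2 * s by rewrite divfK// gt_eqF.
have eV : (e^-1) `^ (2 * s) = e `^ (- (2 * s)).
  by rewrite -powR_inv1 ?(ltW e0)// -powRrM mulN1r.
have eD r r' : e `^ r * e `^ r' = e `^ (r + r') by rewrite powRD// (gt_eqF e0) implybT.
split.
- by rewrite mulr_gt0// powR_gt0.
- rewrite eV /A exprMn -(powR_mulrn d (ltW e0)).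
  have -> : e `^ (- (2 * s)) * (B * e `^ (- q) * (6 ^+ d * e `^ d%:R)) =
      6 ^+ d * B * (e `^ (- (2 * s)) * e `^ (- q) * e `^ d%:R) by ring.
  rewrite !eD -[leRHS]mulr1 ler_wpM2l//.
    by rewrite mulr_ge0 ?(ltW B0)// exprn_ge0.
  rewrite -[leRHS](powRr0 e) ger_powR ?e0//.
  have h : d%:R <= p * (d%:R - 2 * s) by rewrite -ler_pdivrMr// subr_gt0.
  (* Equivalent to p >= d / (d - 2s). It makes the total exponent d - 2s - q nonnegative, so for e
     <= 1 the power of e is at most 1. *)
  have : q <= d%:R - 2 * s.
    by rewrite ler_pdivrMr//; move: h; move: (d%:R) => dd; lra.
  by lra.
- rewrite eV /A powRM ?(ltW B0) ?powR_ge0// -powRrM mulrCA eD.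
  have -> : - (2 * s) + - q * (1 - p) = 0.
    by rewrite -qE; ring.
  by rewrite powRr0 mulr1.
Qed.

Lemma bump_scale (e : R) : bump (d := d) e = fun z => bump 1 (e^-1 *: z).
Proof. by apply/funext => z; rewrite /bump invr1 scale1r. Qed.

Lemma leb_ball_indic (r A : R) : 0 <= r -> \int[leb d]_x (A * \1_[set y | `|y| <= r] x) =
  A * (2 * r) ^+ d.
Proof.
move=> r0; pose Q := [set y : 'rV[R]_d | `|y| <= r].
have mQ : measurable Q by exact: measurable_norm_le.
have lQ : leb d Q = ((2 * r) ^+ d)%:E.
  by rewrite -(leb_cube 0 r0); congr (leb d _); apply/seteqP; split => x; rewrite /Q /= addr0.
have I : (\int[leb d]_x (\1_Q x)%:E = ((2 * r) ^+ d)%:E)%E by rewrite integral_indic// setIT.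
have iQ : (leb d).-integrable setT (EFin \o \1_Q).
  apply/integrableP; split; first by apply/measurable_EFinP; exact: measurable_indic.
  by under eq_integral => x _ do rewrite gee0_abs ?lee_fin//; rewrite I ltry.
by rewrite (RintegralZl A measurableT iQ) /Rintegral I.
Qed.

(** Outside the cube of radius 3 e, L of the bump is nonnegative and helps; inside, scaling bounds
    it below by - C e^(- 2s). The u^p term of the residual has the favourable sign, and u is split
    with threshold A on that cube, whose volume is (6 e)^d. *)
Lemma residual_bump_le (a : R) : 0 < a -> [set x | `|x| <= 16 * a] `<=` D ->
  exists2 C : R, 0 < C & forall e A : R, 0 < e -> e <= a -> 0 < A ->
  residual (bump e) <= C * (e^-1) `^ (2 * s) * (A * (6 * e) ^+ d +
    A `^ (1 - p) * \int[leb d]_x (up x * \1_[set y | `|y| <= 3 * e] x)).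
Proof.
move=> a0 aD; have [C C0 LC] := levy_op_bounded mY hgen (Cck_bump (d := d) (r := 1) ltr01 2).
exists C => // e A e0 ea A0; pose Q := [set y : 'rV[R]_d | `|y| <= 3 * e].
have QD : Q `<=` D.
  move=> x xe; apply: aD; apply: (le_trans xe); apply: (@le_trans _ _ (3 * a)).
    by rewrite ler_pM2l.
  by rewrite ler_pM2r// ler_nat.
have eD : [set x | `|x| <= 2 * e] `<=` D.
  by move=> x /= xe; apply: QD; apply: (le_trans xe); rewrite ler_pM2r// ler_nat.
have Cb : Ccinfty D (bump (d := d) e) by exact: Ccinfty_bump.
have mQ : measurable Q by exact: measurable_norm_le.
have cQ : compact Q by exact: compact_norm_le.
pose c := C * (e^-1) `^ (2 * s).
have c0 : 0 <= c by rewrite mulr_ge0 ?powR_ge0 ?ltW.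
have ind01 x : `|\1_Q x : R| <= 1.
  by rewrite indicE; case: (_ \in _); rewrite ?normr1 ?normr0.
have indN x : ~ Q x -> \1_Q x = 0 :> R by move=> h; rewrite indicE memNset.
have mind : measurable_fun setT (\1_Q : 'rV[R]_d -> R) by exact: measurable_indic.
have iuQ : (leb d).-integrable setT (EFin \o (fun x => u x * \1_Q x)).
  exact: (integrable_bounded_supp mfu u0 mind ind01 indN mQ (uL1 cQ QD)).
have up0 x : 0 <= up x by exact: powR_ge0.
have iupQ : (leb d).-integrable setT (EFin \o (fun x => up x * \1_Q x)).
  exact: (integrable_bounded_supp measurable_up up0 mind ind01 indN mQ (integral_up_lty cQ QD)).
have iQ : (leb d).-integrable setT (EFin \o (\1_Q : 'rV[R]_d -> R)).
  apply/integrableP; split; first exact/measurable_EFinP.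
  under eq_integral => x _ do rewrite gee0_abs ?lee_fin//.
  by rewrite integral_indic// setIT; exact: leb_ball_lty.
have iL := integrable_u_levy (Cb 2%N).
have Llow x : 0 <= u x * L (bump e) x + c * (u x * \1_Q x).
  have E (l i : R) : u x * l + c * (u x * i) = u x * (l + c * i) by ring.
  rewrite E mulr_ge0//; have [xe|xe] := leP `|x| (3 * e).
    rewrite indicE mem_set// mulr1 -lerBlDr sub0r.
    have LE : L (bump e) x = (e^-1) `^ (2 * s) * L (bump 1) (e^-1 *: x).
      by rewrite bump_scale; apply: hst; [rewrite invr_gt0|exact: Cck_bump].
    rewrite LE /c mulrC -mulrN ler_wpM2l ?powR_ge0//.
    by have := LC (e^-1 *: x); rewrite ler_norml => /andP[].
  rewrite indN ?mulr0 ?addr0; last by rewrite /Q /= leNgt xe.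
  apply: levy_op_near0_ge0; last by move=> y; exact: bump_ge0.
  have xe2 : 2 * e < `|x| by apply: le_lt_trans xe; rewrite ler_pM2r// ler_nat.
  by apply: filterS (near_norm_gt xe2) => z /ltW; exact: bump_eq0.
have I1 : 0 <= \int[leb d]_x (u x * L (bump e) x) + c * \int[leb d]_x (u x * \1_Q x).
  rewrite -(RintegralZl c measurableT iuQ) -(RintegralD measurableT iL (integrable_EFinZ c iuQ)).
  by apply: Rintegral_ge0 => x _; exact: Llow.
have I2 : 0 <= \int[leb d]_x (up x * bump e x).
  by apply: Rintegral_ge0 => x _; rewrite mulr_ge0 ?bump_ge0.
have I3 : \int[leb d]_x (u x * \1_Q x) <=
    A * (6 * e) ^+ d + A `^ (1 - p) * \int[leb d]_x (up x * \1_Q x).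
  have -> : 6 * e = 2 * (3 * e) by rewrite mulrA -natrM.
  rewrite -leb_ball_indic ?mulr_ge0 ?(ltW e0)//.
  rewrite -(RintegralZl _ measurableT iupQ).
  rewrite -(RintegralD measurableT (integrable_EFinZ A iQ) (integrable_EFinZ _ iupQ)).
  apply: le_Rintegral => //.
    by apply: integrable_EFinD; exact: integrable_EFinZ.
  move=> x _; rewrite mulrA -mulrDl ler_wpM2r// le_add_powR// ltW//.
rewrite /residual -/c -/Q; move: I1 I2 (ler_wpM2l c0 I3).
move: (\int[leb d]_x _) (\int[leb d]_x _) (\int[leb d]_x _) => i j k.
by move: (A * _ + _) => q; lra.
Qed.

(** By [residualE] the residual of a bump does not depend on its radius. At the critical exponent
    the volume term does not tend to 0 with e, so A keeps a free factor B: first e -> 0, where the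
    integral of u^p over shrinking cubes vanishes, then B -> 0. *)
Lemma residual_critical (a : R) : 0 < a -> [set x | `|x| <= 2 * a] `<=` D ->
  d%:R / (d%:R - 2 * s) <= p -> residual (bump a) = 0.
Proof.
move=> a0 aD hp; apply/eqP; rewrite eq_le residual_bump_ge0// andbT.
have [r r0 rD] := exists_cube; have [C C0 HC] := residual_bump_le r0 rD.
pose r1 := Num.min r 1; have r10 : 0 < r1 by rewrite lt_min r0 ltr01.
pose e n := r1 / n.+1%:R : R.
have e0 n : 0 < e n by rewrite divr_gt0.
have er1 n : e n <= r1 by rewrite ler_pdivrMr// ler_peMr ?(ltW r10)// ler1n.
have er n : e n <= r by apply: (le_trans (er1 n)); rewrite ge_min lexx.
have e1 n : e n <= 1 by apply: (le_trans (er1 n)); rewrite ge_min lexx orbT.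
pose Q n := [set y : 'rV[R]_d | `|y| <= 3 * e n].
have up0 x : 0 <= up x by exact: powR_ge0.
have QD n : Q n `<=` D.
  move=> x xe; apply: rD; apply: (le_trans xe); apply: (@le_trans _ _ (3 * r)).
    by rewrite ler_pM2l.
  by rewrite ler_pM2r// ler_nat.
have mQ n : measurable (Q n) by exact: measurable_norm_le.
have mind n : measurable_fun setT (\1_(Q n) : 'rV[R]_d -> R) by exact: measurable_indic.
have ind01 n x : `|\1_(Q n) x : R| <= 1.
  by rewrite indicE; case: (_ \in _); rewrite ?normr1 ?normr0.
have indN n x : ~ Q n x -> \1_(Q n) x = 0 :> R by move=> h; rewrite indicE memNset.
have cQ n : compact (Q n) by exact: compact_norm_le.
pose F n x := up x * \1_(Q n) x.
have iF n : (leb d).-integrable setT (EFin \o F n).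
  exact: (integrable_bounded_supp measurable_up up0 (mind n) (ind01 n) (@indN n) (mQ n)
    (integral_up_lty (@cQ n) (@QD n))).
have mF n : measurable_fun setT (F n) by have /integrableP[/measurable_EFinP] := iF n.
have FF n x : `|F n x| <= F 0%N x.
  rewrite normrM (ger0_norm (up0 x)) /F ler_wpM2l// !indicE.
  case: (boolP (x \in Q n)) => [|_]; last by rewrite normr0.
  rewrite inE => xn; rewrite mem_set ?normr1// /Q /=; apply: (le_trans xn).
  by rewrite ler_pM2l// [leRHS]/e divr1.
have cF : {ae leb d, forall x, F n x @[n --> \oo] --> (0 : R)}.
  (* For d > 0 the origin is a null set; at any other point F n x is eventually 0. *)
  have d0 : (0 < d)%N.
    by move: sd; case: (d) => // h; move: s0 h; rewrite mulr0n; lra.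
  exists [set x | `|x + 0| <= 0]; split.
  - by rewrite (_ : mkset _ = [set x | `|x| <= 0]);
      [exact: measurable_norm_le|apply/seteqP; split => x /=; rewrite addr0].
  - by rewrite leb_cube// mulr0 expr0n eqn0Ngt d0.
  - move=> x; apply: contra_notP; rewrite /= addr0 => /negP; rewrite -ltNge => x0.
    have [N HN] : exists N : nat, 3 * r1 / `|x| < N.+1%:R.
      by exists (Num.truncn (3 * r1 / `|x|)); exact: truncnS_gt.
    apply: cvg_near_cst; exists N => // n /= Nn; rewrite /F indN ?mulr0// /Q /=.
    apply/negP; rewrite -ltNge /e mulrA ltr_pdivrMr// [ltRHS]mulrC -ltr_pdivrMr//.
    by apply: (lt_le_trans HN); rewrite ler_nat.
have [_ cI] := Rintegral_cvg_ae mF (@measurable_cst _ _ _ _ _ (0 : R)) cF (iF 0%N) FF.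
have cI0 : \int[leb d]_x F n x @[n --> \oo] --> (0 : R).
  move: cI; rewrite (_ : \int[leb d]_x cst 0 x = 0)//.
  by rewrite /Rintegral integral0.
have b0 n : residual (bump (e n)) = residual (bump a).
  rewrite (@residualE a)//; last apply: Ccinfty_bump => //.
    by rewrite bump_eq1 ?mul1r// normr0 ltW.
  by move=> x /= xe; apply: (QD n); apply: (le_trans xe); rewrite ler_pM2r// ler_nat.
have key (B : R) : 0 < B -> residual (bump a) <= C * (6 ^+ d * B).
  move=> B0; have kn n : residual (bump a) <=
      C * (6 ^+ d * B + B `^ (1 - p) * \int[leb d]_x F n x).
    have [A0 h1 h2] := critical_exponents (introT andP (conj (e0 n) (e1 n))) B0 hp.
    rewrite -(b0 n); apply: (le_trans (HC _ _ (e0 n) (er n) A0)).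
    rewrite -mulrA ler_wpM2l ?(ltW C0)// mulrDr lerD// mulrA h2.
    exact: lexx.
  have c : C * (6 ^+ d * B + B `^ (1 - p) * \int[leb d]_x F n x) @[n --> \oo] -->
      C * (6 ^+ d * B).
    apply: cvgM; first exact: cvg_cst.
    rewrite -[X in _ --> X]addr0; apply: cvgD; first exact: cvg_cst.
    rewrite -[X in _ --> X](mulr0 (B `^ (1 - p))); apply: cvgM => //; exact: cvg_cst.
  by apply: (@cvgr_to_ge _ _ _ _ _ _ _ c); apply: nearW.
rewrite -oppr_ge0; apply: (@ge0_of_addZ _ (C * 6 ^+ d)) => B B0.
by have := key B B0; rewrite mulrA [B * _]mulrC addrC subr_ge0.
Qed.
(** The statement on tails is exported for every stable pair (b', m), because the tail space
    involves both the measure [mu] of the section and its reflection. *)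
Lemma removable_singularity :
  [/\ forall K, compact K -> K `<=` D -> (\int[leb d]_(x in K) (up x)%:E < +oo)%E,
      forall b' (m : {measure set 'rV[R]_d -> \bar R}), levy_measure m ->
        strictly_stable s b' m -> tails m V0 u -> tails m D u,
      forall eta, Ccinfty D eta ->
        (leb d).-integrable setT (EFin \o (fun x => up x * eta x)) &
      exists k : R, [/\ 0 <= k,
        forall eta, Ccinfty D eta ->
          - (\int[leb d]_x (u x * L eta x)) = \int[leb d]_x (up x * eta x) + k * eta 0 &
        d%:R / (d%:R - 2 * s) <= p -> k = 0]].
Proof.
split; [exact: integral_up_lty|exact: tails_fill| |].
  by move=> eta Ce; exact: integrable_up (Ce 0%N).
have [a a0 aD] := exists_cube.
have aD2 : [set x | `|x| <= 2 * a] `<=` D.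
  by move=> x /= xa; apply: aD => /=; apply: (le_trans xa); rewrite ler_pM2r// ler_nat.
exists (residual (bump a)); split; first exact: residual_bump_ge0.
- move=> eta Ce.
  have comb (i j k e : R) : - i - j = e * k -> - i = j + k * e.
    by move=> h; rewrite [k * e]mulrC -h addrC subrK.
  exact: comb (residualE a0 aD2 Ce).
- exact: residual_critical.
Qed.

End removable_singularity.

Lemma Rintegral_supp (R : realType) (d : nat) (V : set 'rV[R]_d) (f g : 'rV[R]_d -> R) :
  (forall x, ~ V x -> g x = 0) ->
  (\int[leb d]_(x in V) (g x * f x)%:E = \int[leb d]_x (f x * g x)%:E)%E.
Proof.
move=> gV; rewrite integral_mkcond; apply: eq_integral => x _; rewrite patchE.
case: (boolP (x \in V)) => [_|]; first by rewrite mulrC.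
by rewrite notin_setE => /gV ->; rewrite mulr0.
Qed.

Theorem theorem6p5 (R : realType) (d : nat) (s : R)
    (hd : (1 <= d)%N) (hs : 0 < s < 1) (hsd : 2 * s < d%:R)
    (b : 'rV[R]_d) (lam : {finite_measure set 'rV[R]_d -> \bar R})
    (nu : {measure set 'rV[R]_d -> \bar R})
    (hlam : lam (~` sphere) = 0%E)
    (hnu : levy_measure nu) (hpolar : polar_form s lam nu)
    (hstable : strictly_stable s b nu)
    (Lambda : R) (hLambda : 0 < Lambda)
    (hnondeg : (Lambda%:E <= ereal_inf
       [set \int[lam]_(theta in sphere) (`|dot xi theta| `^ (2 * s))%:E
          | xi in sphere])%E)
    (dO : measure_display) (Omega : measurableType dO) (P : probability Omega R)
    (X : R -> Omega -> 'rV[R]_d)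
    (hX : levy_process P X) (hgen : generated_by P X (levy_op b nu))
    (hgreen : s < 2^-1 -> exists2 G : 'rV[R]_d -> 'rV[R]_d -> \bar R,
       green_function P X G & forall x y, (0 < G x y)%E)
    (D : set 'rV[R]_d) (hDbd : bounded_set D) (hDop : open D) (hD0 : D 0)
    (p : R) (hp : 1 < p)
    (u : 'rV[R]_d -> R) (hu0 : forall x, 0 <= u x)
    (hutail : tail_space nu (D `\ 0) u) (huLp : Lploc p (D `\ 0) u)
    (hueq : solves b nu (D `\ 0) u (density (fun x => u x `^ p))) :
  [/\ tail_space nu D u, Lploc p D u &
    exists k : R, [/\ 0 <= k,
      solves b nu D u
        (fun A => density (fun x => u x `^ p)%R A + k%:E * \d_(0 : 'rV[R]_d)%R A)%E &
      d%:R / (d%:R - 2 * s) <= p -> k = 0]].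
Proof.
have /andP[s0 _] := hs; have mu : measurable_fun setT u by case: hutail.
have hmu := levy_measure_refl hnu; have hst := strictly_stable_dual hnu hstable.
(* The dual operator is generated by - X, so that process takes the role of Y, with
   [refl_measure nu] in the role of [mu]. *)
have mX t : 0 <= t -> measurable_fun setT (fun w => - X t w).
  move=> t0; apply: (measurableT_comp (@oppr_measurable_rV R d)).
  exact: levy_measurable hX t t0.
have hgenD := generated_by_dual hnu hgen.
have [t1 t2] := tails_of_tail_space hd hDop hD0 hnu hutail.
have absE K : (\int[leb d]_(x in K) (`|u x| `^ p)%:E = \int[leb d]_(x in K) (u x `^ p)%:E)%E.
  by apply: eq_integral => x _; rewrite ger0_norm.
have uLp0 K : compact K -> K `<=` D `\ 0 -> (\int[leb d]_(x in K) (u x `^ p)%:E < +oo)%E.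
  by move=> cK KD; rewrite -absE; exact: huLp.2.
have up0 x : 0 <= u x `^ p by exact: powR_ge0.
have mup : measurable_fun setT (fun x => u x `^ p).
  exact: (measurableT_comp (measurable_powR p) mu).
have mV (V : set 'rV[R]_d) eta : Ccinfty V eta -> measurable_fun setT eta.
  by move=> Ce; apply: continuous_measurable_rVR; have [/Ck_continuous] := Ce 0%N.
have off (V : set 'rV[R]_d) eta : Ccinfty V eta -> forall x, ~ V x -> eta x = 0.
  by move=> Ce x Vx; have [_ _ KV] := Ce 0%N; apply: supp_eq0 => /KV.
have equ eta : Ccinfty (D `\ 0) eta ->
    \int[leb d]_x (u x * levy_op_dual b nu eta x) + \int[leb d]_x (u x `^ p * eta x) = 0.
  move=> Ce; have := hueq eta Ce; rewrite integral_density//.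
  - rewrite (Rintegral_supp _ (off _ _ Ce)) => h.
    have comb (i j : R) : - i = j -> i + j = 0 by move=> <-; rewrite subrr.
    exact: comb h.
  - by apply: open_measurable_rV; exact: open_punctured.
  - by apply: measurable_funTS; exact: mV Ce.
have [Lp fill iup [k [k0 kE kcrit]]] :=
  removable_singularity hmu mX hgenD s0 hsd hst hu0 mu hp hDop hD0 t2 uLp0 equ.
split.
(* The tails for [nu] are filled with the stable pair (b, nu), those for the reflection with the
   dual pair. *)
- apply: tail_space_of_tails => //.
    exact: fill hnu hstable t1.
  exact: fill hmu hst t2.
- split; first exact: measurable_funTS.
  by move=> K cK KD; rewrite absE; exact: Lp.
- exists k; split => // eta Ce; rewrite (kE _ Ce) integral_density_dirac//.
  + rewrite (Rintegral_supp _ (off _ _ Ce)) fineD//.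
    exact: integrable_fin_num (iup _ Ce).
  + exact: open_measurable_rV.
  + by apply: measurable_funTS; exact: mV Ce.
  + apply: (integrableS measurableT) => //; first exact: open_measurable_rV.
    by apply: eq_integrable (iup _ Ce) => // x _ /=; rewrite mulrC.
Qed.
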